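(* Let $p \in (0,1)$. There exists a small constant $\varepsilon_0 \in (0,1)$, depending only on $p$, such that for every $\alpha\in(0,1)$ and every $f \in C^{\alpha}(\mathbb{S}^{1})$ with $\|f-1\|_{C^{\alpha}(\mathbb{S}^{1})} \leq \varepsilon_0$, the planar $L_p$ Minkowski equation $$h_K^{1-p}\,(\nabla^2 h_K + h_K) = f \quad \text{on } \mathbb{S}^{1}$$ has a unique solution $K\in\mathcal{K}^2_o$. Moreover, the solution is positive and of class $C^{2,\alpha}$, i.e. $h_K>0$ on $\mathbb{S}^1$ and $h_K\in C^{2,\alpha}(\mathbb{S}^{1})$.
   Context: $\mathbb{S}^1$ is the unit circle in $\mathbb{R}^2$, $\mathcal{H}^1$ is one-dimensional Hausdorff measure (arc length), and $\nabla$ is the covariant derivative on $\mathbb{S}^1$. A convex body is a compact convex set with nonempty interior; $\mathcal{K}^2_o$ denotes the set of all convex bodies in $\mathbb{R}^2$ containing the origin (not necessarily in the interior). The support function of $K$ is $h_K(u)=\max\{u\cdot x : x\in K\}$, $u\in\mathbb{S}^1$. $S(K,\cdot)$ is the surface area measure of $K$ on $\mathbb{S}^1$: $S(K,\omega)=\mathcal{H}^1(\{x\in\partial K: N(x)\in\omega\})$ for Borel $\omega\subset\mathbb{S}^1$, where $N(x)$ is the outer unit normal of $\partial K$ at $x$ (defined for $\mathcal{H}^1$-a.e. $x\in\partial K$). A convex body $K\in\mathcal{K}^2_o$ is a solution of the equation if its $L_p$ surface area measure $h_K^{1-p}\,S(K,\cdot)$ equals $f\,\mathrm{d}\mathcal{H}^1$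 as measures on $\mathbb{S}^1$; when $h_K$ is of class $C^2$ and positive this is the displayed equation. *)

(* Defs.v *)
From HB Require Import structures.
From mathcomp Require Import all_boot all_order all_algebra.
From mathcomp Require Import all_classical all_reals all_analysis.

Set Implicit Arguments.
Unset Strict Implicit.
Unset Printing Implicit Defensive.

Import Order.TTheory GRing.Theory Num.Theory.
Import numFieldNormedType.Exports.

Local Open Scope classical_set_scope.
Local Open Scope ring_scope.

(* The plane is R * R: its library topology and its product sigma-algebra are
   the Euclidean topology and the Borel sets. Its library norm is the max norm,
   hence the Euclidean norm below. *)
Section Plane.
Variable R : realType.
Local Notation plane := (R * R)%type.

Definition dot (x y : plane) : R := x.1 * y.1 + x.2 * y.2.

Definition enorm (x : plane) : R := Num.sqrt (dot x x).

Definition S1 : set plane := [set u | enorm u = 1].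

End Plane.

Arguments S1 {R}.

Section Hausdorff.
Variable R : realType.
Local Notation plane := (R * R)%type.
Local Open Scope ereal_scope.

(* 0 is adjoined so that the empty set has diameter 0 and not -oo *)
Definition diam (A : set plane) : \bar R :=
  ereal_sup (0 |` [set (enorm (x.1 - x.2))%:E | x in A `*` A]).

Definition hausdorff1_delta (delta : R) (A : set plane) : \bar R :=
  ereal_inf [set \sum_(0 <= i <oo) diam (U i) | U in
    [set U : (set plane)^nat |
      A `<=` \bigcup_i U i /\ forall i, diam (U i) <= delta%:E]].

(* An outer measure on all subsets of the plane. [integral] accepts any set
   function and evaluates it only on measurable sets, so that \int[hausdorff1]
   is integration against the restriction to the Borel sets. *)
Definition hausdorff1 (A : set plane) : \bar R :=
  ereal_sup [set hausdorff1_delta delta A | delta in [set d : R | (0 < d)%R]].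

End Hausdorff.

Section ConvexBody.
Variable R : realType.
Local Notation plane := (R * R)%type.

Definition convex_body (K : set plane) : Prop :=
  [/\ compact K, convex_set K & K° !=set0].

Definition convex_body_o (K : set plane) : Prop := convex_body K /\ K 0.

(* For compact nonempty K the supremum is attained. *)
Definition support_fun (K : set plane) (u : plane) : R :=
  sup [set dot u x | x in K].

Definition bd (K : set plane) : set plane := closure K `\` K°.

Definition outer_normal (K : set plane) (x u : plane) : Prop :=
  S1 u /\ forall y, K y -> dot u y <= dot u x.

(* N(x) is defined and equal to u *)
Definition gauss_map_eq (K : set plane) (x u : plane) : Prop :=
  outer_normal K x u /\ forall v, outer_normal K x v -> v = u.

Definition surface_area (K omega : set plane) : \bar R :=
  hausdorff1 [set x | bd K x /\ exists2 u, omega u & gauss_map_eq K x u].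

Definition Lp_Minkowski_solution (p : R) (f : plane -> R) (K : set plane) :
    Prop :=
  convex_body_o K /\
  forall omega : set plane, measurable omega -> omega `<=` S1 ->
    (\int[surface_area K]_(u in omega) (support_fun K u `^ (1 - p))%:E =
     \int[@hausdorff1 R]_(u in omega) (f u)%:E)%E.

End ConvexBody.

(* A function on the circle is represented by a function on the plane, of which
   only the values on S1 are ever used. *)
Section Holder.
Variable R : realType.
Local Notation plane := (R * R)%type.
Local Open Scope ereal_scope.

Definition sup_norm (f : plane -> R) : \bar R :=
  ereal_sup [set `|f u|%:E | u in S1].

Definition holder_seminorm (alpha : R) (f : plane -> R) : \bar R :=
  ereal_sup [set (`|f x.1 - f x.2| / enorm (x.1 - x.2) `^ alpha)%R%:E | x in
    [set x : plane * plane | [/\ S1 x.1, S1 x.2 & x.1 <> x.2]]].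

Definition holder_norm (alpha : R) (f : plane -> R) : \bar R :=
  sup_norm f + holder_seminorm alpha f.

Definition holder (alpha : R) (f : plane -> R) : Prop :=
  holder_norm alpha f < +oo.

End Holder.

Section C2alpha.
Variable R : realType.
Local Notation plane := (R * R)%type.

(* the unit speed geodesic of S1 issued counterclockwise from u *)
Definition geodesic (u : plane) (t : R) : plane :=
  (cos t * u.1 - sin t * u.2, cos t * u.2 + sin t * u.1).

(* The component of the covariant derivative of h along the counterclockwise
   unit tangent field; as that field is parallel, iterating it twice gives the
   covariant Hessian. *)
Definition circle_derivable (h : plane -> R) : Prop :=
  forall u, S1 u -> derivable (fun t : R => h (geodesic u t)) 0 1.

Definition circle_derive (h : plane -> R) (u : plane) : R :=
  derive1 (fun t : R => h (geodesic u t)) 0.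

Definition C2holder (alpha : R) (h : plane -> R) : Prop :=
  [/\ circle_derivable h,
      circle_derivable (circle_derive h) &
      holder alpha (circle_derive (circle_derive h))].

End C2alpha.

(* Main.v *)
Require Import Defs.
From HB Require Import structures.
From mathcomp Require Import all_boot all_order all_algebra.
From mathcomp Require Import all_classical all_reals all_analysis.
From mathcomp Require Import measurable_realfun.
From mathcomp Require Import ring lra.

Set Implicit Arguments.
Unset Strict Implicit.
Unset Printing Implicit Defensive.

Import Order.TTheory GRing.Theory Num.Theory.
Import numFieldNormedType.Exports.

Local Open Scope classical_set_scope.
Local Open Scope ring_scope.


(** Along the angle [t] of a direction [cpt t = (cos t, sin t)], the equation reads
    [h'' + h = f h^(p-1)]. The proof relates it to the measure equation in both
    directions and solves it near the constant solution 1.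

    From measures to the differential equation. A solution has no corner: the
    open arc of the normals at a corner would carry no surface area, while the
    integral of [f] over it is positive ([solution_smooth]). Hence normals are
    unique, the surface area is a measure, and since the normals at the origin
    are exactly the zeros of [h], the support function has at most one zero per
    period. It has no edge in a direction with [h > 0] either: the edge would be
    an atom of the surface area ([solution_face]). The boundary is thus a curve
    parametrized by its normal where [h > 0]; comparing its length over short
    arcs with the integral of [f] gives the second derivative of [h]
    ([arc_comparison], [solution_derive2], [solution_circle_solution]).

    A priori estimate ([a_priori_near_one]). Nothing excludes beforehand that [h]
    vanishes. For [f] close to 1 the energy [h'^2 + h^2 - (2/p) h^p] is almost
    conserved, so [h] is bounded, and a phase of monotonicity that starts well
    below 1, possibly at a zero, ends well above 1, and conversely. Comparison
    with mirror images shows that such a phase is longer than [pi/2]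
    ([quarter_circle_rise]) and shorter than [pi] ([half_circle_rise]). Three
    consecutive phases then overlap with the phase that ends the period, which is
    monotone the other way. So [h] is uniformly close to 1, hence positive.

    Near 1 ([near_one_existence_uniqueness]). The linearized equation
    [v'' + (2 - p) v = g] has exactly one periodic solution, because the
    frequency is strictly between 1 and 2, and the remainder is a contraction
    for [f] close to 1. This gives existence and uniqueness of [h], and [h]
    determines the body ([support_inj]).

    From the differential equation to measures ([wulff_solution]). As
    [h'' + h > 0], the contact curve [h cpt + h' ctan] bounds the intersection of
    the half-planes given by [h], whose support function is [h]. Over short arcs
    the normal map is bi-Lipschitz with constants close to the radius of
    curvature, so the two measures of a Borel set agree up to a factor that
    tends to 1 with the length of the arcs.

    For the surface integrals one needs that the Hausdorff measure is countably
    additive on Borel sets ([sublevel_caratheodory]), and that lengths of curves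
    are controlled by Lipschitz maps ([hausdorff1_lipschitz]). The threshold does
    not depend on the exponent because the smallness of [f - 1] enters through
    the uniform norm; the exponent enters through the regularity of [h''], read
    off the equation ([near_one_C2holder]). *)
(** * Real calculus *)

Section Calculus.
Context {R : realType}.
Implicit Types (f g : R -> R) (a b c x y : R).

Lemma derive_add f g x a b : is_derive x 1 f a -> is_derive x 1 g b ->
  is_derive x 1 (fun t => f t + g t) (a + b).
Proof. by move=> ? ?; exact: is_deriveD. Qed.

Lemma derive_opp f x a : is_derive x 1 f a ->
  is_derive x 1 (fun t => - f t) (- a).
Proof. by move=> ?; exact: is_deriveN. Qed.

Lemma derive_mul f g x a b : is_derive x 1 f a -> is_derive x 1 g b ->
  is_derive x 1 (fun t => f t * g t) (a * g x + f x * b).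
Proof.
move=> df dg; apply: (is_derive_eq (is_deriveM df dg)).
by rewrite addrC; congr (_ + _); exact: mulrC.
Qed.

Lemma derive_const c x : is_derive x 1 (fun=> c) 0.
Proof. exact: is_derive_cst. Qed.

Lemma derive_ident x : is_derive x 1 (fun t => t) 1.
Proof. exact: is_derive_id. Qed.

Lemma derive_pow2 f x a : is_derive x 1 f a ->
  is_derive x 1 (fun t => f t ^+ 2) (2 * f x * a).
Proof.
move=> df; have := derive_mul df df.
under eq_fun do rewrite -expr2.
by move/is_derive_eq; apply; ring.
Qed.

Lemma derive_chain f g x a b : is_derive (g x) 1 f a -> is_derive x 1 g b ->
  is_derive x 1 (fun t => f (g t)) (a * b).
Proof. by move=> df dg; exact: is_derive1_comp. Qed.

Lemma derive_sin g x b : is_derive x 1 g b ->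
  is_derive x 1 (fun t => sin (g t)) (cos (g x) * b).
Proof. by move=> dg; apply: derive_chain. Qed.

Lemma derive_cos g x b : is_derive x 1 g b ->
  is_derive x 1 (fun t => cos (g t)) (- sin (g x) * b).
Proof. by move=> dg; apply: derive_chain. Qed.

Lemma derive_powR g x b s : 0 < g x -> is_derive x 1 g b ->
  is_derive x 1 (fun t => g t `^ s) (s * g x `^ (s - 1) * b).
Proof.
by move=> gx dg; exact: (derive_chain (is_derive1_powR s gx) dg).
Qed.

End Calculus.

Ltac derive_step :=
  lazymatch goal with
  | |- is_derive _ _ (fun t => @?f t + @?g t) _ => apply (@derive_add _ f g)
  | |- is_derive _ _ (fun t => - @?f t) _ => apply (@derive_opp _ f)
  | |- is_derive _ _ (fun t => @?f t * @?g t) _ => apply (@derive_mul _ f g)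
  | |- is_derive _ _ (fun t => (@?f t) ^+ 2) _ => apply (@derive_pow2 _ f)
  | |- is_derive _ _ (fun t => t) _ => apply derive_ident
  | |- is_derive _ _ (fun t => sin (@?f t)) _ => apply (@derive_sin _ f)
  | |- is_derive _ _ (fun t => cos (@?f t)) _ => apply (@derive_cos _ f)
  | |- is_derive _ _ (fun t => (@?f t) `^ _) _ => apply (@derive_powR _ f)
  | |- is_derive _ _ (fun t => ?c) _ => apply (@derive_const _ c)
  end.
(** Computes a derivative by the structure of the function; what remains is
    the derivatives of its unknown parts and the equation between the computed
    and the announced value. *)
Ltac derive := eapply is_derive_eq; [repeat (first [eassumption | derive_step])|].

Section Monotonicity.
Context {R : realType}.
Implicit Types (f df g : R -> R) (a b c x y e r : R).

Lemma derive_continuous f x l : is_derive x 1 f l -> {for x, continuous f}.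
Proof.
by move=> [dfx _]; apply: differentiable_continuous; apply/derivable1_diffP.
Qed.

Lemma derive_deriv1 f x l : is_derive x 1 f l -> derive1 f x = l.
Proof. by move=> dfx; rewrite derive1E; exact: derive_val. Qed.

Lemma derive_uniq f x l m : is_derive x 1 f l -> is_derive x 1 f m -> l = m.
Proof. by move=> h1 h2; rewrite -(derive_deriv1 h1) (derive_deriv1 h2). Qed.

(** Derivatives are used through first order estimates: the support function is
    differentiated by squeezing, where no formula is available. *)
Lemma deriveP f x l :
  is_derive x 1 f l <->
  (forall e, 0 < e -> exists2 r, 0 < r &
     forall t, `|t - x| < r -> `|f t - f x - l * (t - x)| <= e * `|t - x|).
Proof.
have gain t : t != 0 -> `|l - t^-1 *: ((f \o shift x) (t *: (1 : R)) - f x)| =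
    `|f (t + x) - f x - l * t| / `|t|.
  move=> t0; rewrite -normfV -normrM distrC; congr `|_|.
  by rewrite /= /GRing.scale/= mulr1; field.
split=> [dfx e e0|H].
  have /cvgrPdist_le/(_ e e0) : (fun h => h^-1 *: ((f \o shift x) (h *: 1) - f x))
      @ 0^' --> l.
    by rewrite -(@derive_val _ _ _ _ _ _ _ dfx); exact: (@ex_derive _ _ _ _ _ _ _ dfx).
  move=> /nbhs_ballP[r /= r0 rP]; exists r => // t tr.
  have [->|tx] := eqVneq t x; first by rewrite !subrr mulr0 normr0 mulr0 subrr normr0.
  have tx0 : t - x != 0 by rewrite subr_eq0.
  have := rP (t - x); rewrite /ball/= sub0r normrN => /(_ tr tx0).
  by rewrite gain// subrK ler_pdivrMr// normr_gt0.
have cf : (fun h => h^-1 *: ((f \o shift x) (h *: 1) - f x)) @ 0^' --> l.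
  apply/cvgrPdist_le => e e0; have [r r0 rP] := H e e0.
  apply/nbhs_ballP; exists r => //= t; rewrite /ball/= sub0r normrN => tr t0.
  rewrite gain// ler_pdivrMr ?normr_gt0//.
  by have := rP (t + x); rewrite addrK => /(_ tr).
by apply: DeriveDef; [apply/cvg_ex; exists l|apply: cvg_lim].
Qed.

Lemma derive_local f g x l r : 0 < r ->
  (forall t, `|t - x| < r -> f t = g t) ->
  is_derive x 1 f l -> is_derive x 1 g l.
Proof.
move=> r0 fg /deriveP df; apply/deriveP => e e0.
have [d d0 dP] := df e e0; exists (Num.min d r); first by rewrite lt_min d0.
move=> t; rewrite lt_min => /andP[td tr].
by rewrite -!fg// ?subrr ?normr0//; exact: dP.
Qed.

Lemma mvt f df a b : a < b ->
  (forall x, a <= x <= b -> is_derive x 1 f (df x)) ->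
  exists2 c, a < c < b & f b - f a = df c * (b - a).
Proof.
move=> ab fd.
have [x xab||c cab ->] := @MVT R f df a b ab.
- by apply: fd; move: xab; rewrite in_itv/= => /andP[/ltW-> /ltW->].
- apply: derivable_within_continuous => x xab.
  by apply: ex_derive; apply: fd; move: xab; rewrite in_itv.
- by exists c => //; move: cab; rewrite in_itv.
Qed.

(** Open intervals, because the solutions are differentiable only where they are
    positive, and the ends of the intervals of interest can be zeros. *)
Lemma derive_ge0_le f df a b :
  (forall x, a < x < b -> is_derive x 1 f (df x)) ->
  (forall x, a < x < b -> 0 <= df x) ->
  forall x y, a < x -> x <= y -> y < b -> f x <= f y.
Proof.
move=> fd f0 x y ax; rewrite le_eqVlt => /predU1P[->//|xy] yb.
have [z /andP[xz zy]|c /andP[xc cy] e] := @mvt f df x y xy.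
  by apply: fd; rewrite (lt_le_trans ax)// (le_lt_trans zy).
rewrite -subr_ge0 e mulr_ge0// ?subr_ge0 ?(ltW xy)//.
by rewrite f0// (lt_trans ax)// (lt_trans cy).
Qed.

Lemma derive_le0_ge f df a b :
  (forall x, a < x < b -> is_derive x 1 f (df x)) ->
  (forall x, a < x < b -> df x <= 0) ->
  forall x y, a < x -> x <= y -> y < b -> f y <= f x.
Proof.
move=> fd f0 x y ax xy yb; rewrite -lerN2.
apply: (@derive_ge0_le (fun t => - f t) (fun t => - df t) a b) => // z zab.
  by derive; [apply: fd|].
by rewrite oppr_ge0 f0.
Qed.

Lemma derive_gt0_lt f df a b :
  (forall x, a < x < b -> is_derive x 1 f (df x)) ->
  (forall x, a < x < b -> 0 < df x) ->
  forall x y, a < x -> x < y -> y < b -> f x < f y.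
Proof.
move=> fd f0 x y ax xy yb.
have [z /andP[xz zy]|c /andP[xc cy] e] := @mvt f df x y xy.
  by apply: fd; rewrite (lt_le_trans ax)// (le_lt_trans zy).
rewrite -subr_gt0 e mulr_gt0// ?subr_gt0//.
by rewrite f0// (lt_trans ax)// (lt_trans cy).
Qed.

Lemma evt_max f a b : a <= b -> (forall x, a <= x <= b -> {for x, continuous f}) ->
  exists2 c, a <= c <= b & forall t, a <= t <= b -> f t <= f c.
Proof.
move=> ab cf; have [|c] := @EVT_max R f a b ab.
  by apply: continuous_subspace_itv => x; rewrite in_itv; exact: cf.
by rewrite in_itv => cab cP; exists c => // t tab; apply: cP; rewrite in_itv.
Qed.

Lemma evt_min f a b : a <= b -> (forall x, a <= x <= b -> {for x, continuous f}) ->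
  exists2 c, a <= c <= b & forall t, a <= t <= b -> f c <= f t.
Proof.
move=> ab cf; have [|c] := @EVT_min R f a b ab.
  by apply: continuous_subspace_itv => x; rewrite in_itv; exact: cf.
by rewrite in_itv => cab cP; exists c => // t tab; apply: cP; rewrite in_itv.
Qed.

Lemma ivt f a b v : a <= b -> (forall x, a <= x <= b -> {for x, continuous f}) ->
  f a <= v <= f b \/ f b <= v <= f a -> exists2 c, a <= c <= b & f c = v.
Proof.
move=> ab cf fv; have [| |c] := @IVT R f a b v ab.
- by apply: continuous_subspace_itv => x; rewrite in_itv; exact: cf.
- by rewrite ge_min le_max; case: fv => /andP[-> ->]; rewrite ?orbT.
- by rewrite in_itv => cab; exists c.
Qed.

Lemma continuousP_eps f x : {for x, continuous f} <->
  forall e, 0 < e -> exists2 r, 0 < r & forall t, `|t - x| < r -> `|f t - f x| < e.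
Proof.
split=> [/cvgrPdist_lt cf e e0|H].
  have /nbhs_ballP[r r0 rP] := cf e e0; exists r => // t tr.
  by rewrite distrC; apply: rP; rewrite /ball/= distrC.
apply/cvgrPdist_lt => e e0; have [r r0 rP] := H e e0.
apply/nbhs_ballP; exists r => // t; rewrite /ball/= distrC => tr.
by rewrite distrC; exact: rP.
Qed.

Lemma derive_shift_arg f c x l : is_derive (x + c) 1 f l ->
  is_derive x 1 (fun t => f (t + c)) l.
Proof.
move=> df; have := @derive_chain _ f (fun t => t + c) x _ _ df
  (derive_add (derive_ident x) (derive_const c x)).
by rewrite addr0 mulr1.
Qed.

Lemma derive_reflect f c x l : is_derive (c - x) 1 f l ->
  is_derive x 1 (fun t => f (c - t)) (- l).
Proof.
move=> df; have := @derive_chain _ f (fun t => c - t) x _ _ df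
  (derive_add (derive_const c x) (derive_opp (derive_ident x))).
by rewrite add0r mulrN1.
Qed.

End Monotonicity.

(** * Elementary inequalities for powers and trigonometric functions *)

Section PowerTrig.
Context {R : realType}.
Implicit Types (x y C p s t : R).

Lemma sin_le_id x : 0 <= x -> sin x <= x.
Proof.
rewrite le_eqVlt => /predU1P[<-|x0]; first by rewrite sin0.
have [c _] := mvt x0 (fun z _ => is_derive_sin z).
by rewrite sin0 !subr0 => ->; rewrite ger_pMl// cos_le1.
Qed.

Lemma cos_ge_quad x : 1 - x ^+ 2 / 2 <= cos x.
Proof.
wlog x0 : x / 0 <= x => [hw|].
  have [|/ltW x0] := leP 0 x; first exact: hw.
  by rewrite -cosN -sqrrN hw// oppr_ge0.
move: x0; rewrite le_eqVlt => /predU1P[<-|x0].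
  by rewrite cos0 expr0n/= mul0r subr0.
have [z _|c /andP[c0 cx]] :=
  @mvt R (fun t => cos t + t * t / 2) (fun t => - sin t + t) 0 x x0.
  by derive; rewrite ?mulr1; lra.
rewrite cos0 => e; have := sin_le_id (ltW c0) => sc.
have : 0 <= (- sin c + c) * (x - 0) by apply: mulr_ge0; lra.
by rewrite -e expr2; lra.
Qed.

Lemma sin_ge_half x : 0 <= x -> x <= 1 -> x / 2 <= sin x.
Proof.
rewrite le_eqVlt => /predU1P[<-|x0] x1; first by rewrite sin0 mul0r.
have [c /andP[c0 cx]] := mvt x0 (fun z _ => is_derive_sin z).
rewrite sin0 !subr0 => ->; rewrite mulrC ler_pM2r//.
by apply: le_trans (cos_ge_quad c); nra.
Qed.

Lemma pi_le4 : pi <= 4 :> R.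
Proof. by have := @pihalf_lt2 R; lra. Qed.

Lemma sin_ge_quarter x : 0 <= x -> x <= pi / 2 -> x / 4 <= sin x.
Proof.
move=> x0 xpi; have [x1|x1] := leP x 1.
  by apply: le_trans (sin_ge_half x0 x1); lra.
have p1 := @pihalf_ge1 R; have p2 := @pihalf_lt2 R.
have : sin 1 < sin x by rewrite ltr_sin// in_itv/=; apply/andP; split; lra.
by have := sin_ge_half ler01 (lexx (1 : R)); lra.
Qed.

Lemma ler_powR_neg x y s : s <= 0 -> 0 < x -> x <= y -> y `^ s <= x `^ s.
Proof.
move=> s0 x0 xy; have y0 := lt_le_trans x0 xy.
rewrite -[s]opprK powRN [leRHS]powRN lef_pV2 ?posrE ?powR_gt0//.
by rewrite ge0_ler_powR ?nnegrE ?oppr_ge0// ltW.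
Qed.

Lemma ler_powR_pos x y s : 0 <= s -> 0 <= x -> x <= y -> x `^ s <= y `^ s.
Proof.
by move=> s0 x0 xy; rewrite ge0_ler_powR ?nnegrE// (le_trans x0 xy).
Qed.

Lemma powR_ge1 x s : s <= 0 -> 0 < x -> x <= 1 -> 1 <= x `^ s.
Proof. by move=> s0 x0 x1; have := ler_powR_neg s0 x0 x1; rewrite powR1. Qed.

Lemma powR_le1 x s : s <= 0 -> 1 <= x -> x `^ s <= 1.
Proof. by move=> s0 x1; have := ler_powR_neg s0 ltr01 x1; rewrite powR1. Qed.

Lemma mulr_powRB x p : 0 < p -> 0 <= x -> x * x `^ (p - 1) = x `^ p.
Proof. by move=> p0 x0; rewrite mulr_powRB1. Qed.

Lemma powRD_gt0 x s t : 0 < x -> x `^ (s + t) = x `^ s * x `^ t.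
Proof. by move=> x0; rewrite powRD//; apply/implyP => _; rewrite gt_eqF. Qed.

Lemma mulr_powR_pred x s : 0 < x -> x * x `^ (s - 1) = x `^ s.
Proof.
move=> x0; rewrite -[X in X * _](powRr1 (ltW x0)) -powRD_gt0//.
by congr (_ `^ _); lra.
Qed.

Lemma powR_neg_gap x y C p : 0 < p -> p < 1 -> 0 < x -> x <= y -> y <= C ->
  (1 - p) * C `^ (p - 2) * (y - x) <= x `^ (p - 1) - y `^ (p - 1).
Proof.
move=> p0 p1 x0; rewrite le_eqVlt => /predU1P[->|xy] yC; first by lra.
have [z /andP[xz zy]|c /andP[xc cy] e] :=
  @mvt R (fun t => t `^ (p - 1)) (fun t => (p - 1) * t `^ (p - 1 - 1) * 1) x y xy.
  by derive => //; exact: lt_le_trans xz.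
have -> : x `^ (p - 1) - y `^ (p - 1) = (1 - p) * c `^ (p - 2) * (y - x).
  have -> : p - 2 = p - 1 - 1 by lra.
  by rewrite -opprB e; ring.
rewrite ler_pM2r ?subr_gt0// ler_pM2l ?subr_gt0// ler_powR_neg//; first by lra.
- exact: lt_trans xc.
- exact: ltW (lt_le_trans cy yC).
Qed.

Lemma powR_gap x y C p : 0 < p -> p < 1 -> 0 < x -> x <= y -> y <= C ->
  p * C `^ (p - 1) * (y - x) <= y `^ p - x `^ p.
Proof.
move=> p0 p1 x0; rewrite le_eqVlt => /predU1P[->|xy] yC; first by lra.
have [z /andP[xz zy]|c /andP[xc cy] e] :=
  @mvt R (fun t => t `^ p) (fun t => p * t `^ (p - 1) * 1) x y xy.
  by derive => //; exact: lt_le_trans xz.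
rewrite e mulr1 ler_pM2r ?subr_gt0// ler_pM2l// ler_powR_neg//; first by lra.
- exact: lt_trans xc.
- exact: ltW (lt_le_trans cy yC).
Qed.

End PowerTrig.

(** * A priori estimate for the equation on the circle *)

Section Equation.
Context {R : realType}.
Variable p : R.
Hypotheses (p0 : 0 < p) (p1 : p < 1).
Implicit Types (f h dh : R -> R) (a b c s t eps : R).

(** The support function of a solution, along the angle. It may vanish, and the
    equation says nothing at a zero; what is known there is that the zero is
    unique up to the period and that the Lipschitz constant is the maximum of
    the function. *)
Record circle_solution eps f h dh : Prop := CircleSolution {
  sol_ge0 : forall t, 0 <= h t ;
  sol_periodic : forall t, h (t + 2 * pi) = h t ;
  sol_continuous : forall t, {for t, continuous h} ;
  sol_lipschitz : forall C, (forall t, h t <= C) ->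
    forall s t, `|h s - h t| <= C * `|s - t| ;
  sol_zero : forall a b, h a = 0 -> h b = 0 -> a < b -> a + 2 * pi <= b ;
  sol_derive : forall t, 0 < h t -> is_derive t 1 h (dh t) ;
  sol_derive2 : forall t, 0 < h t ->
    is_derive t 1 dh (f t * h t `^ (p - 1) - h t) ;
  sol_near1 : forall t, `|f t - 1| <= eps }.

Arguments sol_continuous {eps f h dh} _ _.

Definition critical h dh a := h a = 0 \/ 0 < h a /\ dh a = 0.

(** A monotone phase; by reflection of the angle, falls are rises as well. *)
Definition rising h dh a b :=
  a < b /\ forall t, a < t < b -> 0 < h t /\ 0 < dh t.

Lemma sol_reflect eps f h dh : circle_solution eps f h dh ->
  circle_solution eps (fun t => f (- t)) (fun t => h (- t))
    (fun t => - dh (- t)).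
Proof.
case=> h0 hp hc hl hz hd hdd fe; split => //.
- by move=> t; rewrite -(hp (- (t + _))); congr h; ring.
- move=> t; apply: continuous_comp; first exact: opp_continuous.
  exact: hc.
- move=> C hC s t; have hC' u : h u <= C by rewrite -(opprK u).
  by have := hl C hC' (- s) (- t); rewrite -opprD normrN.
- by move=> a b ha hb ab; have := hz _ _ hb ha; rewrite ltrN2 => /(_ ab); lra.
- move=> t ht; have := @derive_reflect _ h 0 t (dh (- t)).
  by under eq_fun do rewrite sub0r; apply; rewrite sub0r; exact: hd.
- move=> t ht; have := @derive_reflect _ dh 0 t _.
  move/(_ (f (- t) * h (- t) `^ (p - 1) - h (- t))); rewrite sub0r => /(_ (hdd _ ht)) H.
  have := derive_opp H; rewrite opprK.
  by under eq_fun do rewrite sub0r.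
Qed.

Lemma sol_near_bounds eps f h dh : circle_solution eps f h dh ->
  forall t, 1 - eps <= f t /\ f t <= 1 + eps.
Proof.
by move=> S t; have := sol_near1 S t; rewrite ler_norml => /andP[]; lra.
Qed.

Lemma sol_derive_per eps f h dh : circle_solution eps f h dh ->
  forall t, 0 < h t -> dh (t + 2 * pi) = dh t.
Proof.
move=> S t ht; have hp := sol_periodic S t.
have h1 := sol_derive S ht; have : 0 < h (t + 2 * pi) by rewrite hp.
move=> /(sol_derive S)/derive_shift_arg h2; apply: derive_uniq h2 _.
by under eq_fun do rewrite (sol_periodic S).
Qed.

Lemma sol_critical_per eps f h dh a : circle_solution eps f h dh ->
  critical h dh a -> critical h dh (a + 2 * pi).
Proof.
move=> S [ha|[ha da]]; [left|right]; rewrite (sol_periodic S)//.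
by rewrite (sol_derive_per S).
Qed.

End Equation.

Arguments sol_continuous {R p eps f h dh} _ _.

(** The cost of linear arithmetic grows quickly with the number of hypotheses:
    [lra_from] and [nra_from] forget all facts but the listed ones (and those
    of the shape of the section hypotheses). *)
Ltac clear_facts := repeat match goal with H : ?T |- _ =>
  lazymatch T with
  | is_true (0 < ?x) => tryif is_var x then fail else clear H
  | is_true (?x < 1) => tryif is_var x then fail else clear H
  | [/\ _, _, _ & _] => fail
  | _ => lazymatch type of T with Prop => clear H end
  end end.
Tactic Notation "lra_from" ne_hyp_list(hs) := revert hs; clear_facts; intros; lra.
Tactic Notation "nra_from" ne_hyp_list(hs) := revert hs; clear_facts; intros; nra.
Ltac lra_alone := clear_facts; lra.
Ltac nra_alone := clear_facts; nra.
Section Phases.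
Context {R : realType}.
Variable p : R.
Hypotheses (p0 : 0 < p) (p1 : p < 1).
Implicit Types (f h dh : R -> R) (a b c s t eps : R).

Section Fixed.
Variables (eps : R) (f h dh : R -> R).
Hypothesis S : circle_solution p eps f h dh.
Hypotheses (e0 : 0 <= eps) (e1 : eps <= (1 - p) / 4).

Let fb := sol_near_bounds S.
Let small : [/\ 0 < p, p < 1, 0 <= eps & eps <= (1 - p) / 4].
Proof. by []. Qed.

Lemma positive_interval a : 0 < h a -> exists2 r : R, 0 < r &
  forall t, `|t - a| < r -> h a / 2 < h t.
Proof.
move=> ha; have /continuousP_eps/(_ (h a / 2)) := sol_continuous S a.
case=> [|r r0 rP]; first by lra.
by exists r => // t /rP; rewrite ltr_norml => /andP[]; lra.
Qed.

Lemma dh_continuous t : 0 < h t -> {for t, continuous dh}.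
Proof. by move=> ht; apply: derive_continuous (sol_derive2 S ht). Qed.

Lemma rising_lt a b : rising h dh a b ->
  forall s t, a <= s -> s < t -> t <= b -> h s < h t.
Proof.
move=> [ab ad] s t.
have ooP u v : a < u -> u < v -> v < b -> h u < h v.
  by apply: (derive_gt0_lt (df := dh)) => x /ad[hx dx] //; exact: sol_derive S _ hx.
(* the values at the endpoints are limits of the values inside *)
have left u : a < u -> u < b -> h a < h u.
  move=> au ub; pose v := (a + u) / 2.
  have huv : h v < h u by apply: ooP; rewrite /v; lra.
  rewrite ltNge; apply/negP => hau.
  have /continuousP_eps/(_ (h u - h v)) := sol_continuous S a.
  case=> [|r r0 rP]; first lra.
  pose w := a + Num.min (r / 2) ((v - a) / 2).
  have m1 : Num.min (r / 2) ((v - a) / 2) <= r / 2 by rewrite ge_min lexx.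
  have m2 : Num.min (r / 2) ((v - a) / 2) <= (v - a) / 2 by rewrite ge_min lexx orbT.
  have m0 : 0 < Num.min (r / 2) ((v - a) / 2) by rewrite lt_min /v; lra.
  have hw : h w < h v by apply: ooP; rewrite /w /v in m2 *; lra.
  have := rP w; rewrite /w addrAC subrr add0r gtr0_norm// -/w => /(_ _).
  rewrite ltr_norml => H; have /andP[] := H ltac:(lra); lra.
have right u : a < u -> u < b -> h u < h b.
  move=> au ub; pose v := (b + u) / 2.
  have huv : h u < h v by apply: ooP; rewrite /v; lra.
  rewrite ltNge; apply/negP => hau.
  have /continuousP_eps/(_ (h v - h u)) := sol_continuous S b.
  case=> [|r r0 rP]; first lra.
  pose w := b - Num.min (r / 2) ((b - v) / 2).
  have m1 : Num.min (r / 2) ((b - v) / 2) <= r / 2 by rewrite ge_min lexx.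
  have m2 : Num.min (r / 2) ((b - v) / 2) <= (b - v) / 2 by rewrite ge_min lexx orbT.
  have m0 : 0 < Num.min (r / 2) ((b - v) / 2) by rewrite lt_min /v; lra.
  have hw : h v < h w by apply: ooP; rewrite /w /v in m2 *; lra.
  have := rP w; rewrite /w addrAC subrr add0r normrN gtr0_norm// -/w => /(_ _).
  rewrite ltr_norml => H; have /andP[] := H ltac:(lra); lra.
move=> as_ st tb; move: as_ tb st.
rewrite le_eqVlt => /predU1P[<-|as_]; rewrite le_eqVlt => /predU1P[->|tb] st.
- apply: (@lt_trans _ _ (h ((a + b) / 2))); [apply: left|apply: right]; lra.
- exact: left.
- exact: right.
- exact: ooP.
Qed.

Lemma rising_le a b : rising h dh a b ->
  forall s t, a <= s -> s <= t -> t <= b -> h s <= h t.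
Proof.
move=> ab s t as_; rewrite le_eqVlt => /predU1P[->//|st] tb.
exact: ltW (rising_lt ab as_ st tb).
Qed.

Lemma rising_top_gt0 a b : rising h dh a b -> 0 < h b.
Proof.
move=> ab; apply: le_lt_trans (sol_ge0 S a) _.
by apply: (rising_lt ab) => //; case: ab.
Qed.

(** To the right of a minimum at which the equation forces strict convexity,
    the solution rises; a zero is such a minimum because [x^(p-1)] exceeds [x]
    there. *)
Lemma rising_start a : h a = 0 \/ [/\ 0 < h a, dh a = 0 &
    0 < f a * h a `^ (p - 1) - h a] ->
  exists2 b, a < b & rising h dh a b.
Proof.
case=> [ha|[ha da dda]]; last first.
  have /deriveP/(_ ((f a * h a `^ (p - 1) - h a) / 2)) := sol_derive2 S ha.
  case=> [|r r0 rP]; first by lra.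
  have [r' r'0 r'P] := positive_interval ha.
  exists (a + Num.min r r'); first by rewrite ltrDl lt_min r0.
  split; first by rewrite ltrDl lt_min r0.
  move=> t /andP[at_ tr]; have [ta1 ta2] : t - a < r /\ t - a < r'.
    by move: tr; rewrite addrC -ltrBlDr lt_min => /andP[].
  have tn : `|t - a| = t - a by rewrite gtr0_norm// subr_gt0.
  have ht := r'P t; rewrite tn in ht; split.
    by apply: lt_trans (ht ta2); lra.
  have := rP t; rewrite tn da subr0 => /(_ ta1); rewrite ler_norml => /andP[+ _].
  have tp : 0 < t - a by lra.
  set q := f a * _ - _ in dda *; nra.
have [r r0 rP] : exists2 r : R, 0 < r & forall t, `|t - a| < r -> h t < 1 / 2.
  have /continuousP_eps/(_ (1/2)) := sol_continuous S a.
  case=> [|r r0 rP]; first lra.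
  by exists r => // t /rP; rewrite ha subr0 ltr_norml => /andP[].
have pi0 := @pi_gt0 R.
have hpos t : a < t -> t < a + 2 * pi -> 0 < h t.
  move=> at_ tp; rewrite lt_def (sol_ge0 S) andbT; apply/eqP => ht.
  by have := sol_zero S ha ht at_; lra.
pose b := a + Num.min r (2 * pi).
have ab : a < b by rewrite ltrDl lt_min r0; lra.
have br t : t < b -> t < a + r /\ t < a + 2 * pi.
  by rewrite /b addrC -ltrBlDr lt_min => /andP[]; lra.
have [? ? ? ?] := small.
have convex t : a < t -> t < b -> 0 < f t * h t `^ (p - 1) - h t.
  move=> at_ /br[tr tp]; have ht := hpos t at_ tp.
  have h1 : h t < 1 / 2 by apply: rP; rewrite gtr0_norm; lra.
  have [fl _] := fb t; have : 1 <= h t `^ (p - 1) by apply: powR_ge1; lra.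
  by set P := _ `^ _; nra.
have dinc : forall u v, a < u -> u < v -> v < b -> dh u < dh v.
  apply: (derive_gt0_lt (df := fun t => f t * h t `^ (p - 1) - h t)).
    by move=> x /andP[ax xb]; apply: (sol_derive2 S); apply: hpos => //; have [] := br x xb.
  by move=> x /andP[ax xb]; exact: convex.
exists b => //; split => // t /andP[at_ tb].
have ht : 0 < h t by apply: hpos => //; have [] := br t tb.
split => //; rewrite ltNge; apply/negP => dt.
(* otherwise the solution would decrease from the value 0 at [a] *)
pose u := (a + t) / 2.
have [_ tpi] := br t tb.
have hu : 0 < h u by apply: hpos; rewrite /u; lra.
have /continuousP_eps/(_ (h u / 2)) := sol_continuous S a.
case=> [|q q0 qP]; first lra.
pose w := a + Num.min (q / 2) ((u - a) / 2).
have m1 : Num.min (q / 2) ((u - a) / 2) <= q / 2 by rewrite ge_min lexx.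
have m2 : Num.min (q / 2) ((u - a) / 2) <= (u - a) / 2 by rewrite ge_min lexx orbT.
have m0 : 0 < Num.min (q / 2) ((u - a) / 2) by rewrite lt_min /u; lra.
have := qP w; rewrite /w addrAC subrr add0r gtr0_norm// -/w ha subr0 => /(_ _).
rewrite ltr_norml => H; have /andP[_ hw] := H ltac:(lra).
have : h u <= h w.
  apply: (@derive_le0_ge _ h dh a t); rewrite ?/w ?/u in m2 *; try lra.
    move=> x /andP[ax xt]; apply: (sol_derive S); apply: hpos => //.
    by have [? ?] := br t tb; lra.
  by move=> x /andP[ax xt]; apply: le_trans dt; exact/ltW/dinc.
lra.
Qed.

(** The rise is continued up to the next critical point, which is met within a
    period. *)
Lemma rising_extend a : h a = 0 \/ [/\ 0 < h a, dh a = 0 &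
    0 < f a * h a `^ (p - 1) - h a] ->
  exists b, [/\ rising h dh a b, 0 < h b & dh b = 0].
Proof.
move=> ha; have [b0 ab0 rb0] := rising_start ha.
have pi0 := @pi_gt0 R.
pose A : set R := [set b | rising h dh a b].
have Aub : ubound A (a + 2 * pi).
  move=> b rb; rewrite leNgt; apply/negP => bp.
  have := rising_lt rb (lexx a) (_ : a < a + 2 * pi) (ltW bp).
  by rewrite (sol_periodic S) ltxx => H; have := H ltac:(lra).
have hA : has_sup A by split; [exists b0|exists (a + 2 * pi)].
pose b := sup A.
have b0b : b0 <= b by apply: ub_le_sup => //; exists (a + 2 * pi).
have ab : a < b by lra.
have rb : rising h dh a b.
  split => // t /andP[at_ tb].
  have bt : 0 < b - t by lra.
  have [c [_ cP] tc] := sup_adherent bt hA.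
  by apply: cP; rewrite at_/=; rewrite -/b in tc; lra.
have hb := rising_top_gt0 rb; exists b; split => //.
have [d1|d1|//] := ltgtP (dh b) 0.
  have /continuousP_eps/(_ (- dh b)) := dh_continuous hb.
  case=> [|r r0 rP]; first lra.
  pose t := b - Num.min (r / 2) ((b - a) / 2).
  have m1 : Num.min (r / 2) ((b - a) / 2) <= r / 2 by rewrite ge_min lexx.
  have m2 : Num.min (r / 2) ((b - a) / 2) <= (b - a) / 2 by rewrite ge_min lexx orbT.
  have m0 : 0 < Num.min (r / 2) ((b - a) / 2) by rewrite lt_min; lra.
  have [_ +] : 0 < h t /\ 0 < dh t by apply: rb.2; rewrite /t; lra.
  have := rP t; rewrite /t addrAC subrr add0r normrN gtr0_norm// -/t => /(_ _).
  rewrite ltr_norml => H; have /andP[_] := H ltac:(lra); lra.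
have /continuousP_eps/(_ (dh b)) := dh_continuous hb.
case=> [|r r0 rP]; first lra.
have [r' r'0 r'P] := positive_interval hb.
pose m := Num.min r r'; have m0 : 0 < m by rewrite lt_min r0.
have : A (b + m / 2).
  split; first lra.
  move=> t /andP[at_ tm]; have [tb|tb] := ltP t b; first by apply: rb.2; rewrite at_.
  have [tr tr'] : `|t - b| < r /\ `|t - b| < r'.
    have : `|t - b| < m by rewrite ger0_norm; lra.
    by rewrite lt_min => /andP[].
  have := rP t tr; have := r'P t tr'; rewrite ltr_norml => ? /andP[? ?]; split; lra.
move/(ub_le_sup (ex_intro _ _ Aub)); rewrite -/b; lra.
Qed.

End Fixed.
End Phases.

Section Energy.
Context {R : realType}.
Variable p : R.
Hypotheses (p0 : 0 < p) (p1 : p < 1).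
Implicit Types (a b c s t : R).

Lemma powR_small (e : R) : 0 < e ->
  exists2 r : R, 0 < r & forall x, 0 <= x -> x < r -> x `^ p < e.
Proof.
move=> e0; exists (e `^ p^-1); first exact: powR_gt0.
move=> x x0 xe; have -> : e = (e `^ p^-1) `^ p.
  by rewrite -powRrM mulVf ?powRr1 ?ltW// gt_eqF.
by apply: gt0_ltr_powR; rewrite ?nnegrE ?powR_ge0.
Qed.

Lemma point_right a b (r : R) : a < b -> 0 < r ->
  exists2 s : R, a < s < b & s < a + r.
Proof.
move=> ab r0; exists (a + Num.min (r / 2) ((b - a) / 2)).
  have m2 : Num.min (r / 2) ((b - a) / 2) <= (b - a) / 2 by rewrite ge_min lexx orbT.
  have m0 : 0 < Num.min (r / 2) ((b - a) / 2) by rewrite lt_min; lra.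
  lra.
have m1 : Num.min (r / 2) ((b - a) / 2) <= r / 2 by rewrite ge_min lexx.
lra.
Qed.

Variables (eps : R) (f h dh : R -> R).
Hypothesis S : circle_solution p eps f h dh.
Hypotheses (e0 : 0 <= eps) (e1 : eps <= (1 - p) / 4).

Let fb := sol_near_bounds S.
Let small : [/\ 0 < p, p < 1, 0 <= eps & eps <= (1 - p) / 4].
Proof. by []. Qed.

(** For constant [f = k] this is a first integral of the equation. Along a rise,
    it is monotone when [k] is one of the extreme values of [f]. *)
Definition energy (k : R) t := dh t ^+ 2 + h t ^+ 2 - 2 / p * k * h t `^ p.

Lemma energy_derive k t : 0 < h t ->
  is_derive t 1 (energy k) (2 * dh t * h t `^ (p - 1) * (f t - k)).
Proof.
move=> ht; have d1 := sol_derive S ht; have d2 := sol_derive2 S ht.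
rewrite /energy; derive => //.
have p_neq0 : p != 0 by rewrite gt_eqF.
by field.
Qed.

Lemma energy_rising a b : rising h dh a b -> forall s t, a < s -> s <= t -> t < b ->
  energy (1 - eps) s <= energy (1 - eps) t /\
  energy (1 + eps) t <= energy (1 + eps) s.
Proof.
move=> [ab ad] s t as_ st tb; split.
  apply: (@derive_ge0_le _ _
      (fun t => 2 * dh t * h t `^ (p - 1) * (f t - (1 - eps))) a b) => // x /ad[hx dx].
    exact: energy_derive.
  have [fl fr] := fb x; have := powR_gt0 (p - 1) hx => P.
  by apply: mulr_ge0; [apply: mulr_ge0; lra|lra].
apply: (@derive_le0_ge _ _
    (fun t => 2 * dh t * h t `^ (p - 1) * (f t - (1 + eps))) a b) => // x /ad[hx dx].
  exact: energy_derive.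
have [fl fr] := fb x; have := powR_gt0 (p - 1) hx => P.
by apply: mulr_ge0_le0; [apply: mulr_ge0; lra|lra].
Qed.

(** The energy is continuous where [h] is positive, so that its monotonicity
    inside a rise extends to endpoints at which [h] is positive. *)
Lemma energy_critical a b : rising h dh a b -> 0 < h a -> dh a = 0 ->
  dh b = 0 ->
  h a ^+ 2 - 2 / p * (1 - eps) * h a `^ p <= h b ^+ 2 - 2 / p * (1 - eps) * h b `^ p /\
  h b ^+ 2 - 2 / p * (1 + eps) * h b `^ p <= h a ^+ 2 - 2 / p * (1 + eps) * h a `^ p.
Proof.
move=> ab ha da db; have [ltab ad] := ab.
have pos t : a <= t <= b -> 0 < h t /\ 0 <= dh t.
  move=> /andP[]; rewrite le_eqVlt => /predU1P[<-|at_]; first by rewrite da.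
  rewrite le_eqVlt => /predU1P[->|tb].
    by rewrite db; split => //; exact: rising_top_gt0 S _ _ ab.
  by have [|? ?] := ad t; [rewrite at_|rewrite ltW].
have en k : exists2 c, a < c < b & energy k b - energy k a =
    2 * dh c * h c `^ (p - 1) * (f c - k) * (b - a).
  apply: (@mvt _ _ (fun c => 2 * dh c * h c `^ (p - 1) * (f c - k))) => // x xab.
  by apply: energy_derive; have [] := pos x xab.
have E k t : dh t = 0 -> energy k t = h t ^+ 2 - 2 / p * k * h t `^ p.
  by rewrite /energy => ->; rewrite expr0n add0r.
rewrite -!(E _ a)// -!(E _ b)//; split.
  have [c /ad[hc dc] e] := en (1 - eps); rewrite -subr_ge0 e.
  have [fl fr] := fb c; have := powR_gt0 (p - 1) hc => P.
  by apply: mulr_ge0; [apply: mulr_ge0; [apply: mulr_ge0; lra|lra]|lra].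
have [c /ad[hc dc] e] := en (1 + eps); rewrite -subr_le0 e.
have [fl fr] := fb c; have := powR_gt0 (p - 1) hc => P.
by apply: mulr_le0_ge0; [apply: mulr_ge0_le0; [apply: mulr_ge0; lra|lra]|lra].
Qed.

(** At a zero the derivative has no limit a priori, but the energy is at least
    a multiple of [- h^p], which tends to 0 there. *)
Lemma energy_from_zero a b : rising h dh a b -> h a = 0 -> forall t, a < t -> t < b ->
  0 <= energy (1 - eps) t.
Proof.
move=> ab ha t at_ tb; rewrite leNgt; apply/negP => en.
have [? ? ? ?] := small.
have [r r0 rP] := @powR_small (- energy (1 - eps) t * (p / 2)) ltac:(nra).
have /continuousP_eps/(_ r r0)[q q0 qP] := sol_continuous S a.
have [s /andP[as_ st] sq] := point_right at_ q0.
have [+ _] := energy_rising ab as_ (ltW st) tb.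
have : h s `^ p < - energy (1 - eps) t * (p / 2).
  apply: rP; first exact: sol_ge0 S _.
  have := qP s; rewrite ha subr0 gtr0_norm; last lra.
  by move/(_ ltac:(lra)); rewrite ltr_norml => /andP[].
have := powR_ge0 (h s) p.
rewrite {2}/energy; set P := h s `^ p => P0 Pl El.
have A : 0 <= dh s ^+ 2 by exact: sqr_ge0.
have B : 0 <= h s ^+ 2 by exact: sqr_ge0.
have : 2 / p * (1 - eps) * P < - energy (1 - eps) t.
  apply: (@le_lt_trans _ _ (2 / p * P)).
    apply: ler_wpM2r => //; apply: ler_piMr; first by apply: divr_ge0; lra.
    lra.
  by rewrite mulrAC ltr_pdivrMr//; lra.
by lra.
Qed.

(** The second derivative cannot have the wrong sign at the beginning of a rise. *)
Lemma critical_bottom a b : rising h dh a b -> 0 < h a -> dh a = 0 ->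
  h a <= f a * h a `^ (p - 1).
Proof.
move=> [ab ad] ha da; rewrite leNgt; apply/negP => lt.
have /deriveP/(_ ((h a - f a * h a `^ (p - 1)) / 2)) := sol_derive2 S ha.
case=> [|r r0 rP]; first lra.
have [s /andP[as_ sb] sr] := point_right ab r0.
have [_ ds] : 0 < h s /\ 0 < dh s by apply: ad; rewrite as_.
have := rP s; rewrite gtr0_norm; last lra.
move/(_ ltac:(lra)); rewrite da subr0 ler_norml => /andP[_].
set q := f a * _ in lt *; have : 0 < s - a by lra.
nra.
Qed.

Lemma critical_top a b : rising h dh a b -> dh b = 0 ->
  f b * h b `^ (p - 1) <= h b.
Proof.
move=> ab db; have hb := rising_top_gt0 S ab; have [ltab ad] := ab.
rewrite leNgt; apply/negP => lt.
have /deriveP/(_ ((f b * h b `^ (p - 1) - h b) / 2)) := sol_derive2 S hb.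
case=> [|r r0 rP]; first lra.
have ba : - b < - a by lra.
have [s' /andP[as_ sb] sr] := point_right ba r0.
pose s := - s'; have es : s' = - s by rewrite opprK.
rewrite es in as_ sb sr.
have [_ ds] : 0 < h s /\ 0 < dh s by apply: ad; lra.
have := rP s; rewrite ltr0_norm; last lra.
move/(_ ltac:(lra)); rewrite db subr0 ler_norml => /andP[_].
set q := f b * _ in lt *; have : s - b < 0 by lra.
nra.
Qed.

(** A rise from a zero is too short to fill half the circle. With
    [s = 1 - (p/2) (1+eps)/(1-eps)], the energy inequality makes [w = h^s] a
    supersolution of [w'' + s^2 w = 0], and [s > 1/2] brings the maximum of
    [sin (s t)] before [pi]. *)
Lemma rise_from_zero_lt_pi a b : rising h dh a b -> h a = 0 -> b - a < pi.
Proof.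
move=> ab ha; rewrite ltNge; apply/negP => pib.
have [? ? ? ?] := small; have pi0 := @pi_gt0 R; have [ltab ad] := ab.
pose s := 1 - p / 2 * ((1 + eps) / (1 - eps)).
have seq : (1 - s) * (2 / p) * (1 - eps) = 1 + eps by rewrite /s; field; lra.
have s1 : s < 1.
  have : 0 < p / 2 * ((1 + eps) / (1 - eps)).
    by apply: mulr_gt0; [lra|apply: divr_gt0; lra].
  by rewrite /s; lra.
have s12 : 1 / 2 < s.
  have : p / 2 * ((1 + eps) / (1 - eps)) < 1 / 2; last by rewrite /s; lra.
  by rewrite mulrA ltr_pdivrMr; nra.
pose w t := h t `^ s.
pose dw t := s * h t `^ (s - 1) * dh t.
pose ddw t := s * h t `^ (s - 2) * ((s - 1) * dh t ^+ 2 + h t * (f t * h t `^ (p - 1) - h t)).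
have wd t : a < t < b -> is_derive t 1 w (dw t).
  move=> /ad[ht dt]; have d1 := sol_derive S ht.
  by rewrite /w /dw; derive => //; ring.
have dwd t : a < t < b -> is_derive t 1 dw (ddw t).
  move=> /ad[ht dt]; have d1 := sol_derive S ht; have d2 := sol_derive2 S ht.
  rewrite /dw /ddw; derive => //.
  have -> : s - 1 - 1 = s - 2 by lra.
  have -> : h t `^ (s - 1) = h t * h t `^ (s - 2).
    by rewrite -(mulr_powR_pred (s - 1) ht); congr (_ * _ `^ _); lra.
  by ring.
have super t : a < t < b -> ddw t <= - s ^+ 2 * w t.
  move=> tab; have [ht dt] := ad t tab; have [at_ tb] := andP tab.
  have := energy_from_zero ab ha at_ tb; rewrite /energy => en.
  have -> : w t = h t ^+ 2 * h t `^ (s - 2).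
    rewrite /w -(mulr_powR_pred s ht) -(mulr_powR_pred (s - 1) ht) expr2 mulrA.
    by congr (_ * _ `^ _); lra.
  have Q0 : 0 < h t `^ (s - 2) by exact: powR_gt0.
  have -> : - s ^+ 2 * (h t ^+ 2 * h t `^ (s - 2)) =
     s * h t `^ (s - 2) * (- s * h t ^+ 2) by ring.
  rewrite /ddw ler_pM2l; last by apply: mulr_gt0; lra.
  have [fl fr] := fb t.
  have P0 : 0 < h t `^ p by exact: powR_gt0.
  have -> : h t * (f t * h t `^ (p - 1) - h t) = f t * h t `^ p - h t ^+ 2.
    by rewrite -(mulr_powRB p0 (ltW ht)); ring.
  have : f t * h t `^ p <= (1 + eps) * h t `^ p by rewrite ler_pM2r.
  rewrite -seq; set k := 2 / p in en *.
  have : 0 <= (1 - s) * (dh t ^+ 2 + h t ^+ 2 - k * (1 - eps) * h t `^ p).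
    by apply: mulr_ge0; lra.
  by lra.
have w0 t : a < t < b -> 0 < w t by move=> /ad[ht _]; exact: powR_gt0.
have dw0 t : a < t < b -> 0 < dw t.
  by move=> /ad[ht dt]; apply: mulr_gt0 => //; apply: mulr_gt0; [lra|exact: powR_gt0].
have dw_small t : a < t -> t < b -> dw t * (t - a) <= 2 * w t.
  move=> at_ tb; pose r := (a + t) / 2.
  have rt : r < t by rewrite /r; lra.
  have [|c /andP[rc ct] e] := @mvt _ w dw r t rt.
    by move=> x /andP[rx xt]; apply: wd; rewrite /r in rx; lra.
  have : dw t <= dw c.
    apply: (@derive_le0_ge _ dw ddw a b) => //; try (rewrite /r in rc; lra).
    move=> x xab; apply: le_trans (super x xab) _.
    by rewrite mulNr oppr_le0 mulr_ge0 ?sqr_ge0// ltW// w0.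
  have wr : 0 < w r by apply: w0; rewrite /r; lra.
  have : 0 < t - r by lra.
  have -> : t - a = 2 * (t - r) by rewrite /r; lra.
  nra.
pose F t := dw t * sin (s * (t - a)) - s * (w t * cos (s * (t - a))).
have Fd t : a < t < b -> is_derive t 1 F ((ddw t + s ^+ 2 * w t) * sin (s * (t - a))).
  move=> tab; have d1 := wd t tab; have d2 := dwd t tab.
  by rewrite /F; derive; ring.
have sinp t : a < t -> t < a + pi -> 0 < sin (s * (t - a)).
  by move=> at_ tp; apply: sin_gt0_pi; apply/andP; split; nra.
have Fdec : forall u v, a < u -> u <= v -> v < a + pi -> F v <= F u.
  apply: (derive_le0_ge (df := fun t => (ddw t + s ^+ 2 * w t) * sin (s * (t - a)))).
    by move=> x /andP[ax xp]; apply: Fd; lra.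
  move=> x /andP[ax xp]; apply: mulr_le0_ge0; last by rewrite ltW// sinp.
  by have := super x ltac:(lra); lra.
have Fle t : a < t -> t < a + pi -> F t <= 0.
  move=> at_ tp; rewrite leNgt; apply/negP => F0.
  have [r r0 rP] : exists2 r : R, 0 < r & forall u, a < u < b -> u < a + r -> w u < F t / 3.
    pose e := (F t / 3) `^ s^-1.
    have ee : 0 < e by apply: powR_gt0; lra.
    have /continuousP_eps/(_ e ee)[q q0 qP] := sol_continuous S a.
    exists q => // u uab uq; have -> : F t / 3 = e `^ s.
      by rewrite /e -powRrM mulVf ?powRr1//; lra.
    apply: gt0_ltr_powR; rewrite ?nnegrE ?(sol_ge0 S) ?(ltW ee)//; first lra.
    have := qP u; rewrite ha subr0 gtr0_norm; last lra.
    by move/(_ ltac:(lra)); rewrite ltr_norml => /andP[].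
  have [u /andP[au ut] ur] := point_right at_ r0.
  have uab : a < u < b by lra.
  have := Fdec u t au (ltW ut) tp.
  have := rP u uab ur; have := dw_small u au ltac:(lra).
  have := w0 u uab; have := dw0 u uab; rewrite /F.
  have sl : sin (s * (u - a)) <= u - a.
    by apply: le_trans (sin_le_id _) _; nra.
  have := cos_geN1 (s * (u - a)).
  set cu := cos _; set su := sin _ in sl *; set W := w u; set D := dw u; set X := F t.
  move=> cg D0 W0 DW WX Fl.
  have h1 : D * su <= 2 * W by apply: le_trans DW; rewrite ler_pM2l.
  have h2 : - W <= W * cu by rewrite -mulrN1 ler_pM2l.
  have h3 : - W <= s * (W * cu) by nra.
  lra.
pose t := a + (pi / (2 * s) + pi) / 2.
have ps : pi / (2 * s) < pi by rewrite ltr_pdivrMr; nra.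
have ps0 : 0 < pi / (2 * s) by apply: divr_gt0; lra.
have at_ : a < t by rewrite /t; lra.
have tp : t < a + pi by rewrite /t; lra.
have := Fle t at_ tp; apply/negP; rewrite -ltNge /F.
have c0 : cos (s * (t - a)) <= 0.
  rewrite -[X in cos X](subrK (pi / 2)) cosDpihalf oppr_le0 sin_ge0_pi//.
  have e : s * (pi / (2 * s)) = pi / 2 by field; lra.
  by rewrite /t; apply/andP; split; nra.
have := sinp t at_ tp; have := dw0 t ltac:(lra); have := w0 t ltac:(lra).
move=> W0 D0 S0; have : 0 < dw t * sin (s * (t - a)) by exact: mulr_gt0.
have : s * (w t * cos (s * (t - a))) <= 0.
  by apply: mulr_ge0_le0; [lra|apply: mulr_ge0_le0; [exact: ltW|]].
lra.
Qed.

End Energy.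

Section Periodic.
Context {R : realType}.

Lemma periodic_int (T : Type) (g : R -> T) : (forall t, g (t + 2 * pi) = g t) ->
  forall t (k : int), g (t + 2 * pi * k%:~R) = g t.
Proof.
move=> gp; have nat_case t (n : nat) : g (t + 2 * pi * n%:R) = g t.
  elim: n t => [|n IH] t; first by rewrite mulr0 addr0.
  have -> : t + 2 * pi * n.+1%:R = t + 2 * pi * n%:R + 2 * pi by rewrite -natr1; ring.
  by rewrite gp.
move=> t [n|n]; first exact: nat_case.
rewrite NegzE -[LHS](nat_case _ n.+1); congr g.
by rewrite mulrNz -pmulrn; ring.
Qed.

Lemma reduce_angle (t : R) : exists k : int, 0 <= t + 2 * pi * k%:~R < 2 * pi.
Proof.
have pi0 := @pi_gt0 R; have pp : 0 < 2 * pi :> R by lra.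
exists (- Num.floor (t / (2 * pi))).
have /andP[l u] := floor_itv (t / (2 * pi)).
rewrite mulrNz; move: l u; rewrite intrD; set k := (Num.floor _)%:~R => l u.
have lk : k * (2 * pi) <= t by rewrite -ler_pdivlMr.
have uk : t < (k + 1) * (2 * pi) by rewrite -ltr_pdivrMr.
by apply/andP; split; lra.
Qed.

End Periodic.

Section Bound.
Context {R : realType}.
Variable p : R.
Hypotheses (p0 : 0 < p) (p1 : p < 1).
Implicit Types (a b c s t : R).

Section OneSolution.
Variables (eps : R) (f h dh : R -> R).
Hypothesis S : circle_solution p eps f h dh.
Hypotheses (e0 : 0 <= eps) (e1 : eps <= (1 - p) / 4).

Let fb := sol_near_bounds S.
Let small : [/\ 0 < p, p < 1, 0 <= eps & eps <= (1 - p) / 4].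
Proof. by []. Qed.

(** A rise before a critical point at which the equation is concave: the mirror
    image of the continuation of a rise. *)
Lemma rising_back c : 0 < h c -> dh c = 0 -> f c * h c `^ (p - 1) < h c ->
  exists a, rising h dh a c /\ critical h dh a.
Proof.
move=> hc dc ddc; have pi0 := @pi_gt0 R.
have [b0 rb0] : exists b, rising h dh b c.
  have /deriveP/(_ ((h c - f c * h c `^ (p - 1)) / 2)) := sol_derive2 S hc.
  case=> [|r r0 rP]; first by lra.
  have [r' r'0 r'P] := positive_interval S hc.
  pose m := Num.min r r'; have m0 : 0 < m by rewrite lt_min r0.
  exists (c - m); split; first lra.
  move=> t /andP[tr tc]; have tn : `|t - c| = c - t by rewrite ltr0_norm; lra.
  have [ta1 ta2] : c - t < r /\ c - t < r'.
    have : c - t < m by lra.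
    by rewrite lt_min => /andP[].
  have ht := r'P t; rewrite tn in ht; split.
    by apply: lt_trans (ht ta2); lra.
  have := rP t; rewrite tn dc subr0 => /(_ ta1); rewrite ler_norml => /andP[+ _].
  have tp : 0 < c - t by lra.
  by set q := f c * _ in ddc *; nra.
pose A : set R := [set b | rising h dh b c].
have Alb : lbound A (c - 2 * pi).
  move=> b rb; rewrite leNgt; apply/negP => bp.
  have := rising_lt S rb (ltW bp) (_ : c - 2 * pi < c) (lexx c).
  by rewrite -(sol_periodic S (c - _)) subrK ltxx => H; have := H ltac:(lra).
have hA : has_inf A by split; [exists b0|exists (c - 2 * pi)].
pose a := inf A.
have ab0 : a <= b0 by apply: ge_inf => //; exists (c - 2 * pi).
have ac : a < c by case: rb0; lra.
have ra : rising h dh a c.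
  split => // t /andP[at_ tc]; have ta : 0 < t - a by lra.
  have [b [_ bP] tb] := inf_adherent ta hA.
  by apply: bP; rewrite tc andbT; rewrite -/a in tb; lra.
exists a; split => //.
have := sol_ge0 S a; rewrite le_eqVlt => /predU1P[/esym ha|ha]; [by left|right; split => //].
have [d1|d1|//] := ltgtP (dh a) 0.
  have /continuousP_eps/(_ (- dh a)) := dh_continuous S ha.
  case=> [|r r0 rP]; first lra.
  have [t /andP[at_ tc] tr] := point_right ac r0.
  have [_ +] : 0 < h t /\ 0 < dh t by apply: ra.2; lra.
  have := rP t; rewrite gtr0_norm; last lra.
  by move=> /(_ ltac:(lra)); rewrite ltr_norml => /andP[_]; lra.
have /continuousP_eps/(_ (dh a)) := dh_continuous S ha.
case=> [|r r0 rP]; first lra.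
have [r' r'0 r'P] := positive_interval S ha.
pose m := Num.min r r'; have m0 : 0 < m by rewrite lt_min r0.
have : A (a - m / 2).
  split; first lra.
  move=> t /andP[at_ tm]; have [tb|tb] := ltP a t; first by apply: ra.2; rewrite tb.
  have [tr tr'] : `|t - a| < r /\ `|t - a| < r'.
    have : `|t - a| < m by rewrite ler0_norm; lra.
    by rewrite lt_min => /andP[].
  by have := rP t tr; have := r'P t tr'; rewrite ltr_norml => ? /andP[? ?]; split; lra.
by move/(ge_inf (ex_intro _ _ Alb)); rewrite -/a; lra.
Qed.

(** Descending to a positive critical point forbids large maxima, by the energy
    inequality, so that a large maximum is preceded by a zero. *)
Lemma high_top_zero_before c : 4 / p < h c -> dh c = 0 ->
  exists a, [/\ h a = 0, a < c & c - a < pi].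
Proof.
move=> hc dc; have [? ? ? ?] := small.
have h4 : 4 < 4 / p by rewrite ltr_pdivlMr//; lra.
have hc0 : 0 < h c by lra.
have [fl fr] := fb c.
have P1 : h c `^ (p - 1) <= 1 by apply: powR_le1; lra.
have P0 := powR_gt0 (p - 1) hc0.
have [|a [ra [ha|[ha da]]]] := rising_back hc0 dc.
- have hc4 := lt_trans h4 hc; apply: (@le_lt_trans _ _ (1 + eps)); last lra.
  apply: (@le_trans _ _ ((1 + eps) * h c `^ (p - 1))); first by rewrite ler_pM2r.
  by rewrite ger_pMr//; lra.
- by exists a; split => //; [case: ra|exact: (rise_from_zero_lt_pi p0 p1 S e0 e1)].
have [_ en] := energy_critical p0 S ra ha da dc.
have := critical_bottom S ra ha da; have [fla fra] := fb a.
have Pa := powR_gt0 (p - 1) ha => bot.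
have : h a ^+ 2 <= (1 + eps) * h a `^ p.
  rewrite -(mulr_powRB p0 (ltW ha)) mulrCA expr2 ler_pM2l//.
  by apply: le_trans bot _; rewrite ler_pM2r.
have Pa' := powR_gt0 p ha => bot2.
have kp : 2 < 2 / p by rewrite ltr_pdivlMr//; lra.
have kp4 : 2 / p * 2 = 4 / p by field; lra.
have Pc : h c `^ p <= h c by apply: ler1_powR; lra.
have Pc0 := powR_gt0 p hc0.
set k := 2 / p in en kp kp4.
have E1 : h a ^+ 2 <= k * (1 + eps) * h a `^ p.
  by apply: (le_trans bot2); rewrite ler_pM2r//; nra.
have E2 : h c ^+ 2 <= k * (1 + eps) * h c `^ p by lra.
have E3 : k * (1 + eps) * h c `^ p <= 4 / p * h c.
  by apply: ler_pM; [nra|exact: ltW| nra |].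
nra.
Qed.

End OneSolution.

Lemma sol_max eps f h dh : circle_solution p eps f h dh ->
  exists c, (forall t, h t <= h c) /\ critical h dh c.
Proof.
move=> S; have pi0 := @pi_gt0 R.
have [//||c cab cP] := @evt_max R h 0 (2 * pi); first lra.
  by move=> x _; exact: sol_continuous S x.
have cP' t : h t <= h c.
  have [k /andP[k1 k2]] := reduce_angle t.
  by rewrite -(periodic_int (sol_periodic S) t k) cP// k1 ltW.
exists c; split => //.
have := sol_ge0 S c; rewrite le_eqVlt => /predU1P[/esym hc|hc]; [by left|right; split => //].
have [r r0 rP] := positive_interval S hc.
apply: (derive_uniq (sol_derive S hc)).
apply: (@derive1_at_max _ h (c - r) (c + r)) => //; first lra.
  move=> t; rewrite in_itv/= => /andP[tl tr].
  have ht : 0 < h t by apply: lt_trans (rP t _); rewrite ?ltr_distl; lra.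
  exact: (@ex_derive _ _ _ _ _ _ _ (sol_derive S ht)).
by rewrite in_itv/=; lra.
Qed.

Lemma sol_min eps f h dh : circle_solution p eps f h dh ->
  exists c, (forall t, h c <= h t) /\ critical h dh c.
Proof.
move=> S; have pi0 := @pi_gt0 R.
have [//||c cab cP] := @evt_min R h 0 (2 * pi); first lra.
  by move=> x _; exact: sol_continuous S x.
have cP' t : h c <= h t.
  have [k /andP[k1 k2]] := reduce_angle t.
  by rewrite -(periodic_int (sol_periodic S) t k) cP// k1 ltW.
exists c; split => //.
have := sol_ge0 S c; rewrite le_eqVlt => /predU1P[/esym hc|hc]; [by left|right; split => //].
have [r r0 rP] := positive_interval S hc.
apply: (derive_uniq (sol_derive S hc)).
apply: (@derive1_at_min _ h (c - r) (c + r)) => //; first lra.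
  move=> t; rewrite in_itv/= => /andP[tl tr].
  have ht : 0 < h t by apply: lt_trans (rP t _); rewrite ?ltr_distl; lra.
  exact: (@ex_derive _ _ _ _ _ _ _ (sol_derive S ht)).
by rewrite in_itv/=; lra.
Qed.

(** A maximum above [4 / p] would have a zero on either side, at a distance less
    than [pi], while two zeros are at least a period apart. *)
Lemma sol_le eps f h dh : circle_solution p eps f h dh -> 0 <= eps ->
  eps <= (1 - p) / 4 -> forall t, h t <= 4 / p.
Proof.
move=> S e0 e1 t; have [c [cP crc]] := sol_max S.
apply: le_trans (cP t) _; rewrite leNgt; apply/negP => hc.
have dc : dh c = 0.
  case: crc => [hc0|[]//]; move: hc; rewrite hc0 ltNge divr_ge0//; exact: ltW.
have [a [ha ac cpi]] := high_top_zero_before S e0 e1 hc dc.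
have [||b [hb cb bpi]] := high_top_zero_before (sol_reflect S) e0 e1 (c := - c).
- by rewrite opprK.
- by rewrite opprK dc oppr0.
have := sol_zero S ha hb ltac:(lra); lra.
Qed.

End Bound.

Section Rises.
Context {R : realType}.
Variable p : R.
Hypotheses (p0 : 0 < p) (p1 : p < 1).
Implicit Types (a b c s t : R).

Let C : R := 4 / p.
Let pC : [/\ 0 < p, p < 1, 0 < C & 4 < C].
Proof.
by split => //; [rewrite divr_gt0|rewrite ltr_pdivlMr//; have := p1; lra].
Qed.

Lemma sol_dh_le eps f h dh : circle_solution p eps f h dh -> 0 <= eps ->
  eps <= (1 - p) / 4 -> forall t, 0 < h t -> dh t <= C.
Proof.
move=> S e0 e1 t ht; have hC := sol_le p0 p1 S e0 e1.
rewrite leNgt; apply/negP => Cd.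
have /deriveP/(_ ((dh t - C) / 2)) := sol_derive S ht.
case=> [|r r0 rP]; first lra_from Cd.
have := rP (t + r / 2); rewrite addrAC subrr add0r gtr0_norm; last lra_from r0.
move=> /(_ ltac:(lra_from r0)); rewrite ler_norml => /andP[+ _].
have := sol_lipschitz S hC (t + r / 2) t.
rewrite addrAC subrr add0r [X in _ <= _ * X]gtr0_norm ?ler_norml; last lra_from r0.
by move=> /andP[_]; rewrite -/C; nra_from Cd r0.
Qed.

(** A rise over a half circle is almost flat. Comparing the solution with its
    mirror image in the middle of the half circle, [d] below solves
    [d'' + d <= 0] with [d = O(eps)] in the middle and [d' <= 0] at the start;
    the test function [cos] turns this into an upper bound for the integral of
    the right-hand side. The factor [k] in front of the smaller value absorbs
    the variation of [f]. *)
Lemma half_circle_rise (A : R) : 0 < A -> exists2 e1 : R, 0 < e1 &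
  forall eps f h dh, circle_solution p eps f h dh -> 0 <= eps ->
    eps <= (1 - p) / 4 -> eps <= e1 ->
    forall a, rising h dh a (a + pi) -> h (a + pi) - h a < A.
Proof.
wlog AC : A / A <= C => [hw A0|A0].
  have [||e1 e10 H] := hw (Num.min A C); first by rewrite ge_min lexx orbT.
    by rewrite lt_min A0; case: pC.
  exists e1 => // eps f h dh S e0 ep e1' a ra.
  by have := H eps f h dh S e0 ep e1' a ra; rewrite lt_min => /andP[].
have [p_gt0 p_lt1 C0 C4] := pC; have pi2 := @pi_ge2 R.
pose c0 := (1 - p) * C `^ (p - 2).
have c00 : 0 < c0 by apply: mulr_gt0; [lra_from p_lt1|exact: powR_gt0].
pose l := A / (4 * C).
have l0 : 0 < l by apply: divr_gt0; lra_from AC A0.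
have lA : C * l = A / 4 by rewrite /l; field; lra_from AC A0.
have l1 : l <= 1 / 4 by rewrite ler_pdivrMr; lra_from A0 AC.
have c0Al : 0 < c0 * A * l by apply: mulr_gt0 => //; exact: mulr_gt0.
exists (c0 * A * l / (128 * C)); first by apply: divr_gt0; lra_from AC A0 c0Al.
move=> eps f h dh S e0 ep; rewrite ler_pdivlMr; last lra_from AC A0.
move=> eps_small a ra; have hC := sol_le p0 p1 S e0 ep.
have lip := sol_lipschitz S hC.
rewrite ltNge; apply/negP => hA.
have ad t : a < t < a + pi -> 0 < h t /\ 0 < dh t by exact: ra.2.
pose k := (1 + eps) / (1 - eps).
have kE : k * (1 - eps) = 1 + eps by rewrite /k; field; lra_from p_gt0 ep.
have k1 : k - 1 <= 4 * eps.
  have : k * (1 - eps) <= (1 + 4 * eps) * (1 - eps) by rewrite kE; nra_from p_gt0 e0 ep.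
  by rewrite ler_pM2r; lra_from p_gt0 ep.
have k0 : 1 <= k by rewrite /k ler_pdivlMr; lra_from p_gt0 ep e0.
pose Y t := 2 * a + pi - t.
pose d t := h (Y t) - k * h t.
pose d1 t := - dh (Y t) - k * dh t.
pose ddh t := f t * h t `^ (p - 1) - h t.
pose G t := d1 t * cos (t - a) + d t * sin (t - a).
have Gd t : a < t < a + pi ->
    is_derive t 1 G ((ddh (Y t) - k * ddh t + d t) * cos (t - a)).
  move=> tab; have [ht _] := ad t tab.
  have [hY _] : 0 < h (Y t) /\ 0 < dh (Y t) by apply: ad; rewrite /Y; lra_from tab.
  have h1 := sol_derive S ht; have h2 := sol_derive2 S ht.
  have h3 := derive_reflect (sol_derive S hY).
  have h4 := derive_reflect (sol_derive2 S hY).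
  by rewrite /G /d1 /d /Y /ddh; derive; rewrite /Y; ring.
have rhs t : a < t <= a + pi / 2 ->
    ddh (Y t) - k * ddh t + d t <= - (h t `^ (p - 1) - h (Y t) `^ (p - 1)).
  move=> /andP[at_ tm]; have [ht _] := ad t ltac:(lra_from at_ tm).
  have [hY _] : 0 < h (Y t) /\ 0 < dh (Y t) by apply: ad; rewrite /Y; lra_from at_ tm.
  have hle : h t <= h (Y t) by apply: (rising_le S ra); rewrite /Y; lra_from tm at_.
  have Ple : h (Y t) `^ (p - 1) <= h t `^ (p - 1) by apply: ler_powR_neg; lra_from hle ht p_lt1.
  have PY := powR_gt0 (p - 1) hY; have Pt := powR_gt0 (p - 1) ht.
  have [fl fr] := sol_near_bounds S t; have [gl gr] := sol_near_bounds S (Y t).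
  rewrite /ddh /d; move: PY Pt Ple; set P := h t `^ _; set Q := h (Y t) `^ _ => Q0 P0 QP.
  have h1 : f (Y t) * Q <= (1 + eps) * Q by rewrite ler_pM2r.
  have h2 : (1 + eps) * P <= k * (f t * P).
    by rewrite -kE -mulrA ler_pM2l ?ler_pM2r//; lra_from k0.
  have h3 : 0 <= eps * (P - Q) by apply: mulr_ge0; lra_from QP e0.
  lra_from h1 h2 h3.
have Gmid : - (4 * eps * C) <= G (a + pi / 2).
  rewrite /G addrAC subrr add0r cos_pihalf sin_pihalf mulr0 add0r mulr1 /d.
  have -> : Y (a + pi / 2) = a + pi / 2 by rewrite /Y; lra_alone.
  have := hC (a + pi / 2); have := sol_ge0 S (a + pi / 2).
  rewrite -/C; set H := h _ => H0 HC.
  have : (k - 1) * H <= 4 * eps * C by apply: ler_pM => //; lra_from k0.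
  lra_alone.
have cosp t : a < t -> t <= a + pi / 2 -> 0 <= cos (t - a).
  by move=> at_ tm; apply: cos_ge0_pihalf; lra_from at_ tm.
have Gl : - (4 * eps * C) <= G (a + l).
  apply: le_trans Gmid _.
  have [x xab|c /andP[lc cm] e] := @mvt _ G
    (fun t => (ddh (Y t) - k * ddh t + d t) * cos (t - a)) (a + l) (a + pi / 2) ltac:(lra_from pi2 l1).
    by apply: Gd; lra_from l0 xab.
  rewrite -subr_le0 e; apply: mulr_le0_ge0; last lra_from pi2 l1.
  apply: mulr_le0_ge0; last by apply: cosp; lra_from cm l0 lc.
  apply: le_trans (rhs c _) _; first lra_from l0 lc cm.
  rewrite oppr_le0 subr_ge0; have [hc _] := ad c ltac:(lra_from l0 lc cm).
  apply: ler_powR_neg => //; first lra_from p_lt1.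
  by apply: (rising_le S ra); rewrite /Y; lra_from cm l0 lc.
have Gup s : a < s -> s < a + l -> G s <= C * (s - a).
  move=> as_ sl; have [hs ds] := ad s ltac:(lra_from pi2 l1 as_ sl).
  have [hY dY] : 0 < h (Y s) /\ 0 < dh (Y s) by apply: ad; rewrite /Y; lra_from pi2 l1 as_ sl.
  have c_ge0 := cosp s as_ ltac:(lra_from pi2 l1 sl).
  have s_le : sin (s - a) <= s - a by apply: sin_le_id; lra_from as_.
  have s_ge0 : 0 <= sin (s - a) by apply: sin_ge0_pi; lra_from pi2 l1 as_ sl.
  have d1_le : d1 s <= 0 by rewrite /d1; nra_from p_gt0 e0 ep kE ds dY.
  have d_le : d s <= C by have := hC (Y s); rewrite /d -/C; nra_from p_gt0 e0 ep kE hs.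
  have e1 : d1 s * cos (s - a) <= 0 by exact: mulr_le0_ge0.
  have e2 : d s * sin (s - a) <= C * sin (s - a) by exact: ler_wpM2r.
  have e3 : C * sin (s - a) <= C * (s - a) by rewrite ler_pM2l.
  by rewrite /G; lra_from e1 e2 e3.
have Gdrop t : a < t <= a + l ->
    (ddh (Y t) - k * ddh t + d t) * cos (t - a) <= - (c0 * A / 4).
  move=> /andP[at_ tl].
  have c12 : 1 / 2 <= cos (t - a) by apply: le_trans (cos_ge_quad _); nra_from l1 at_ tl.
  have [ht _] := ad t ltac:(lra_from pi2 l1 at_ tl).
  have gap : A / 2 <= h (Y t) - h t.
    have := lip (Y t) (a + pi); have := lip t a.
    have -> : Y t - (a + pi) = - (t - a) by rewrite /Y; lra_alone.
    rewrite normrN [`|t - a|]gtr0_norm; last lra_from at_.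
    rewrite -/C !ler_norml => /andP[_ u1] /andP[u2 _].
    have : C * (t - a) <= C * l by rewrite ler_pM2l//; lra_from tl.
    lra_from lA hA u1 u2.
  have := powR_neg_gap p0 p1 ht (_ : h t <= h (Y t)) (hC (Y t)).
  move=> /(_ ltac:(lra_from A0 gap)); rewrite -/C -/c0 => pgap.
  have c0gap : c0 * (A / 2) <= c0 * (h (Y t) - h t) by rewrite ler_pM2l.
  have := rhs t ltac:(lra_from pi2 l1 at_ tl); set X := _ + d t => Xl.
  have c0A : 0 < c0 * A by exact: mulr_gt0.
  nra_from c12 pgap c0gap Xl c0A.
pose s := a + Num.min (l / 2) (c0 * A * l / (32 * C)).
have m1 : Num.min (l / 2) (c0 * A * l / (32 * C)) <= l / 2 by rewrite ge_min lexx.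
have m2 : Num.min (l / 2) (c0 * A * l / (32 * C)) <= c0 * A * l / (32 * C).
  by rewrite ge_min lexx orbT.
have m0 : 0 < Num.min (l / 2) (c0 * A * l / (32 * C)).
  by rewrite lt_min divr_gt0//= divr_gt0//; lra_from AC A0.
have Cs : C * (s - a) <= c0 * A * l / 32.
  rewrite /s addrAC subrr add0r; apply: (@le_trans _ _ (C * (c0 * A * l / (32 * C)))).
    by rewrite ler_pM2l.
  have -> // : C * (c0 * A * l / (32 * C)) = c0 * A * l / 32 by field; lra_from AC A0.
have [x xab|c /andP[sc cl] e] := @mvt _ G
    (fun t => (ddh (Y t) - k * ddh t + d t) * cos (t - a)) s (a + l) ltac:(rewrite /s; lra_from l0 m1).
  by apply: Gd; rewrite /s in xab; lra_from pi2 l1 m0 xab.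
have Gs := Gup s ltac:(rewrite /s; lra_from m0) ltac:(rewrite /s; lra_from l0 m1).
have := Gdrop c ltac:(rewrite /s in sc; lra_from m0 cl sc).
set X := (_ - _ + _) * _ in e * => Xl.
have len : l / 2 <= a + l - s by rewrite /s; lra_from m1.
have : X * (a + l - s) <= - (c0 * A / 4) * (l / 2).
  have : 0 < c0 * A by exact: mulr_gt0.
  nra_from l0 Xl len.
lra_from c0Al eps_small Gl Cs Gs e.
Qed.

End Rises.

Section ShortRises.
Context {R : realType}.
Variable p : R.
Hypotheses (p0 : 0 < p) (p1 : p < 1).
Implicit Types (a b c s t : R).

Let C : R := 4 / p.
Let pC : [/\ 0 < p, p < 1, 0 < C & 4 < C].
Proof.
by split => //; [rewrite divr_gt0|rewrite ltr_pdivlMr//; have := p1; lra].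
Qed.

Lemma critical_flux eps f h dh a b e : circle_solution p eps f h dh -> 0 <= eps ->
  eps <= (1 - p) / 4 -> critical h dh a -> 0 < e ->
  exists2 r : R, 0 < r & forall s, `|s - a| < r -> 0 < h s -> 0 < dh s ->
    h s * dh s < e.
Proof.
move=> S e0 ep cra epos; have [p_gt0 p_lt1 C0 _] := pC.
have hC := sol_le p0 p1 S e0 ep.
have eC : 0 < e / C by exact: divr_gt0.
case: cra => [ha|[ha da]].
  have /continuousP_eps/(_ _ eC)[r r0 rP] := sol_continuous S a.
  exists r => // s sr hs ds; have := rP s sr; rewrite ha subr0 gtr0_norm// => hsl.
  have := sol_dh_le p0 p1 S e0 ep hs => dsC.
  apply: (@le_lt_trans _ _ (h s * C)); first by rewrite ler_pM2l.
  by rewrite -ltr_pdivlMr.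
have /continuousP_eps/(_ _ eC)[r r0 rP] := dh_continuous S ha.
exists r => // s sr hs ds; have := rP s sr; rewrite da subr0 gtr0_norm// => dsl.
apply: (@le_lt_trans _ _ (C * dh s)); first by rewrite ler_pM2r//; exact: hC.
by rewrite mulrC -ltr_pdivlMr.
Qed.

(** A rise between two critical points over at most a quarter of the circle is
    almost flat. For [y = h^2/2] the equation reads [y'' + 4 y = N + f h^p],
    with an [N = h'^2 + h^2] that increases with [h]; the mirror difference [d]
    of [y] then satisfies [d'' + 4 d >= - O(eps)], and the test function
    [sin (a + b - 2 t)] has its first zero not before the middle. *)
Lemma quarter_circle_rise (A : R) : 0 < A -> exists2 e1 : R, 0 < e1 &
  forall eps f h dh, circle_solution p eps f h dh -> 0 <= eps ->
    eps <= (1 - p) / 4 -> eps <= e1 ->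
    forall a b, rising h dh a b -> critical h dh a -> dh b = 0 ->
      b - a <= pi / 2 -> h b - h a < A.
Proof.
wlog AC : A / A <= C => [hw A0|A0].
  have [||e1 e10 H] := hw (Num.min A C); first by rewrite ge_min lexx orbT.
    by rewrite lt_min A0; case: pC.
  exists e1 => // eps f h dh S e0 ep e1' a b ra ca db ba.
  by have := H eps f h dh S e0 ep e1' a b ra ca db ba; rewrite lt_min => /andP[].
have [p_gt0 p_lt1 C0 C4] := pC; have pi2 := @pi_ge2 R; have pi4 := @pi_le4 R.
pose beta := p * C `^ (p - 1) * (A / 2).
have beta0 : 0 < beta.
  by apply: mulr_gt0; [apply: mulr_gt0 => //; exact: powR_gt0|lra_from A0].
have Cp0 : 0 < C `^ p by exact: powR_gt0.
pose l := A / (16 * C).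
have l0 : 0 < l by apply: divr_gt0; lra_from AC A0.
have lA : C * l = A / 16 by rewrite /l; field; lra_from AC A0.
have l1 : l <= 1 / 16 by rewrite ler_pdivrMr; lra_from A0 AC.
have bl : 0 < beta * l ^+ 2 by apply: mulr_gt0 => //; exact: exprn_gt0.
exists (beta * l ^+ 2 / (16 * C `^ p)); first by apply: divr_gt0; lra_from Cp0 bl.
move=> eps f h dh S e0 ep; rewrite ler_pdivlMr; last lra_from Cp0.
move=> eps_small a b ra ca db ba; have hC := sol_le p0 p1 S e0 ep.
pose mu := 2 * eps * C `^ p.
have mu0 : 0 <= mu by apply: mulr_ge0; lra_from Cp0 e0.
have mul : mu <= beta * l ^+ 2 / 8 by rewrite /mu; lra_from eps_small.
have lip := sol_lipschitz S hC.
rewrite ltNge; apply/negP => hA.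
have [ltab ad] := ra; have hb := rising_top_gt0 S ra.
have Ctau : A <= C * (b - a).
  have := lip b a; rewrite [X in _ <= _ * X]gtr0_norm; last lra_from ltab.
  by rewrite -/C ler_norml => /andP[_]; lra_from hA.
have tau : 16 * l <= b - a.
  have : C * (16 * l) <= C * (b - a) by lra_from lA Ctau.
  by rewrite ler_pM2l.
pose m := (a + b) / 2.
pose Y t := a + b - t.
pose d t := h (Y t) ^+ 2 / 2 - h t ^+ 2 / 2.
pose d1 t := - (h (Y t) * dh (Y t)) - h t * dh t.
pose ddy t := dh t ^+ 2 + h t * (f t * h t `^ (p - 1) - h t).
pose Phi t := d1 t * sin (a + b - 2 * t) + 2 * (d t * cos (a + b - 2 * t)).
have Phid t : a < t < b ->
    is_derive t 1 Phi ((ddy (Y t) - ddy t + 4 * d t) * sin (a + b - 2 * t)).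
  move=> tab; have [ht _] := ad t tab.
  have [hY _] : 0 < h (Y t) /\ 0 < dh (Y t) by apply: ad; rewrite /Y; lra_from tab.
  have h1 := sol_derive S ht; have h2 := sol_derive2 S ht.
  have h3 := derive_reflect (sol_derive S hY).
  have h4 := derive_reflect (sol_derive2 S hY).
  by rewrite /Phi /d1 /d /Y /ddy; derive; rewrite /Y; field.
have rhs t : a < t <= m ->
    h (Y t) `^ p - h t `^ p - mu <= ddy (Y t) - ddy t + 4 * d t /\
    0 <= h (Y t) `^ p - h t `^ p.
  rewrite /m => /andP[at_ tm]; have [ht _] := ad t ltac:(lra_from at_ tm).
  have [hY _] : 0 < h (Y t) /\ 0 < dh (Y t) by apply: ad; rewrite /Y; lra_from at_ tm.
  have hle : h t <= h (Y t) by apply: (rising_le S ra); rewrite /Y; lra_from tm at_.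
  have Ple : h t `^ p <= h (Y t) `^ p.
    by apply: ler_powR_pos => //; exact: ltW.
  have PC : h t `^ p <= C `^ p.
    by apply: ler_powR_pos; [exact: ltW|exact: ltW|exact: hC].
  have tY : t <= Y t by rewrite /Y; lra_from tm.
  have Yb : Y t < b by rewrite /Y; lra_from at_.
  have [en _] := energy_rising p0 S ra at_ tY Yb; rewrite /energy in en.
  have [fl fr] := sol_near_bounds S t; have [gl gr] := sol_near_bounds S (Y t).
  have Pt := powR_gt0 p ht; have PY := powR_gt0 p hY.
  have Et u : 0 < h u -> h u * (f u * h u `^ (p - 1) - h u) = f u * h u `^ p - h u ^+ 2.
    by move=> hu; rewrite -(mulr_powRB p0 (ltW hu)); ring.
  rewrite /ddy /d !Et//.
  have k2 : 2 <= 2 / p by rewrite ler_pdivlMr//; lra_from p_lt1.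
  move: en Pt PY Ple PC; rewrite /mu; set P := h t `^ p; set Q := h (Y t) `^ p.
  set k := 2 / p in k2 *.
  move=> en P0 Q0 PQ PC; split; last lra_from PQ.
  have h1 : (1 - eps) * Q <= f (Y t) * Q by rewrite ler_pM2r.
  have h2 : f t * P <= (1 + eps) * P by rewrite ler_pM2r.
  have h3 : eps * P <= eps * C `^ p by exact: ler_wpM2l.
  have h4 : 0 <= (k * (1 - eps) - 1) * (Q - P) by apply: mulr_ge0; [nra_from p_gt0 ep k2|lra_from PQ].
  have h5 : 0 <= (1 - eps) * (Q - P) by apply: mulr_ge0; lra_from PQ p_gt0 ep.
  lra_from en h1 h2 h3 h4 h5.
have sinp t : a < t -> t <= m -> 0 <= sin (a + b - 2 * t).
  by rewrite /m => at_ tm; apply: sin_ge0_pi; lra_from ba at_ tm.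
(* off the part where the gap is large, the derivative is at least [- mu] *)
have slow u v : a < u -> u < v -> v <= m -> Phi u - mu * (v - u) <= Phi v.
  move=> au uv vm; have [x xab|c /andP[uc cv] e] := @mvt _ Phi
    (fun t => (ddy (Y t) - ddy t + 4 * d t) * sin (a + b - 2 * t)) u v uv.
    by apply: Phid; rewrite /m in vm; lra_from au xab vm.
  have [r1 r2] := rhs c ltac:(lra_from au vm uc cv); have := sinp c ltac:(lra_from au uc) ltac:(lra_from vm cv).
  have := sin_le1 (a + b - 2 * c); rewrite -subr_ge0 in e *.
  move: e r1; set s := sin _; set X := _ + 4 * d c => e r1 s1 s0.
  have : - mu <= X * s by nra_from mu0 r2 r1 s1 s0.
  have vu : 0 < v - u by lra_from uv.
  by move=> /(ler_wpM2r (ltW vu)); rewrite -e; lra_alone.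
have Phim : Phi m = 0.
  have Ym : Y m = m by rewrite /Y /m; lra_alone.
  by rewrite /Phi /d Ym subrr mul0r mulr0 addr0 (_ : a + b - 2 * m = 0)
    ?sin0 ?mulr0// /m; lra_alone.
have l12 : a + 2 * l <= m by rewrite /m; lra_from l0 tau.
have fast : Phi (a + l) + (beta - mu) * l * l <= Phi (a + 2 * l).
  have [x xab|c /andP[uc cv] e] := @mvt _ Phi
    (fun t => (ddy (Y t) - ddy t + 4 * d t) * sin (a + b - 2 * t))
      (a + l) (a + 2 * l) ltac:(lra_from l0).
    by apply: Phid; rewrite /m in l12; lra_from l0 tau xab.
  have [r1 r2] := rhs c ltac:(lra_from l12 uc cv).
  have [hc _] := ad c ltac:(rewrite /m in l12; lra_from tau uc cv).
  have gap : A / 2 <= h (Y c) - h c.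
    have := lip (Y c) b; have := lip c a.
    have -> : Y c - b = - (c - a) by rewrite /Y; lra_alone.
    rewrite normrN [`|c - a|]gtr0_norm; last lra_from l0 uc.
    rewrite -/C !ler_norml => /andP[_ u1] /andP[u2 _].
    have : C * (c - a) <= C * (2 * l) by rewrite ler_pM2l//; lra_from cv.
    lra_from A0 lA hA u1 u2.
  have hcY : h c <= h (Y c) by lra_from A0 gap.
  have pgap := powR_gap p0 p1 hc hcY (hC (Y c)); rewrite -/C in pgap.
  have bgap : beta <= p * C `^ (p - 1) * (h (Y c) - h c).
    by rewrite /beta ler_pM2l//; apply: mulr_gt0 => //; exact: powR_gt0.
  have sl : l <= sin (a + b - 2 * c).
    by apply: le_trans (sin_ge_quarter _ _); lra_from ba uc l0 tau cv.
  have ll : l ^+ 2 <= 1 by rewrite expr2; nra_from AC A0 lA.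
  have bmu : 0 <= beta - mu.
    by have : beta * l ^+ 2 <= beta; [rewrite ger_pMr|lra_from beta0 mul].
  move: e r1; set s := sin _ in sl *; set X := _ + 4 * d c => e r1.
  have : (beta - mu) * l <= X * s by apply: ler_pM; lra_from bmu l0 r1 bgap pgap sl.
  move=> /(ler_wpM2r (ltW l0)); lra_from e.
(* the boundary terms at [a] and [b] vanish in the limit *)
have [r1 r10 r1P] := @critical_flux _ _ _ _ a b (beta * l ^+ 2 / 4) S e0 ep ca ltac:(lra_from bl).
have [r2 r20 r2P] := @critical_flux _ _ _ _ b b (beta * l ^+ 2 / 4) S e0 ep
  (or_intror (conj hb db)) ltac:(lra_from bl).
have [s /andP[as_ sl] sr] := @point_right _ a (a + l) (Num.min r1 r2)
  ltac:(lra_from l0) ltac:(rewrite lt_min r10; exact: r20).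
have [sr1 sr2] : s - a < r1 /\ s - a < r2.
  have : s - a < Num.min r1 r2 by lra_from sr.
  by rewrite lt_min => /andP[].
have [hs ds] := ad s ltac:(lra_from as_ sl tau l0).
have [hY dY] : 0 < h (Y s) /\ 0 < dh (Y s) by apply: ad; rewrite /Y; lra_from as_ sl tau l0.
have f1 : h s * dh s < beta * l ^+ 2 / 4 by apply: r1P => //; rewrite gtr0_norm; lra_from sr1 as_.
have f2 : h (Y s) * dh (Y s) < beta * l ^+ 2 / 4.
  apply: r2P => //; have -> : Y s - b = - (s - a) by rewrite /Y; lra_alone.
  by rewrite normrN gtr0_norm; lra_from sr2 as_.
have Phis : - (beta * l ^+ 2 / 2) < Phi s.
  have c0 : 0 <= cos (a + b - 2 * s) by apply: cos_ge0_pihalf; lra_from ba as_ sl tau l0 pi2.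
  have d0 : 0 <= d s.
    have hle : h s <= h (Y s) by apply: (rising_le S ra); rewrite /Y; lra_from as_ sl tau l0.
    by rewrite /d; nra_from hle hs hY.
  have dc : 0 <= d s * cos (a + b - 2 * s) by exact: mulr_ge0.
  have q1 : 0 < h s * dh s by exact: mulr_gt0.
  have q2 : 0 < h (Y s) * dh (Y s) by exact: mulr_gt0.
  have s0 := sinp s as_ ltac:(lra_from l12 sl l0); have s1 := sin_le1 (a + b - 2 * s).
  rewrite /Phi /d1; move: s0 s1 f1 f2 q1 q2.
  set q := sin _; set u := _ * dh s; set v := _ * dh (Y s).
  move=> s0 s1 f1 f2 q1 q2.
  have : u * q <= u by rewrite ger_pMr.
  have : v * q <= v by rewrite ger_pMr.
  lra_from f1 f2 dc.
have s1 := slow s (a + l) as_ sl ltac:(lra_from l12 l0).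
have s2 : Phi (a + 2 * l) - mu * 1 <= 0.
  rewrite -Phim; have := l12; rewrite le_eqVlt => /predU1P[->|lm]; first lra_from mu0.
  have := slow (a + 2 * l) m ltac:(lra_from l0) lm (lexx m).
  have : mu * (m - (a + 2 * l)) <= mu * 1 by apply: ler_wpM2l => //; rewrite /m; lra_from ba pi4 l0.
  lra_alone.
have s3 : mu * (a + l - s) <= mu * 1 by apply: ler_wpM2l => //; lra_from as_ l1.
have s4 : mu * l * l <= mu * 1.
  by rewrite -mulrA; apply: ler_wpM2l => //; nra_from l0 l1.
have s5 : beta * l ^+ 2 = beta * l * l by ring.
lra_from fast Phis s1 s2 s3 s4 s5 mul mu0 bl.
Qed.

End ShortRises.

Section NearOne.
Context {R : realType}.
Variable p : R.
Hypotheses (p0 : 0 < p) (p1 : p < 1).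
Implicit Types (a b c s t x d : R).

Let C : R := 4 / p.
Let pC : [/\ 0 < p, p < 1, 0 < C & 4 < C].
Proof.
by split => //; [rewrite divr_gt0|rewrite ltr_pdivlMr//; have := p1; lra].
Qed.

(** The potential of the equation with [f = 1]; it has a strict minimum at 1. *)
Let V x := x ^+ 2 - 2 / p * x `^ p.

Lemma potential_derive x : 0 < x -> is_derive x 1 V (2 * x - 2 * x `^ (p - 1)).
Proof.
move=> x0; rewrite /V; derive => //.
have p_neq0 : p != 0 by rewrite gt_eqF.
by field.
Qed.

Lemma potential_decr x y : 0 < x -> x <= y -> y <= 1 -> V y <= V x.
Proof.
move=> x0; rewrite le_eqVlt => /predU1P[->//|xy] y1.
have [z /andP[xz zy]|c /andP[xc cy] e] := mvt (df := fun x => 2 * x - 2 * x `^ (p - 1)) (f := V) xy.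
  by apply: potential_derive; exact: lt_le_trans xz.
rewrite -subr_le0 e; apply: mulr_le0_ge0; last lra_from xy.
have : 1 <= c `^ (p - 1) by apply: powR_ge1; have := p1; lra_from y1 cy x0 xc.
lra_from y1 cy.
Qed.

Lemma potential_incr x y : 1 <= x -> x <= y -> V x <= V y.
Proof.
move=> x1; rewrite le_eqVlt => /predU1P[->//|xy].
have [z /andP[xz zy]|c /andP[xc cy] e] := mvt (df := fun x => 2 * x - 2 * x `^ (p - 1)) (f := V) xy.
  by apply: potential_derive; lra_from x1 xz.
rewrite -subr_ge0 e; apply: mulr_ge0; last lra_from xy.
have : c `^ (p - 1) <= 1 by apply: powR_le1; have := p1; lra_from x1 xc.
lra_from x1 xc.
Qed.

Lemma potential_min_lt x : 0 < x -> x != 1 -> V 1 < V x.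
Proof.
move=> x0; rewrite neq_lt => /orP[x1|x1].
  have [z /andP[xz zy]|c /andP[xc cy] e] := mvt (df := fun x => 2 * x - 2 * x `^ (p - 1)) (f := V) x1.
    by apply: potential_derive; lra_from x0 xz.
  rewrite -subr_lt0 e nmulr_rlt0; first lra_from x1.
  have : 1 <= c `^ (p - 1) by apply: powR_ge1; have := p1; lra_from cy x0 xc.
  lra_from cy.
have [z /andP[xz zy]|c /andP[xc cy] e] := mvt (df := fun x => 2 * x - 2 * x `^ (p - 1)) (f := V) x1.
  by apply: potential_derive; lra_from xz.
rewrite -subr_gt0 e; apply: mulr_gt0; last lra_from x1.
have : c `^ (p - 1) <= 1 by apply: powR_le1; have := p1; lra_from xc.
lra_from xc.
Qed.

(** A well of the potential below a given level at distance [d] from 1. *)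
Lemma potential_well x : 0 < x -> x != 1 -> exists2 r : R, 0 < r < 1 &
  forall e y, e <= (V x - V 1) / 2 -> 0 < y -> V x - e <= V y -> r <= `|y - 1|.
Proof.
move=> x0 x1; have Vx := potential_min_lt x0 x1.
have /derive_continuous/continuousP_eps/(_ ((V x - V 1) / 2)) :=
  potential_derive (@ltr01 R).
case=> [|r r0 rP]; first lra_from Vx.
exists (Num.min r (1 / 2)).
  by rewrite lt_min r0 gt_min; apply/andP; split; lra_alone.
move=> e y ey y0 Vy; rewrite leNgt lt_min; apply/negP => /andP[/rP + _].
by rewrite ltr_norml => /andP[_]; lra_from ey Vy.
Qed.

Lemma bottom_le eps f h dh a b : circle_solution p eps f h dh ->
  rising h dh a b -> 0 < h a -> dh a = 0 -> h a <= 1 + eps.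
Proof.
move=> S ra ha da; have bot := critical_bottom S ra ha da.
have [fl fr] := sol_near_bounds S a.
have eps0 : 0 <= eps by apply: le_trans (sol_near1 S a).
have [h1|h1] := leP (h a) 1; first lra_from fl fr h1.
have P1 : h a `^ (p - 1) <= 1 by apply: powR_le1; have := p1; lra_from h1.
have P0 := powR_gt0 (p - 1) ha.
apply: le_trans bot _; apply: (@le_trans _ _ ((1 + eps) * h a `^ (p - 1))).
  by rewrite ler_pM2r.
by rewrite ger_pMr//; lra_from fl fr.
Qed.

Lemma top_ge eps f h dh a b : circle_solution p eps f h dh -> eps <= 1 ->
  rising h dh a b -> dh b = 0 -> 1 - eps <= h b.
Proof.
move=> S e1 ra db; have hb := rising_top_gt0 S ra.
have top := critical_top S ra db; have [fl fr] := sol_near_bounds S b.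
have eps0 : 0 <= eps by apply: le_trans (sol_near1 S a).
have [h1|h1] := leP 1 (h b); first lra_from fl fr h1.
have P1 : 1 <= h b `^ (p - 1) by apply: powR_ge1; have := p1; lra_from h1 hb.
apply: le_trans top; apply: (@le_trans _ _ ((1 - eps) * h b `^ (p - 1))).
  by rewrite ler_peMr//; lra_from e1.
by rewrite ler_pM2r//; exact: powR_gt0.
Qed.

(** The energy is almost conserved, so the end of the rise lies on the other side
    of the well of the potential, and as the rise is not small, the two estimates
    of the rises over a quarter and over half of the circle bound its length. *)
Lemma rise_from_bottom d : 0 < d -> d < 1 -> exists2 r : R, 0 < r < 1 &
  exists2 e1 : R, 0 < e1 &
  forall eps f h dh, circle_solution p eps f h dh -> 0 <= eps ->
    eps <= (1 - p) / 4 -> eps <= e1 ->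
  forall a, critical h dh a -> h a <= 1 - d -> exists b,
    [/\ rising h dh a b, 0 < h b, dh b = 0, pi / 2 < b - a < pi & 1 + r <= h b].
Proof.
move=> d0 d1; have [p_gt0 p_lt1 C0 C4] := pC; have pi2 := @pi_ge2 R.
have dneq : 1 - d != 1 by rewrite lt_eqF//; lra_from d0.
have [r r01 rP] := @potential_well (1 - d) ltac:(lra_from d1) dneq.
have Vd : 0 < V (1 - d) - V 1 by rewrite subr_gt0; apply: potential_min_lt => //; lra_from d1.
have [eU eU0 U] := @half_circle_rise R p p0 p1 (d / 8) ltac:(lra_from d0).
have [eL eL0 L] := @quarter_circle_rise R p p0 p1 (d / 2) ltac:(lra_from d0).
have Cp0 : 0 < C `^ p by exact: powR_gt0.
pose eV := (V (1 - d) - V 1) / (2 * (2 / p * C `^ p)).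
have kC0 : 0 < 2 / p * C `^ p by rewrite mulr_gt0 ?divr_gt0.
have eV0 : 0 < eV by apply: divr_gt0; lra_from kC0 Vd.
exists r => //; exists (Num.min (Num.min eU eL) (Num.min eV (Num.min (d / 4) (r / 2)))).
  by rewrite !lt_min eU0 eL0 eV0/= !divr_gt0//; lra_from r01.
move=> eps f h dh S e0 ep; rewrite !le_min => /andP[/andP[epU epL] /andP[epV /andP[epd epr]]].
move=> a ca ha; have hC := sol_le p0 p1 S e0 ep.
have [b [rb hb db]] : exists b, [/\ rising h dh a b, 0 < h b & dh b = 0].
  apply: (rising_extend p0 p1 S e0 ep); case: ca => [?|[ha0 da]]; [by left|right].
  split => //; have [fl _] := sol_near_bounds S a.
  have : 1 <= h a `^ (p - 1) by apply: powR_ge1; lra_from d0 ha ha0 p_lt1.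
  nra_from d0 d1 epd ha fl.
have epsC : eps * (2 / p * C `^ p) <= (V (1 - d) - V 1) / 2.
  move: epV; rewrite /eV ler_pdivlMr; last lra_from kC0.
  lra_alone.
have b_ge := top_ge S ltac:(lra_from p_gt0 ep) rb db.
exists b; split => //; last first.
  have Pb : h b `^ p <= C `^ p by apply: ler_powR_pos; [lra_from p_gt0|exact: ltW|exact: hC].
  have kP : 2 / p * (eps * h b `^ p) <= 2 / p * (eps * C `^ p).
    by rewrite ler_pM2l ?divr_gt0//; exact: ler_wpM2l.
  have := rP (eps * (2 / p * C `^ p)) (h b) epsC hb; rewrite {2}/V.
  suff VV : V (1 - d) - eps * (2 / p * C `^ p) <= h b ^+ 2 - 2 / p * h b `^ p.
    by move=> /(_ VV); rewrite ler_normr => /orP[]; lra_from epr b_ge.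
  have [ha0|[ha0 da]] := ca.
    have V0 : V (1 - d) <= 0.
      have x1 : 1 - d <= (1 - d) `^ p by apply: ger1_powR; lra_from p_lt1 d0 d1.
      have k2 : 2 <= 2 / p by rewrite ler_pdivlMr//; lra_from p_lt1.
      have : (1 - d) ^+ 2 <= 1 - d by rewrite expr2; nra_from d0 d1.
      rewrite /V; nra_from d1 x1 k2.
    (* the energy at the top is the limit of the energies below it *)
    have en0 : 0 <= energy p h dh (1 - eps) b.
      rewrite leNgt; apply/negP => en.
      have /derive_continuous/continuousP_eps/(_ (- energy p h dh (1 - eps) b)) :=
        energy_derive p0 S (1 - eps) hb.
      case=> [|q q0 qP]; first lra_from en.
      have [ab _] := rb; pose t := b - Num.min (q / 2) ((b - a) / 2).
      have m1 : Num.min (q / 2) ((b - a) / 2) <= q / 2 by rewrite ge_min lexx.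
      have m2 : Num.min (q / 2) ((b - a) / 2) <= (b - a) / 2 by rewrite ge_min lexx orbT.
      have m0 : 0 < Num.min (q / 2) ((b - a) / 2) by rewrite lt_min; lra_from q0 ab.
      have at_ : a < t by rewrite /t; lra_from ab m2.
      have tb : t < b by rewrite /t; lra_from m0.
      have := energy_from_zero p0 p1 S e0 ep rb ha0 at_ tb.
      have := qP t; rewrite /t addrAC subrr add0r normrN gtr0_norm// -/t.
      by move=> /(_ ltac:(lra_from q0 m1)); rewrite ltr_norml => /andP[_]; lra_alone.
    move: en0; rewrite /energy db expr0n add0r; lra_from kP V0.
  have [en _] := energy_critical p0 S rb ha0 da db.
  have Va : V (1 - d) <= h a ^+ 2 - 2 / p * h a `^ p.
    by apply: (potential_decr ha0 ha); lra_from d0.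
  have Pa : 0 <= 2 / p * (eps * h a `^ p).
    by apply: mulr_ge0; [apply: divr_ge0; lra_from p_gt0|apply: mulr_ge0 => //; exact: powR_ge0].
  lra_from kP en Va Pa.
apply/andP; split.
  rewrite ltNge; apply/negP => bl.
  have := L eps f h dh S e0 ep epL a b rb ca db bl; lra_from d0 epd ha b_ge.
rewrite ltNge; apply/negP => bl.
have ra : rising h dh a (a + pi).
  by split => [|t tab]; [lra_from pi2|apply: rb.2; lra_from bl tab].
have amp := U eps f h dh S e0 ep epU a ra.
have h_le t : a <= t <= a + pi -> h t <= 1 - d / 2.
  move=> tab; have : h t <= h (a + pi) by apply: (rising_le S ra); lra_from tab.
  lra_from d0 ha amp.
have ddh t : a < t < a + pi -> d / 4 <= f t * h t `^ (p - 1) - h t.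
  move=> tab; have [ht _] := ra.2 t tab; have := h_le t ltac:(lra_from tab) => hl.
  have : 1 <= h t `^ (p - 1) by apply: powR_ge1; lra_from d0 hl ht p_lt1.
  have [fl _] := sol_near_bounds S t; nra_from d1 epd hl fl.
have dh_ge t : a + 1 <= t < a + 2 -> d / 8 <= dh t.
  move=> tab; have at_ : a + 1 / 2 < t by lra_from tab.
  have [x xab|c /andP[rc ct] e] := @mvt _ dh
    (fun t => f t * h t `^ (p - 1) - h t) _ _ at_.
    by apply: (sol_derive2 S); have [] := ra.2 x ltac:(lra_from pi2 tab xab).
  have [_ dpos] := ra.2 (a + 1 / 2) ltac:(lra_from pi2).
  have := ddh c ltac:(lra_from pi2 tab rc ct); have : 1 / 2 <= t - (a + 1 / 2) by lra_from tab.
  nra_from d0 e dpos.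
have [||c cab e] := @mvt _ h dh (a + 1) (a + 2); first lra_alone.
  move=> x xab; apply: (sol_derive S).
  by apply: le_lt_trans (sol_ge0 S a) _; apply: (rising_lt S ra); lra_from pi2 xab.
have := dh_ge c ltac:(lra_from cab).
have : h (a + 2) <= h (a + pi) by apply: (rising_le S ra); lra_from pi2.
have : h a <= h (a + 1) by apply: (rising_le S ra); lra_from pi2.
have -> : dh c = h (a + 2) - h (a + 1) by rewrite e; ring.
lra_from amp.
Qed.

(** The energy argument backwards in the angle; here the rise may start at a
    zero, where there is nothing to prove on its lower end. *)
Lemma rise_to_top d : 0 < d -> exists2 r : R, 0 < r < 1 &
  exists2 e1 : R, 0 < e1 &
  forall eps f h dh, circle_solution p eps f h dh -> 0 <= eps ->
    eps <= (1 - p) / 4 -> eps <= e1 ->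
  forall b, 0 < h b -> dh b = 0 -> 1 + d <= h b -> exists a,
    [/\ rising h dh a b, critical h dh a, pi / 2 < b - a < pi & h a <= 1 - r].
Proof.
wlog d1 : d / d <= 1 => [hw d0|d0].
  have [||r r01 [e1 e10 H]] := hw (Num.min d 1); first by rewrite ge_min lexx orbT.
    by rewrite lt_min d0 ltr01.
  exists r => //; exists e1 => // eps f h dh S e0 ep e1' b hb db hbd.
  apply: (H eps f h dh S e0 ep e1' b hb db); apply: le_trans hbd.
  by rewrite lerD2l ge_min lexx.
have [p_gt0 p_lt1 C0 C4] := pC; have pi2 := @pi_ge2 R.
have dneq : 1 + d != 1 by rewrite gt_eqF//; lra_from d0.
have [r r01 rP] := @potential_well (1 + d) ltac:(lra_from d0) dneq.
have Vd : 0 < V (1 + d) - V 1 by rewrite subr_gt0; apply: potential_min_lt => //; lra_from d0.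
have [eU eU0 U] := @half_circle_rise R p p0 p1 (d / 8) ltac:(lra_from d0).
have [eL eL0 L] := @quarter_circle_rise R p p0 p1 (d / 2) ltac:(lra_from d0).
have Cp0 : 0 < C `^ p by exact: powR_gt0.
pose eV := (V (1 + d) - V 1) / (2 * (2 / p * C `^ p)).
have kC0 : 0 < 2 / p * C `^ p by rewrite mulr_gt0 ?divr_gt0.
have eV0 : 0 < eV by apply: divr_gt0; lra_from kC0 Vd.
exists r => //; exists (Num.min (Num.min eU eL) (Num.min eV (Num.min (d / 4) (r / 2)))).
  by rewrite !lt_min eU0 eL0 eV0/= !divr_gt0//; lra_from r01.
move=> eps f h dh S e0 ep; rewrite !le_min => /andP[/andP[epU epL] /andP[epV /andP[epd epr]]].
move=> b hb db hbd; have hC := sol_le p0 p1 S e0 ep.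
have [a [ra ca]] : exists a, rising h dh a b /\ critical h dh a.
  apply: (rising_back S) => //; have [_ fr] := sol_near_bounds S b.
  have : h b `^ (p - 1) <= 1 by apply: powR_le1; lra_from d0 hbd p_lt1.
  by have := powR_gt0 (p - 1) hb; nra_from d0 epd hbd fr.
have epsC : eps * (2 / p * C `^ p) <= (V (1 + d) - V 1) / 2.
  move: epV; rewrite /eV ler_pdivlMr; last lra_from kC0.
  lra_alone.
have a_le : h a <= 1 + eps.
  by case: ca => [->|[ha da]]; [lra_from e0|exact: (bottom_le S ra)].
exists a; split => //; last first.
  have [ha0|[ha0 da]] := ca; first by rewrite ha0; lra_from r01.
  have Pa : h a `^ p <= C `^ p by apply: ler_powR_pos; [lra_from p_gt0|exact: ltW|exact: hC].
  have kP : 2 / p * (eps * h b `^ p) <= 2 / p * (eps * C `^ p).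
    rewrite ler_pM2l ?divr_gt0//; apply: ler_wpM2l => //.
    by apply: ler_powR_pos; [lra_from p_gt0|exact: ltW|exact: hC].
  have Pa0 : 0 <= 2 / p * (eps * h a `^ p).
    by apply: mulr_ge0; [apply: divr_ge0; lra_from p_gt0|apply: mulr_ge0 => //; exact: powR_ge0].
  have [_ en] := energy_critical p0 S ra ha0 da db.
  have Vb : V (1 + d) <= h b ^+ 2 - 2 / p * h b `^ p.
    by apply: (potential_incr _ hbd); lra_from d0.
  have := rP (eps * (2 / p * C `^ p)) (h a) epsC ha0; rewrite {2}/V.
  suff VV : V (1 + d) - eps * (2 / p * C `^ p) <= h a ^+ 2 - 2 / p * h a `^ p.
    by move=> /(_ VV); rewrite ler_normr => /orP[]; lra_from epr a_le.
  lra_from kP Pa0 en Vb.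
apply/andP; split.
  rewrite ltNge; apply/negP => bl.
  have := L eps f h dh S e0 ep epL a b ra ca db bl; lra_from d0 epd hbd a_le.
rewrite ltNge; apply/negP => bl.
have rb : rising h dh (b - pi) (b - pi + pi).
  by split => [|t tab]; [lra_from pi2|apply: ra.2; lra_from bl tab].
have amp := U eps f h dh S e0 ep epU _ rb; rewrite subrK in rb amp.
have h_ge t : b - pi <= t <= b -> 1 + d / 2 <= h t.
  move=> tab; have : h (b - pi) <= h t by apply: (rising_le S rb); lra_from tab.
  lra_from d0 hbd amp.
have ddh t : b - pi <= t <= b -> f t * h t `^ (p - 1) - h t <= - (d / 4).
  move=> tab; have := h_ge t ltac:(lra_from tab) => hl.
  have : h t `^ (p - 1) <= 1 by apply: powR_le1; lra_from d0 hl p_lt1.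
  have := powR_ge0 (h t) (p - 1); have [_ fr] := sol_near_bounds S t; nra_from d0 epd hl fr.
have dh_ge t : b - 2 <= t <= b - 1 -> d / 4 <= dh t.
  move=> tab; have tb : t < b by lra_from tab.
  have [x xab|c /andP[rc ct] e] := @mvt _ dh
    (fun t => f t * h t `^ (p - 1) - h t) _ _ tb.
    by apply: (sol_derive2 S); have := h_ge x ltac:(lra_from pi2 tab xab); lra_from d0.
  move: e; rewrite db; have := ddh c ltac:(lra_from pi2 tab rc ct); have : 1 <= b - t by lra_from tab.
  nra_from d0.
have [||c cab e] := @mvt _ h dh (b - 2) (b - 1); first lra_alone.
  by move=> x xab; apply: (sol_derive S); have := h_ge x ltac:(lra_from pi2 xab); lra_from d0.
have := dh_ge c ltac:(lra_from cab).
have : h (b - 1) <= h b by apply: (rising_le S rb); lra_from pi2.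
have : h (b - pi) <= h (b - 2) by apply: (rising_le S rb); lra_from pi2.
have -> : dh c = h (b - 1) - h (b - 2) by rewrite e; ring.
lra_from amp d0.
Qed.

End NearOne.

Section APriori.
Context {R : realType}.
Variable p : R.
Hypotheses (p0 : 0 < p) (p1 : p < 1).
Implicit Types (a b c s t x d : R).

(** There is no critical point well below 1: it would start a rise, a fall and
    another rise, together longer than three quarters of the circle, while the
    fall that closes the period starts before the end of the last rise. *)
Lemma no_low_critical d : 0 < d -> d < 1 -> exists2 e1 : R, 0 < e1 &
  forall eps f h dh, circle_solution p eps f h dh -> 0 <= eps ->
    eps <= (1 - p) / 4 -> eps <= e1 ->
  forall a, critical h dh a -> 1 - d < h a.
Proof.
move=> d0 d1.
have [r1 /andP[r10 r11] [e1 e10 up1]] := rise_from_bottom p0 p1 d0 d1.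
have [r2 /andP[r20 r21] [e2 e20 down2]] := rise_to_top p0 p1 r10.
have [r3 r30 [e3 e3_gt0 up3]] := rise_from_bottom p0 p1 r20 r21.
exists (Num.min e1 (Num.min e2 e3)); first by rewrite !lt_min e10 e20.
move=> eps f h dh S e0 ep; rewrite !le_min => /andP[ep1 /andP[ep2 ep3]] t0 c0.
rewrite ltNge; apply/negP => h0; have pi0 := @pi_gt0 R.
have S' := sol_reflect S.
have [t1 [rise1 h1 dh1 /andP[l1 u1] top1]] := up1 _ _ _ _ S e0 ep ep1 t0 c0 h0.
have [|||t2' [fall2 c2 /andP[l2 u2] low2]] := down2 _ _ _ _ S' e0 ep ep2 (- t1).
- by rewrite opprK.
- by rewrite opprK dh1 oppr0.
- by rewrite opprK.
pose t2 := - t2'; have e_t2 : t2' = - t2 by rewrite opprK.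
rewrite e_t2 in fall2 c2 l2 u2 low2.
have c2' : critical h dh t2.
  case: c2 => [c2|[c2 c2']]; [by left; rewrite opprK in c2|right].
  by rewrite opprK in c2; split => //; apply/oppr_inj; rewrite oppr0 -c2' opprK.
rewrite opprK in low2.
have [t3 [rise3 h3 dh3 /andP[l3 u3] top3]] := up3 _ _ _ _ S e0 ep ep3 t2 c2' low2.
have c0' : critical (fun t => h (- t)) (fun t => - dh (- t)) (- (t0 + 2 * pi)).
  by case: (sol_critical_per S c0) => [c|[c c']]; [left|right]; rewrite opprK// c' oppr0.
have [|t4' [fall4 h4 dh4 /andP[l4 u4] top4]] := up1 _ _ _ _ S' e0 ep ep1 _ c0'.
  by rewrite opprK (sol_periodic S).
have [x /andP[x1 x2] x3] := @point_right _ (Num.max t2 (- t4')) (Num.min t3 (t0 + 2 * pi)) 1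
  ltac:(rewrite gt_max !lt_min; apply/andP; split; apply/andP; split; lra) ltr01.
move: x1 x2; rewrite gt_max lt_min => /andP[x1 x1'] /andP[x2 x2'].
have [hx dx] := rise3.2 x ltac:(lra).
have [] := fall4.2 (- x) ltac:(lra); rewrite opprK; lra.
Qed.

(** The extrema are critical points; those below 1 have just been excluded, and a
    critical point above 1 is the end of a rise that starts below 1. *)
Theorem a_priori_near_one d : 0 < d -> exists2 e1 : R, 0 < e1 &
  forall eps f h dh, circle_solution p eps f h dh -> 0 <= eps -> eps <= e1 ->
  forall t, `|h t - 1| < d.
Proof.
wlog d1 : d / d < 1 => [hw d0|d0].
  have [||e1 e10 H] := hw (Num.min d (1 / 2)); first by rewrite gt_min; apply/orP; right; lra.
    by rewrite lt_min d0; lra.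
  exists e1 => // eps f h dh S e0 e1' t; apply: lt_le_trans (H _ _ _ _ S e0 e1' t) _.
  by rewrite ge_min lexx.
have [r /andP[r0 r1] [e1 e10 down]] := rise_to_top p0 p1 d0.
have [e2 e20 low] := no_low_critical d0 d1.
have [e3 e30 lowr] := no_low_critical r0 r1.
exists (Num.min (Num.min e1 e2) (Num.min e3 ((1 - p) / 4))).
  by rewrite !lt_min e10 e20 e30/= divr_gt0// subr_gt0.
move=> eps f h dh S e0; rewrite !le_min => /andP[/andP[ep1 ep2] /andP[ep3 ep]] t.
have [m [mP cm]] := sol_min S; have [M [MP cM]] := sol_max S.
have hm := low _ _ _ _ S e0 ep ep2 m cm.
have hM : h M < 1 + d.
  rewrite ltNge; apply/negP => hM.
  have [hM0 dM] : 0 < h M /\ dh M = 0.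
    by case: cM => [hM0|[]//]; move: hM; rewrite hM0; lra.
  have [a [ra ca _ ha]] := down _ _ _ _ S e0 ep ep1 M hM0 dM hM.
  by have := lowr _ _ _ _ S e0 ep ep3 a ca; lra.
have := mP t; have := MP t; rewrite ltr_distl; lra.
Qed.

End APriori.

(** * The linearized equation and the solution near 1 *)

Section Primitive.
Context {R : realType}.
Implicit Types (g G : R -> R) (x t : R).

Lemma primitive_right g (a : R) : (forall t, {for t, continuous g}) ->
  exists G, forall x, a < x -> is_derive x 1 G (g x).
Proof.
move=> cg; exists (fun x => (\int[lebesgue_measure]_(t in `[a, x]) g t)%R) => x ax.
have gi : lebesgue_measure.-integrable `[a, x + 1] (EFin \o g).
  apply: continuous_compact_integrable; first exact: segment_compact.
  exact: continuous_subspaceT.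
have [df dfE] := @continuous_FTC1_closed R g a x (x + 1) ltac:(lra) gi ax (cg x).
by apply: DeriveDef => //; rewrite -derive1E.
Qed.

Lemma primitive g : (forall t, {for t, continuous g}) ->
  exists G, forall x, is_derive x 1 G (g x).
Proof.
move=> cg; have [P dP] := @primitive_right g (-1) cg.
have [|Q dQ] := @primitive_right (fun t => g (- t)) (-1).
  by move=> t; apply: continuous_comp; [exact: opp_continuous|exact: cg].
have dQ' x : x < 1 -> is_derive x 1 (fun t => - Q (0 - t)) (g x).
  move=> x1; have h1 : is_derive (0 - x) 1 Q (g (- (0 - x))) by apply: dQ; lra.
  have h2 := derive_reflect h1.
  by derive; rewrite !opprK sub0r opprK.
pose G x := if 0 <= x then P x - P 0 else - Q (0 - x) + Q 0.
have GP x : -1 < x < 1 -> G x = P x - P 0.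
  move=> x1; rewrite /G; have [//|x0] := leP 0 x.
  pose D t := P t + Q (0 - t).
  have [t tx|c cx] := @mvt _ (fun t => P t - - Q (0 - t)) (fun=> 0) x 0 x0.
    have h1 : is_derive t 1 P (g t) by apply: dP; lra.
    have h2 := dQ' t ltac:(lra).
    by derive; rewrite subrr.
  by rewrite mul0r subrr => /eqP; rewrite subr_eq0 => /eqP; lra.
exists G => x; have [x0|x0|->] := ltgtP x 0.
- apply: (@derive_local _ (fun t => - Q (0 - t) + Q 0) _ _ _ (- x)); first lra.
    move=> t; rewrite ltr_distl => /andP[_ tx]; rewrite /G.
    by have -> : (0 <= t) = false by apply/negbTE; rewrite -ltNge; lra.
  have h1 := dQ' x ltac:(lra).
  by derive; rewrite addr0.
- apply: (@derive_local _ (fun t => P t - P 0) _ _ _ x) => //.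
    by move=> t; rewrite ltr_distl => /andP[tx _]; rewrite /G ltW//; lra.
  have h1 := dP x ltac:(lra).
  by derive; rewrite oppr0 addr0.
apply: (@derive_local _ (fun t => P t - P 0) _ _ _ 1) => //.
  by move=> t; rewrite subr0 ltr_norml => t1; rewrite GP.
have h1 := dP 0 ltac:(lra).
by derive; rewrite oppr0 addr0.
Qed.

End Primitive.

Section Linear.
Context {R : realType}.
Variable k : R.
Hypotheses (k0 : 0 < k) (sk : sin (k * pi) != 0).
Implicit Types (g v dv : R -> R) (s t : R).

(** Integrating the equation against the Green function [cos (k (s - t - pi))]
    of the circle recovers [v t]. *)
Lemma periodic_green_bound v dv g (B : R) :
  (forall t, is_derive t 1 v (dv t)) ->
  (forall t, is_derive t 1 dv (g t - k ^+ 2 * v t)) ->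
  (forall t, v (t + 2 * pi) = v t) -> (forall t, dv (t + 2 * pi) = dv t) ->
  (forall t, `|g t| <= B) ->
  forall t, `|v t| <= pi / (k * `|sin (k * pi)|) * B.
Proof.
move=> d1 d2 vp dvp gB t; have pi0 := @pi_gt0 R; have k_gt0 := k0.
pose F s := dv s * cos (k * (s - (t + pi))) + k * (v s * sin (k * (s - (t + pi)))).
have [s _|c _ e] := @mvt _ F (fun s => g s * cos (k * (s - (t + pi)))) t (t + 2 * pi)
    ltac:(lra).
  have h1 := d1 s; have h2 := d2 s.
  by rewrite /F; derive; ring.
have F2 : F (t + 2 * pi) - F t = 2 * (k * sin (k * pi)) * v t.
  rewrite /F vp dvp; have -> : t + 2 * pi - (t + pi) = pi by ring.
  have -> : t - (t + pi) = - pi by ring.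
  by rewrite mulrN cosN sinN; ring.
move: e; rewrite F2 => /(congr1 Num.norm).
have -> : t + 2 * pi - t = 2 * pi by ring.
rewrite !normrM (gtr0_norm k_gt0) (gtr0_norm pi0) ger0_norm// => e.
have S0 : 0 < `|sin (k * pi)| by rewrite normr_gt0.
have : `|g c| * `|cos (k * (c - (t + pi)))| <= B.
  apply: le_trans (gB c); rewrite ler_piMr// ler_norml cos_geN1 cos_le1//.
move: e; set X := `|g c| * _; set Y := `|sin _| in S0 *; set W := `|v t| => e XB.
rewrite mulrAC ler_pdivlMr; last exact: mulr_gt0.
have -> : W * (k * Y) = X * pi by lra.
by rewrite mulrC ler_pM2l.
Qed.

(** Variation of constants: the primitives of [g] against the two solutions of
    the homogeneous equation, taken over one period, give the periodic solution. *)
Lemma periodic_green g : (forall t, {for t, continuous g}) ->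
  (forall t, g (t + 2 * pi) = g t) ->
  exists v dv, [/\ forall t, is_derive t 1 v (dv t),
    forall t, is_derive t 1 dv (g t - k ^+ 2 * v t),
    forall t, v (t + 2 * pi) = v t & forall t, dv (t + 2 * pi) = dv t].
Proof.
move=> cg gp; have k_neq0 : k != 0 by rewrite gt_eqF.
have lin t : {for t, continuous (fun s : R => k * s)}.
  by apply: derive_continuous (_ : is_derive t 1 _ k); derive; ring.
have [C dC] : exists C : R -> R, forall x : R, is_derive x 1 C (g x * cos (k * x)).
  apply: primitive => t; apply: continuousM; first exact: cg.
  by apply: (continuous_comp (lin t)); exact: continuous_cos.
have [S dS] : exists S : R -> R, forall x : R, is_derive x 1 S (g x * sin (k * x)).
  apply: primitive => t; apply: continuousM; first exact: cg.
  by apply: (continuous_comp (lin t)); exact: continuous_sin.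
pose c := 2 * k * sin (k * pi).
have c0 : c != 0 by rewrite /c !mulf_neq0.
pose v t := c^-1 * (cos (k * t + k * pi) * (C (t + 2 * pi) - C t) +
                    sin (k * t + k * pi) * (S (t + 2 * pi) - S t)).
pose dv t := c^-1 * k * (cos (k * t + k * pi) * (S (t + 2 * pi) - S t) -
                         sin (k * t + k * pi) * (C (t + 2 * pi) - C t)).
have shift t (H : R -> R) l : is_derive (t + 2 * pi) 1 H l ->
  is_derive t 1 (fun s => H (s + 2 * pi)) l by exact: derive_shift_arg.
have trig2 x : cos (k * (x + 2 * pi)) = cos (k * x + k * pi) * cos (k * pi) -
     sin (k * x + k * pi) * sin (k * pi) /\
   sin (k * (x + 2 * pi)) = sin (k * x + k * pi) * cos (k * pi) +
     cos (k * x + k * pi) * sin (k * pi).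
  by rewrite -cosD -sinD; split; congr (_ _); ring.
have trig0 x : cos (k * x) = cos (k * x + k * pi) * cos (k * pi) +
     sin (k * x + k * pi) * sin (k * pi) /\
   sin (k * x) = sin (k * x + k * pi) * cos (k * pi) -
     cos (k * x + k * pi) * sin (k * pi).
  by rewrite -cosB -sinB; split; congr (_ _); ring.
have vd t : is_derive t 1 v (dv t).
  have h1 := dC t; have h2 := dS t; have h3 := shift _ _ _ (dC (t + 2 * pi)).
  have h4 := shift _ _ _ (dS (t + 2 * pi)).
  rewrite /v; derive; rewrite /dv gp.
  by have [-> ->] := trig2 t; have [-> ->] := trig0 t; ring.
have dvd t : is_derive t 1 dv (g t - k ^+ 2 * v t).
  have h1 := dC t; have h2 := dS t; have h3 := shift _ _ _ (dC (t + 2 * pi)).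
  have h4 := shift _ _ _ (dS (t + 2 * pi)).
  rewrite /dv; derive; rewrite /v gp.
  have [-> ->] := trig2 t; have [-> ->] := trig0 t.
  set x := k * t + k * pi; have := cos2Dsin2 x.
  set cx := cos x; set sx := sin x => e.
  set vt := c^-1 * (_ + _).
  transitivity (c^-1 * c * (cx ^+ 2 + sx ^+ 2) * g t - k ^+ 2 * vt).
    by rewrite /vt; set ic := c^-1; rewrite /c; ring.
  by rewrite e mulVf// !mul1r.
(* the integrals over two consecutive periods agree up to the shift of the
   kernel *)
have per t : v (t + 2 * pi) = v t.
  pose H x := cos (k * (t + 2 * pi) + k * pi) * C (x + 2 * pi) +
    sin (k * (t + 2 * pi) + k * pi) * S (x + 2 * pi) -
    (cos (k * t + k * pi) * C x + sin (k * t + k * pi) * S x).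
  have pi0 := @pi_gt0 R.
  have [x _|y _] := @mvt _ H (fun=> 0) t (t + 2 * pi) ltac:(lra).
    have h1 := dC x; have h2 := dS x; have h3 := shift _ _ _ (dC (x + 2 * pi)).
    have h4 := shift _ _ _ (dS (x + 2 * pi)).
    rewrite /H; derive; rewrite gp.
    have e1 : cos (k * (t + 2 * pi) + k * pi) * cos (k * (x + 2 * pi)) +
        sin (k * (t + 2 * pi) + k * pi) * sin (k * (x + 2 * pi)) =
      cos (k * t + k * pi) * cos (k * x) + sin (k * t + k * pi) * sin (k * x).
      by rewrite -!cosB; congr cos; ring.
    by move: (congr1 (fun z => g x * z) e1); lra.
  rewrite mul0r /H /v => e; congr (_ * _); lra.
exists v, dv; split => // t.
apply: derive_uniq (vd t).
have := derive_shift_arg (vd (t + 2 * pi)).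
by under eq_fun do rewrite per.
Qed.

End Linear.

Lemma continuous_powR {R : realType} (h : R -> R) (a t : R) :
  {for t, continuous h} -> 0 < h t -> {for t, continuous (fun s => h s `^ a)}.
Proof.
move=> ch h0.
exact: (continuous_comp ch (derive_continuous (is_derive1_powR a h0))).
Qed.

Section NearOneSolution.
Context {R : realType}.
Variable p : R.
Hypotheses (p0 : 0 < p) (p1 : p < 1).
Implicit Types (f g h dh v dv : R -> R) (s t x y z d : R).

Record near_one_solution d f h dh : Prop := NearOneSolution {
  nos_near : forall t, `|h t - 1| <= d ;
  nos_periodic : forall t, h (t + 2 * pi) = h t ;
  nos_derive : forall t, is_derive t 1 h (dh t) ;
  nos_derive2 : forall t, is_derive t 1 dh (f t * h t `^ (p - 1) - h t) }.

Lemma derive_periodic v dv : (forall t, is_derive t 1 v (dv t)) ->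
  (forall t, v (t + 2 * pi) = v t) -> forall t, dv (t + 2 * pi) = dv t.
Proof.
move=> vd vp t; apply: derive_uniq (vd t).
have := derive_shift_arg (vd (t + 2 * pi)).
by under eq_fun do rewrite vp.
Qed.

(** The linear part of the equation at 1 is [h'' + k^2 h]; its kernel has
    frequency strictly between 1 and 2, hence no period [2 pi]. *)
Let k : R := Num.sqrt (2 - p).

Let kE : k ^+ 2 = 2 - p.
Proof. by rewrite sqr_sqrtr// subr_ge0; have := p1; lra. Qed.

Let k_gt1 : 1 < k.
Proof.
have k0 : 0 <= k by exact: sqrtr_ge0.
by rewrite ltNge; apply/negP => k1; have := kE; have := p1; rewrite expr2; nra.
Qed.

Let k_lt2 : k < 2.
Proof.
have k0 : 0 <= k by exact: sqrtr_ge0.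
by rewrite ltNge; apply/negP => k1; have := kE; have := p0; rewrite expr2; nra.
Qed.

Let sin_k : sin (k * pi) != 0.
Proof.
have pi0 := @pi_gt0 R; have kl := k_gt1; have kr := k_lt2.
have -> : k * pi = (k * pi - pi) + pi by ring.
rewrite sinDpi oppr_eq0 gt_eqF// sin_gt0_pi//; apply/andP; split; nra.
Qed.

Let M : R := pi / (k * `|sin (k * pi)|).

Let M0 : 0 < M.
Proof.
apply: divr_gt0; first exact: pi_gt0.
by apply: mulr_gt0; [exact: lt_trans k_gt1|rewrite normr_gt0].
Qed.

Let rhs (F x : R) := F * x `^ (p - 1) + (1 - p) * x.

(** After the linear part is taken out, the remainder has a small Lipschitz
    constant near 1, because its derivative at 1 is [O(|f - 1|)]. *)
Lemma rhs_lipschitz (kappa : R) : 0 < kappa -> exists2 d : R, 0 < d <= 1 / 2 &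
  forall F x y, `|F - 1| <= d -> `|x - 1| <= d -> `|y - 1| <= d ->
    `|rhs F x - rhs F y| <= kappa * `|x - y|.
Proof.
wlog kap1 : kappa / kappa <= 1 => [hw kap0|kap0].
  have [||d d0 dP] := hw (Num.min kappa 1); first by rewrite ge_min lexx orbT.
    by rewrite lt_min kap0 ltr01.
  exists d => // F x y Fd xd yd; apply: le_trans (dP F x y Fd xd yd) _.
  by rewrite ler_wpM2r// ge_min lexx.
have /derive_continuous/continuousP_eps/(_ (kappa / 4)) :=
  @is_derive1_powR R (p - 2) 1 ltr01.
case=> [|r r0 rP]; first lra.
pose d := Num.min (r / 2) (kappa / 4).
have [dr dk] : d <= r / 2 /\ d <= kappa / 4 by rewrite /d !ge_min !lexx orbT.
have d0 : 0 < d by rewrite lt_min; lra.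
exists d => [|F x y]; first lra.
wlog xy : x y / x <= y => [hw|].
  have [xy|/ltW yx] := leP x y; first exact: hw.
  by move=> Fd xd yd; rewrite distrC [X in _ <= _ * X]distrC; exact: hw.
move=> Fd xd yd; rewrite !ler_distl in Fd xd yd.
have [/andP[F1 F2] /andP[x1 x2] /andP[y1 y2]] := And3 Fd xd yd.
move: xy; rewrite le_eqVlt => /predU1P[->|xy]; first by rewrite !subrr !normr0 mulr0 lexx.
have [z /andP[xz zy]|z /andP[xz zy] e] := @mvt _ (rhs F)
    (fun z => F * ((p - 1) * z `^ (p - 1 - 1) * 1) + (1 - p)) x y xy.
  rewrite /rhs; derive; first by lra.
  by ring.
rewrite distrC [X in _ <= _ * X]distrC e normrM; apply: ler_wpM2r => //.
have := rP z; rewrite ltr_distl => /(_ ltac:(lra)).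
have -> : p - 1 - 1 = p - 2 by ring.
rewrite powR1; set Z := z `^ _; rewrite ltr_distl => /andP[Z1 Z2].
have -> : F * ((p - 1) * Z * 1) + (1 - p) = (1 - p) * (1 - F * Z) by ring.
rewrite normrM ger0_norm; last by rewrite subr_ge0 ltW.
have FZ : `|1 - F * Z| <= kappa by rewrite ler_distl; apply/andP; split; nra.
apply: le_trans FZ; rewrite ler_piMl//; have := p0; lra.
Qed.

Lemma small_geometric (c x : R) : (forall n : nat, x <= c / 2 ^+ n) -> x <= 0.
Proof.
move=> H; rewrite leNgt; apply/negP => x0.
have c0 : 0 < c by have := H 0%N; rewrite expr0 divr1; lra.
have cx : 0 <= c / x by apply: divr_ge0; exact: ltW.
have := archi_boundP cx; set n := Num.bound _ => cn.
have n2 : (n%:R : R) <= 2 ^+ n by rewrite -natrX ler_nat; exact/ltnW/ltn_expl.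
have := H n; rewrite ler_pdivlMr ?exprn_gt0//.
rewrite ltr_pdivrMr// in cn; nra.
Qed.

(** Existence and uniqueness among functions close to 1: the inverse of the
    linear part turns the equation into a fixed-point problem for a
    contraction. *)
Theorem near_one_existence_uniqueness : exists d : R, [/\ 0 < d, d < 1 &
  exists2 e1 : R, 0 < e1 & forall f, (forall t, {for t, continuous f}) ->
    (forall t, f (t + 2 * pi) = f t) -> (forall t, `|f t - 1| <= e1) ->
  (exists h dh, near_one_solution d f h dh) /\
  (forall h1 dh1 h2 dh2, near_one_solution d f h1 dh1 ->
     near_one_solution d f h2 dh2 -> forall t, h1 t = h2 t)].
Proof.
have pi0 := @pi_gt0 R; have k1 := k_gt1; have M_gt0 := M0.
have k0 : 0 < k by lra.
pose kappa := 1 / (2 * M).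
have kap0 : 0 < kappa by apply: divr_gt0; lra.
have kM : M * kappa = 1 / 2 by rewrite /kappa; field; lra.
have [d /andP[d0 d12] lip] := rhs_lipschitz kap0.
exists d; split => //; first lra.
pose e1 := Num.min d (d / (2 * M)).
have [e1d e1M] : e1 <= d /\ e1 <= d / (2 * M) by rewrite /e1 !ge_min !lexx orbT.
have e10 : 0 < e1 by rewrite lt_min d0 divr_gt0//; lra.
exists e1 => // f cf fp fe.
have fd t : `|f t - 1| <= d by exact: le_trans e1d.
pose N h t := rhs (f t) (h t).
pose good h := [/\ forall t, {for t, continuous h}, forall t, h (t + 2 * pi) = h t &
  forall t, `|h t - 1| <= d].
have good_pos h t : good h -> 0 < h t.
  by case=> _ _ /(_ t); rewrite ler_distl => /andP[]; lra.
have contN h : good h -> forall t, {for t, continuous (N h)}.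
  move=> gh t; have [ch _ _] := gh; apply: continuousD.
    apply: continuousM; first exact: cf.
    exact: continuous_powR (ch t) (good_pos h t gh).
  by apply: continuousM; [exact: cvg_cst|exact: ch].
have perN h : good h -> forall t, N h (t + 2 * pi) = N h t.
  by move=> [_ hp _] t; rewrite /N fp hp.
pose inverse v g := exists dv, [/\ forall t, is_derive t 1 v (dv t),
    forall t, is_derive t 1 dv (g t - k ^+ 2 * v t),
    forall t, v (t + 2 * pi) = v t & forall t, dv (t + 2 * pi) = dv t].
have bound v1 v2 g1 g2 (B : R) : inverse v1 g1 -> inverse v2 g2 ->
    (forall t, `|g1 t - g2 t| <= B) -> forall t, `|v1 t - v2 t| <= M * B.
  move=> [dv1 [a1 b1 c1 c1']] [dv2 [a2 b2 c2 c2']] gB.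
  apply: (@periodic_green_bound _ k k0 sin_k (fun t => v1 t - v2 t)
    (fun t => dv1 t - dv2 t) (fun t => g1 t - g2 t)) => // t.
  - by have h1 := b1 t; have h2 := b2 t; derive; ring.
  - by rewrite c1 c2.
  - by rewrite c1' c2'.
have inv_one : inverse (fun=> 1) (fun=> k ^+ 2).
  exists (fun=> 0); split => // t; first exact: derive_const.
  by rewrite mulr1 subrr; exact: derive_const.
have solvable h : exists v : R -> R, good h -> inverse v (N h).
  have [gh|ngh] := pselect (good h); last by exists (fun=> 0).
  have [v [dv vP]] := periodic_green k0 sin_k (contN h gh) (perN h gh).
  by exists v => _; exists dv.
have [T Tinv] := choice solvable.
have Tlip h1 h2 (B : R) : good h1 -> good h2 -> (forall t, `|h1 t - h2 t| <= B) ->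
    forall t, `|T h1 t - T h2 t| <= B / 2.
  move=> g1 g2 hB t; have -> : B / 2 = M * (kappa * B) by rewrite mulrA kM; lra.
  apply: (bound _ _ _ _ _ (Tinv _ g1) (Tinv _ g2)) => s.
  have [[_ _ n1] [_ _ n2]] := (g1, g2).
  apply: le_trans (lip (f s) _ _ (fd s) (n1 s) (n2 s)) _.
  by rewrite ler_pM2l.
have Tgood h : good h -> good (T h).
  move=> gh; have [dv [a b c c']] := Tinv h gh; split => // t.
    exact: derive_continuous (a t).
  have -> : d = M * (kappa * d + e1) + (d / 2 - M * e1) by rewrite mulrDr mulrA kM; lra.
  have Me1 : M * e1 <= d / 2.
    apply: (@le_trans _ _ (M * (d / (2 * M)))); first by rewrite ler_pM2l.
    by have -> // : M * (d / (2 * M)) = d / 2 by field; lra.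
  apply: (@le_trans _ _ (M * (kappa * d + e1))); last lra.
  apply: (bound (T h) (fun=> 1) (N h) (fun=> k ^+ 2)) (Tinv h gh) inv_one _ t => s.
  have [_ _ n] := gh.
  have := lip (f s) (h s) 1 (fd s) (n s); rewrite subrr normr0 => /(_ (ltW d0)) l1.
  have -> : N h s - k ^+ 2 = (rhs (f s) (h s) - rhs (f s) 1) + (f s - 1).
    by rewrite kE /N /rhs powR1; ring.
  apply: le_trans (ler_normD _ _) _; apply: lerD => //.
  by apply: le_trans l1 _; rewrite ler_pM2l.
pose u n := iter n T (fun=> 1).
have ug n : good (u n).
  elim: n => [|n]; last exact: Tgood.
  by split => // t; [exact: cvg_cst|rewrite subrr normr0 ltW].
have ustep n t : `|u n.+1 t - u n t| <= d / 2 ^+ n.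
  elim: n t => [|n IH] t.
    by rewrite expr0 divr1; have [_ _ near1] := ug 1%N; exact: near1.
  have -> : d / 2 ^+ n.+1 = d / 2 ^+ n / 2 by rewrite exprS invfM; ring.
  exact: (Tlip _ _ _ (ug n.+1) (ug n) IH).
pose a t n := u n t - 2 * (d / 2 ^+ n).
pose b t n := u n t + 2 * (d / 2 ^+ n).
have q0 n : 0 < d / 2 ^+ n by rewrite divr_gt0// exprn_gt0.
have qS n : d / 2 ^+ n.+1 = d / 2 ^+ n / 2 by rewrite exprS invfM; ring.
have aS t n : a t n <= a t n.+1.
  by have := ustep n t; rewrite ler_distl /a qS => /andP[]; lra.
have bS t n : b t n.+1 <= b t n.
  by have := ustep n t; rewrite ler_distl /b qS => /andP[]; lra.
have am t m n : (m <= n)%N -> a t m <= a t n.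
  by move=> /subnKC <-; elim: (n - m)%N => [|j IH]; rewrite ?addn0// addnS (le_trans IH).
have bm t m n : (m <= n)%N -> b t n <= b t m.
  by move=> /subnKC <-; elim: (n - m)%N => [|j IH]; rewrite ?addn0// addnS (le_trans _ IH).
have ab t m n : a t m <= b t n.
  apply: le_trans (am t m (maxn m n) (leq_maxl _ _)) _.
  apply: le_trans (bm t n (maxn m n) (leq_maxr _ _)).
  by rewrite /a /b; have := q0 (maxn m n); lra.
pose h t := sup [set a t n | n in [set: nat]].
have hsup t : has_sup [set a t n | n in [set: nat]].
  by split; [exists (a t 0%N), 0%N|exists (b t 0%N) => _ [n _ <-]].
have hu t n : `|h t - u n t| <= 2 * (d / 2 ^+ n).
  rewrite ler_distl; apply/andP; split.
    by apply: ub_le_sup; [case: (hsup t)|exists n].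
  by apply: ge_sup; [case: (hsup t)|move=> _ [m _ <-]; exact: ab].
have gh : good h.
  split=> t.
  - apply/continuousP_eps => e e0.
    have [n nP] : exists n : nat, 2 * (d / 2 ^+ n) < e / 3.
      apply/not_existsP => H; have : e / 3 <= 0; last lra.
      apply: (@small_geometric (2 * d)) => n.
      by rewrite -mulrA leNgt; apply/negP; exact: H.
    have [cu _ _] := ug n; have /continuousP_eps/(_ (e / 3)) := cu t.
    case=> [|r r0 rP]; first lra.
    exists r => // s sr; have := hu s n; have := hu t n; have := rP s sr.
    by rewrite ltr_distl !ler_distl ltr_distl => /andP[? ?] /andP[? ?] /andP[? ?]; lra.
  - rewrite /h; congr sup; apply: eq_imagel => n _.
    by have [_ up _] := ug n; rewrite /a up.
  - rewrite -subr_le0; apply: (@small_geometric (2 * d)) => n.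
    have [_ _ /(_ t)] := ug n; have := hu t n.
    by rewrite !ler_distl -mulrA => /andP[? ?] /andP[? ?]; rewrite lerBlDr ler_distl; lra.
have hT t : T h t = h t.
  apply/eqP; rewrite -subr_eq0 -normr_le0; apply: (@small_geometric (2 * d)) => n.
  have := Tlip h (u n) _ gh (ug n) (fun s => hu s n) t; have := hu t n.+1.
  rewrite -[u n.+1 t]/(T (u n) t) qS -mulrA.
  by rewrite !ler_distl => /andP[? ?] /andP[? ?]; lra.
split.
  have [dv [d1 d2 vp dvp]] := Tinv h gh.
  have ThE : T h = h by apply/funext.
  rewrite ThE in d1 d2; exists h, dv; split => //; [by case: gh|by case: gh|].
  move=> t; have := d2 t; rewrite /N /rhs kE.
  by congr (is_derive _ _ _ _); ring.
move=> h1 dh1 h2 dh2 S1 S2.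
have sol_good h' dh' : near_one_solution d f h' dh' -> good h' /\ inverse h' (N h').
  case=> n per d1 d2; split.
    by split => // t; exact: derive_continuous (d1 t).
  exists dh'; split => //; last exact: derive_periodic.
  by move=> t; have := d2 t; congr (is_derive _ _ _ _); rewrite /N /rhs kE; ring.
have [[g1 i1] [g2 i2]] := (sol_good _ _ S1, sol_good _ _ S2).
have close n t : `|h1 t - h2 t| <= 2 * d / 2 ^+ n.
  elim: n t => [|n IH] t.
    have [[_ _ /(_ t) n1] [_ _ /(_ t) n2]] := (g1, g2).
    by move: n1 n2; rewrite expr0 divr1 !ler_distl => /andP[? ?] /andP[? ?]; lra.
  have -> : 2 * d / 2 ^+ n.+1 = M * (kappa * (2 * d / 2 ^+ n)).
    by rewrite [RHS]mulrA kM exprS invfM; lra.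
  apply: (bound _ _ _ _ _ i1 i2) => s.
  have [[_ _ n1] [_ _ n2]] := (g1, g2).
  apply: le_trans (lip (f s) _ _ (fd s) (n1 s) (n2 s)) _.
  by rewrite ler_pM2l.
move=> t; apply/eqP; rewrite -subr_eq0 -normr_le0.
exact: (@small_geometric (2 * d)).
Qed.

End NearOneSolution.

(** * The one-dimensional Hausdorff measure of the plane *)

Section PlaneGeometry.
Context {R : realType}.
Local Notation plane := (R * R)%type.
Implicit Types (x y z u v : plane).

Lemma dotC x y : dot x y = dot y x.
Proof. by rewrite /dot; ring. Qed.

Lemma dotDr x y z : dot x (y + z) = dot x y + dot x z.
Proof. by rewrite /dot /=; ring. Qed.

Lemma dotNr x y : dot x (- y) = - dot x y.
Proof. by rewrite /dot /=; ring. Qed.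

Lemma dotBr x y z : dot x (y - z) = dot x y - dot x z.
Proof. by rewrite dotDr dotNr. Qed.

Lemma dotBl x y z : dot (x - y) z = dot x z - dot y z.
Proof. by rewrite dotC dotBr !(dotC z). Qed.

Lemma dot_ge0 x : 0 <= dot x x.
Proof. by rewrite /dot -!expr2 addr_ge0// sqr_ge0. Qed.

Lemma enorm_ge0 x : 0 <= enorm x.
Proof. exact: sqrtr_ge0. Qed.

Lemma enorm_sqr x : enorm x ^+ 2 = dot x x.
Proof. by rewrite sqr_sqrtr// dot_ge0. Qed.

Lemma enorm_le x (r : R) : 0 <= r -> (enorm x <= r) = (dot x x <= r ^+ 2).
Proof.
by move=> r0; rewrite -enorm_sqr ler_sqr// nnegrE ?enorm_ge0.
Qed.

Lemma enormN x : enorm (- x) = enorm x.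
Proof. by rewrite /enorm /dot /= !mulrNN. Qed.

Lemma enormC x y : enorm (x - y) = enorm (y - x).
Proof. by rewrite -enormN opprB. Qed.

Lemma enorm_eq0 x : enorm x = 0 -> x = 0.
Proof.
move=> x0; have : dot x x = 0 by rewrite -enorm_sqr x0 expr0n.
case: x {x0} => a b; rewrite /dot /= -!expr2 => /eqP.
by rewrite paddr_eq0 ?sqr_ge0// !sqrf_eq0 => /andP[/eqP -> /eqP ->].
Qed.

Lemma dot_le_enorm x y : dot x y <= enorm x * enorm y.
Proof.
have H : dot x y ^+ 2 <= (enorm x * enorm y) ^+ 2.
  rewrite exprMn !enorm_sqr /dot -subr_ge0.
  have -> : (x.1 * x.1 + x.2 * x.2) * (y.1 * y.1 + y.2 * y.2) -
    (x.1 * y.1 + x.2 * y.2) ^+ 2 = (x.1 * y.2 - x.2 * y.1) ^+ 2 by ring.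
  exact: sqr_ge0.
have E0 : 0 <= enorm x * enorm y by rewrite mulr_ge0// enorm_ge0.
have [d0|d0] := leP (dot x y) 0; first exact: le_trans E0.
by rewrite -ler_sqr ?nnegrE// ltW.
Qed.

Lemma normr_dot_le x y : `|dot x y| <= enorm x * enorm y.
Proof.
rewrite ler_norml dot_le_enorm andbT lerNl -dotNr.
by apply: le_trans (dot_le_enorm _ _) _; rewrite enormN.
Qed.

Lemma normr_fst_le x : `|x.1| <= enorm x.
Proof.
have -> : x.1 = dot (1, 0) x by rewrite /dot /=; ring.
apply: le_trans (normr_dot_le _ _) _.
by rewrite {1}/enorm /dot /= mulr1 mulr0 addr0 sqrtr1 mul1r.
Qed.

Lemma normr_snd_le x : `|x.2| <= enorm x.
Proof.
have -> : x.2 = dot (0, 1) x by rewrite /dot /=; ring.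
apply: le_trans (normr_dot_le _ _) _.
by rewrite {1}/enorm /dot /= mulr1 mulr0 add0r sqrtr1 mul1r.
Qed.

Lemma enorm_le_sum x : enorm x <= `|x.1| + `|x.2|.
Proof.
rewrite enorm_le ?addr_ge0// sqrrD !real_normK ?num_real// /dot -!expr2.
by rewrite lerD2r lerDl mulrn_wge0// mulr_ge0.
Qed.

Lemma enormD x y : enorm (x + y) <= enorm x + enorm y.
Proof.
rewrite enorm_le ?addr_ge0 ?enorm_ge0// sqrrD !enorm_sqr.
have -> : dot (x + y) (x + y) = dot x x + dot x y *+ 2 + dot y y.
  by rewrite /dot /=; ring.
by rewrite lerD2r lerD2l lerMn2r/= dot_le_enorm.
Qed.

Lemma S1_dot u : S1 u -> dot u u = 1.
Proof. by move=> u1; rewrite -enorm_sqr u1 expr1n. Qed.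

End PlaneGeometry.

Section Diameter.
Context {R : realType}.
Local Notation plane := (R * R)%type.
Local Open Scope ereal_scope.
Implicit Types (A B : set plane) (x y : plane).

Lemma diam_ge0 A : 0 <= diam A.
Proof. by apply: ereal_sup_ubound; left. Qed.

Lemma enorm_le_diam A x y : A x -> A y -> (enorm (x - y))%:E <= diam A.
Proof. by move=> Ax Ay; apply: ereal_sup_ubound; right; exists (x, y). Qed.

Lemma diam_le A (r : \bar R) : 0 <= r ->
  (forall x y, A x -> A y -> (enorm (x - y))%:E <= r) -> diam A <= r.
Proof.
move=> r0 H; apply: ge_ereal_sup => _ [->//|[[x y] [/= Ax Ay] <-]].
exact: H.
Qed.

Lemma le_diam A B : A `<=` B -> diam A <= diam B.
Proof.
move=> AB; apply: diam_le => [|x y /AB Bx /AB By]; first exact: diam_ge0.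
exact: enorm_le_diam.
Qed.

Lemma diam0 : diam (set0 : set plane) = 0.
Proof. by apply/eqP; rewrite eq_le diam_ge0 andbT; exact: diam_le. Qed.

End Diameter.

Section OuterMeasureH1.
Context {R : realType}.
Local Notation plane := (R * R)%type.
Local Open Scope ereal_scope.
Implicit Types (A B X : set plane).

(** The sets of diameter more than [delta] are given an infinite cost, which makes
    the [delta]-content the outer measure generated by a cost function. *)
Let cost (delta : R) A : \bar R := if diam A <= delta%:E then diam A else +oo.
Let allsets := g_sigma_algebraType (@setT (set plane)).

Let cost0 (delta : R) : (0 < delta)%R -> cost delta set0 = 0.
Proof. by move=> d0; rewrite /cost diam0 lee_fin ltW. Qed.

Let cost_ge0 delta A : 0 <= cost delta A.
Proof. by rewrite /cost; case: ifP => // _; exact: diam_ge0. Qed.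

Let hausdorff1_deltaE delta A :
  hausdorff1_delta delta A = @mu_ext _ allsets R (cost delta) A.
Proof.
apply/eqP; rewrite eq_le; apply/andP; split; apply: le_ereal_inf_tmp.
  move=> _ [U [_ AU] <-].
  have [[i Ui]|/forallNP small] := pselect (exists i, ~~ (diam (U i) <= delta%:E)).
    rewrite (@nneseries_pinfty _ _ _ i) ?leey//.
    by rewrite /cost (negbTE Ui).
  have {}small i : diam (U i) <= delta%:E by exact/negPn/negP/small.
  apply: ereal_inf_lbound; exists U => //.
  by apply: eq_eseriesr => i _; rewrite /cost small.
move=> _ [U [AU small] <-]; apply: ereal_inf_lbound; exists U.
  by split => // i; exact: sub_sigma_algebra.
by apply: eq_eseriesr => i _; rewrite /cost small.
Qed.

Lemma hausdorff1_delta_ge0 delta A : 0 <= hausdorff1_delta delta A.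
Proof. by rewrite hausdorff1_deltaE; exact: mu_ext_ge0. Qed.

Lemma le_hausdorff1_delta delta A B : A `<=` B ->
  hausdorff1_delta delta A <= hausdorff1_delta delta B.
Proof.
by move=> AB; rewrite !hausdorff1_deltaE; exact: (@le_mu_ext _ allsets R _ A B AB).
Qed.

Lemma hausdorff1_delta_decr (d1 d2 : R) A : (d1 <= d2)%R ->
  hausdorff1_delta d2 A <= hausdorff1_delta d1 A.
Proof.
move=> d12; apply: ereal_inf_le_tmp => _ [U [AU Ud] <-]; exists U => //.
by split => // i; apply: le_trans (Ud i) _; rewrite lee_fin.
Qed.

Lemma hausdorff1_delta_le (delta : R) A : (0 < delta)%R ->
  hausdorff1_delta delta A <= hausdorff1 A.
Proof. by move=> d0; apply: ereal_sup_ubound; exists delta. Qed.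

Lemma hausdorff1_leP A (c : \bar R) :
  (forall delta : R, (0 < delta)%R -> hausdorff1_delta delta A <= c) ->
  hausdorff1 A <= c.
Proof. by move=> H; apply: ge_ereal_sup => _ [d /= d0 <-]; exact: H. Qed.

Lemma hausdorff1_ge0 A : 0 <= hausdorff1 A.
Proof.
by apply: le_trans (hausdorff1_delta_le A ltr01); exact: hausdorff1_delta_ge0.
Qed.

Lemma hausdorff1_set0 : hausdorff1 (set0 : set plane) = 0.
Proof.
apply/eqP; rewrite eq_le hausdorff1_ge0 andbT; apply: hausdorff1_leP => d d0.
by rewrite hausdorff1_deltaE mu_ext0// cost0.
Qed.

Lemma le_hausdorff1 : {homo (@hausdorff1 R) : A B / A `<=` B >-> A <= B}.
Proof.
move=> A B AB; apply: hausdorff1_leP => d d0.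
exact: le_trans (le_hausdorff1_delta _ AB) (hausdorff1_delta_le _ d0).
Qed.

Lemma hausdorff1_sigma_subadditive : sigma_subadditive (@hausdorff1 R).
Proof.
move=> F; apply: hausdorff1_leP => d d0; rewrite hausdorff1_deltaE.
apply: le_trans (@mu_ext_sigma_subadditive _ allsets R (cost d) (cost_ge0 d) F) _.
apply: lee_nneseries => [i _ _|i _]; first exact: mu_ext_ge0.
by rewrite -hausdorff1_deltaE; exact: hausdorff1_delta_le.
Qed.

HB.instance Definition _ := isOuterMeasure.Build R plane (@hausdorff1 R)
  hausdorff1_set0 hausdorff1_ge0 le_hausdorff1 hausdorff1_sigma_subadditive.

Lemma ereal_supD_le (S T : set (\bar R)) (c : \bar R) :
  S !=set0 -> T !=set0 -> (forall x, S x -> 0 <= x) -> (forall y, T y -> 0 <= y) ->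
  (forall x y, S x -> T y -> x + y <= c) -> ereal_sup S + ereal_sup T <= c.
Proof.
move=> [x0 Sx0] [y0 Ty0] S0 T0 ST.
have c0 : 0 <= c.
  by apply: le_trans (ST _ _ Sx0 Ty0); apply: adde_ge0; [exact: S0|exact: T0].
case: c c0 ST => [c| |//] c0 ST; last exact: leey.
have fin x y : S x -> T y -> x \is a fin_num /\ y \is a fin_num.
  move=> Sx Ty; have := ST x y Sx Ty; have := S0 _ Sx; have := T0 _ Ty.
  by case: x Sx => [x| |] Sx; case: y Ty => [y| |] Ty.
have Sle y : T y -> ereal_sup S <= c%:E - y.
  move=> Ty; apply: ge_ereal_sup => x Sx; have [fx fy] := fin x y Sx Ty.
  by rewrite leeBrDr//; exact: ST.
have sS : ereal_sup S \is a fin_num.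
  have [_ fy0] := fin _ _ Sx0 Ty0.
  apply/fin_numPlt; rewrite (lt_le_trans (ltNye 0) (le_trans (S0 _ Sx0) (ereal_sup_ubound Sx0)))/=.
  by apply: le_lt_trans (Sle _ Ty0) _; rewrite -(fineK fy0) -EFinB ltey.
rewrite addeC -leeBrDr//; apply: ge_ereal_sup => y Ty.
have [_ fy] := fin _ _ Sx0 Ty.
by rewrite leeBrDr// addeC -leeBrDr//; exact: Sle.
Qed.

(** Sets at a positive distance: a small enough set meets only one of them. *)
Lemma hausdorff1_separated A B (eta : R) : (0 < eta)%R ->
  (forall x y, A x -> B y -> (eta <= enorm (x - y))%R) ->
  hausdorff1 A + hausdorff1 B <= hausdorff1 (A `|` B).
Proof.
move=> eta0 AB; apply: ereal_supD_le.
- by exists (hausdorff1_delta 1 A), 1%R => //=.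
- by exists (hausdorff1_delta 1 B), 1%R => //=.
- by move=> _ [d _ <-]; exact: hausdorff1_delta_ge0.
- by move=> _ [d _ <-]; exact: hausdorff1_delta_ge0.
move=> _ _ [d1 /= d10 <-] [d2 /= d20 <-].
pose d : R := (Num.min (Num.min d1 d2) (eta / 2))%R.
have d0 : (0 < d)%R by rewrite !lt_min d10 d20 divr_gt0.
have dd1 : (d <= d1)%R by rewrite /d !ge_min lexx.
have dd2 : (d <= d2)%R by rewrite /d !ge_min lexx orbT.
have deta : (d < eta)%R.
  by apply: (@le_lt_trans _ _ (eta / 2)%R); [rewrite /d ge_min lexx orbT|lra].
apply: le_trans (hausdorff1_delta_le _ d0).
apply: le_trans (leeD (hausdorff1_delta_decr _ dd1) (hausdorff1_delta_decr _ dd2)) _.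
apply: le_ereal_inf_tmp => _ [U [ABU Ud] <-].
apply: (@le_trans _ _ (\sum_(0 <= i <oo) (diam (U i `&` A) + diam (U i `&` B)))).
  rewrite nneseriesD; [|by move=> *; exact: diam_ge0..].
  apply: leeD; apply: ereal_inf_lbound; eexists; try reflexivity.
    split => [x Ax|i]; first by have [i _ Ui] := ABU x (or_introl Ax); exists i.
    by apply: le_trans (Ud i); apply: le_diam; exact: subIsetl.
  split => [x Bx|i]; first by have [i _ Ui] := ABU x (or_intror Bx); exists i.
  by apply: le_trans (Ud i); apply: le_diam; exact: subIsetl.
apply: lee_nneseries => [i _ _|i _]; first by apply: adde_ge0; exact: diam_ge0.
have [[x [Ux Ax]]|noA] := pselect (exists x, (U i `&` A) x); last first.
  have -> : U i `&` A = set0 by rewrite -subset0 => x Ux; apply: noA; exists x.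
  by rewrite diam0 add0e; apply: le_diam; exact: subIsetl.
have -> : U i `&` B = set0.
  rewrite -subset0 => y [Uy By].
  have := le_trans (enorm_le_diam Ux Uy) (Ud i); rewrite lee_fin.
  by have := AB x y Ax By; lra.
by rewrite diam0 adde0; apply: le_diam; exact: subIsetl.
Qed.

End OuterMeasureH1.

Section Caratheodory.
Context {R : realType}.
Local Notation plane := (R * R)%type.
Local Open Scope ereal_scope.
Implicit Types (A B X : set plane).

(** Caratheodory's criterion, for the sublevel sets of functions that do not
    expand distances. The slices of the complement whose indices have the same
    parity are at positive distances from each other, so that the measures of
    the slices are summable. *)
Lemma sublevel_caratheodory (g : plane -> R) (c : R) :
  (forall x y, `|g x - g y| <= enorm (x - y))%R ->
  (@hausdorff1 R).-caratheodory [set x | (g x <= c)%R].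
Proof.
move=> g_lip; apply: le_caratheodory_measurable => X.
set P := [set x | _].
suff H : hausdorff1 (X `&` P) + hausdorff1 (X `&` ~` P) <= hausdorff1 X by exact: H.
have [Xoo|Xfin] := eqVneq (hausdorff1 X) +oo; first by rewrite Xoo leey.
pose r n : R := (n.+1%:R^-1)%R.
have r_gt0 n : (0 < r n)%R by rewrite invr_gt0 ltr0n.
have rS n m : (n < m)%N -> (r m < r n)%R.
  by move=> nm; rewrite ltf_pV2 ?posrE ?ltr0n// ltr_nat ltnS.
have r_le n m : (n <= m)%N -> (r m <= r n)%R.
  by move=> nm; rewrite lef_pV2 ?posrE ?ltr0n// ler_nat ltnS.
pose slice n := X `&` [set x | (r n.+1 <= g x - c)%R /\ (g x - c < r n)%R].
pose far n := X `&` [set x | (r n <= g x - c)%R].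
pose U (b : bool) N := [set x | exists n, [/\ (n < N)%N, odd n = b & slice n x]].
have gap x y (e : R) : (e <= g x - g y)%R -> (e <= enorm (x - y))%R.
  by move=> h; apply: le_trans (g_lip x y); apply: le_trans h (ler_norm _).
have US N : hausdorff1 (U (odd N) N) + hausdorff1 (slice N) <=
    hausdorff1 (U (odd N) N.+1).
  have rr : (0 < r N - r N.+1)%R by rewrite subr_gt0 rS.
  case: N rr => [|N] rr.
    have -> : U (odd 0) 0%N = set0 by rewrite -subset0 => x [n []].
    rewrite hausdorff1_set0 add0e; apply: le_hausdorff1 => x sx.
    by exists 0%N.
  have rr' : (0 < r N - r N.+1)%R by rewrite subr_gt0 rS.
  apply: le_trans (@hausdorff1_separated _ _ _ (r N - r N.+1)%R rr' _) _.
    move=> x y [n [nN nodd [_ [/= x1 x2]]]] [_ [/= y1 y2]].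
    have nN2 : (n < N)%N.
      rewrite ltn_neqAle -ltnS nN andbT; apply/eqP => nE.
      by move: nodd; rewrite nE /=; case: (odd N).
    by apply: gap; have := r_le n.+1 N nN2; lra.
  apply: le_hausdorff1 => x [[n [nN nodd sx]]|sx].
    by exists n; split => //; exact: ltnW.
  by exists N.+1.
have Usum N : \sum_(0 <= i < N) hausdorff1 (slice i) <=
    hausdorff1 (U true N) + hausdorff1 (U false N).
  elim: N => [|N IH].
    by rewrite big_nil; apply: adde_ge0; exact: hausdorff1_ge0.
  rewrite big_nat_recr//=; apply: le_trans (leeD2r _ IH) _.
  have Umono b : hausdorff1 (U b N) <= hausdorff1 (U b N.+1).
    by apply: le_hausdorff1 => x [n [nN nb sx]]; exists n; split => //; exact: ltnW.
  have := US N; case: (odd N) => UN.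
    rewrite addeAC; exact: leeD.
  by rewrite -addeA; exact: leeD.
have UX b N : hausdorff1 (U b N) <= hausdorff1 X.
  by apply: le_hausdorff1 => x [n [_ _ []]].
have sum_fin : \sum_(0 <= i <oo) hausdorff1 (slice i) < +oo.
  apply: (@le_lt_trans _ _ (hausdorff1 X + hausdorff1 X)).
    apply: lime_le; first by apply: is_cvg_nneseries => *; exact: hausdorff1_ge0.
    by apply: nearW => N; apply: le_trans (Usum N) _; exact: leeD.
  by rewrite lte_add_pinfty// ltey.
have tail : \sum_(N <= i <oo) hausdorff1 (slice i) @[N --> \oo] --> 0.
  by apply: nneseries_tail_cvg => // *; exact: hausdorff1_ge0.
apply/lee_addgt0Pr => e e0.
have [N tailN] : exists N : nat, \sum_(N <= i <oo) hausdorff1 (slice i) <= e%:E.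
  have /fine_cvgP[ [n1 _ H1] /cvgrPdist_le/(_ e e0)[n2 _ H2]] := tail.
  exists (maxn n1 n2); have := H2 (maxn n1 n2) (leq_maxr _ _).
  rewrite /= sub0r normrN => le_e.
  rewrite -(fineK (H1 (maxn n1 n2) (leq_maxl _ _))) lee_fin.
  exact: le_trans (ler_norm _) le_e.
have cover : X `&` ~` P `<=` far N `|` \bigcup_(n in ~` `I_N) slice n.
  move=> x [Xx /negP]; rewrite -ltNge => gx.
  have [gN|gN] := leP (r N) (g x - c)%R; first by left.
  right; have gx0 : (0 < g x - c)%R by rewrite subr_gt0.
  have : exists m, (r m.+1 <= g x - c)%R.
    have i0 : (0 <= (g x - c)^-1)%R by rewrite invr_ge0 ltW.
    have := archi_boundP i0; set m := Num.bound _ => im; exists m.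
    rewrite -[leRHS]invrK lef_pV2 ?posrE ?invr_gt0 ?ltr0n//.
    by apply: le_trans (ltW im) _; rewrite ler_nat -addn2 leq_addr.
  case/ex_minnP => m rm mmin.
  have Nm : (N <= m)%N.
    rewrite leqNgt; apply/negP => mN.
    by have := le_lt_trans rm gN; rewrite ltNge r_le.
  exists m; first by apply/negP; rewrite -leqNgt.
  split=> //; split => //=; rewrite ltNge; apply/negP => rmm.
  case: m => [|m] in rm mmin Nm rmm *.
    have {}Nm : N = 0%N by apply/eqP; rewrite -leqn0.
    by move: gN; rewrite Nm ltNge rmm.
  by have := mmin _ rmm; rewrite ltnn.
have split_far : hausdorff1 (X `&` P) + hausdorff1 (far N) <= hausdorff1 X.
  apply: le_trans (@hausdorff1_separated _ _ _ (r N) (r_gt0 N) _) _.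
    move=> x y [_ xP] [_ /= yf]; have {}xP : (g x <= c)%R := xP.
    by rewrite enormC; apply: gap; lra.
  by apply: le_hausdorff1 => x [[]|[]].
apply: (@le_trans _ _ (hausdorff1 (X `&` P) +
    (hausdorff1 (far N) + \sum_(N <= i <oo) hausdorff1 (slice i)))).
  rewrite leeD2l//; apply: le_trans (le_hausdorff1 cover) _.
  apply: le_trans (outer_measureU2 (@hausdorff1 R) _ _) _.
  by rewrite leeD2l//; exact: (outer_measure_sigma_subadditive_tail (@hausdorff1 R)).
by rewrite addeA; exact: leeD.
Qed.

(** The Borel sets are generated by half-planes, which are sublevel sets of the
    coordinates. *)
Lemma measurable_caratheodory A : measurable A -> (@hausdorff1 R).-caratheodory A.
Proof.
pose T := caratheodory_type (@hausdorff1 R).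
have mcoord (pr : plane -> R) : (forall x y, `|pr x - pr y| <= enorm (x - y))%R ->
    measurable_fun (setT : set T) (pr : T -> R).
  move=> prl; apply: (measurability (@RGenCInfty.G R)).
    exact: RGenCInfty.measurableE.
  move=> _ [_ [x ->] <-]; rewrite setTI.
  have -> : pr @^-1` `[x, +oo[ = [set y | (- pr y <= - x)%R].
    by apply/seteqP; split => y /=; rewrite in_itv/= andbT lerN2.
  apply: (@sublevel_caratheodory (fun y => - pr y)%R) => u v.
  by rewrite -opprD normrN; exact: prl.
suff : measurable `<=` (@hausdorff1 R).-caratheodory by exact.
apply: smallest_sub.
  split => [|B mB|F mF].
  - exact: (@measurable0 _ T).
  - by rewrite setTD; exact: (@measurableC _ T).
  - exact: (@bigcupT_measurable _ T).
move=> B [] [C mC <-].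
  exact: (mcoord fst (fun x y => normr_fst_le (x - y)%R) (@measurableT _ T) C mC).
exact: (mcoord snd (fun x y => normr_snd_le (x - y)%R) (@measurableT _ T) C mC).
Qed.

Lemma hausdorff1_semi_sigma_additive : semi_sigma_additive (@hausdorff1 R).
Proof.
move=> F mF tF mUF.
have mF' i := measurable_caratheodory (mF i).
exact: (@caratheodory_measure_sigma_additive R _ (@hausdorff1 R) F mF' tF
  (measurable_caratheodory mUF)).
Qed.

HB.instance Definition _ := isMeasure.Build _ plane R (@hausdorff1 R)
  hausdorff1_set0 hausdorff1_ge0 hausdorff1_semi_sigma_additive.

End Caratheodory.

Section PlaneTopology.
Context {R : realType}.
Local Notation plane := (R * R)%type.
Implicit Types (x y z : plane) (A D : set plane).

Lemma nbhs_enorm x (r : R) : 0 < r -> nbhs x [set y | enorm (y - x) < r].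
Proof.
move=> r0; apply/nbhs_ballP; exists (r / 2); first by rewrite /= divr_gt0.
move=> y [/= b1 b2]; apply: le_lt_trans (enorm_le_sum _) _.
by move: b1 b2; rewrite /ball/= ![`|x.1 - _|]distrC ![`|x.2 - _|]distrC; lra.
Qed.

Lemma enorm_nbhs x A : nbhs x A ->
  exists2 r : R, 0 < r & forall y, enorm (y - x) < r -> A y.
Proof.
move=> /nbhs_ballP[r /= r0 rA]; exists r => // y yr; apply: rA; split.
  by rewrite /ball/= distrC; apply: le_lt_trans (normr_fst_le (y - x)) yr.
by rewrite /ball/= distrC; apply: le_lt_trans (normr_snd_le (y - x)) yr.
Qed.

(** The topology of the product is that of the maximum norm; this is the
    passage to Euclidean distances. *)
Lemma closed_enormP A : closed A <->
  forall x, (forall r : R, 0 < r -> exists2 y, A y & enorm (y - x) < r) -> A x.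
Proof.
split=> [cA x xA|H x xA].
  apply: cA => B /enorm_nbhs[r r0 rB]; have [y Ay yr] := xA r r0.
  by exists y; split => //; exact: rB.
apply: H => r r0; have [y [Ay yr]] := xA _ (nbhs_enorm x r0).
by exists y.
Qed.

(** An open set is a countable union of boxes with rational centers, and boxes
    belong to the product sigma-algebra. *)
Lemma open_plane_measurable (U : set plane) : open U -> measurable U.
Proof.
move=> oU; pose box (q1 q2 : rat) (n : nat) : set plane :=
  ball (ratr q1 : R) (n.+1%:R^-1 : R) `*` ball (ratr q2 : R) (n.+1%:R^-1 : R).
pose F q1 q2 n := if pselect (box q1 q2 n `<=` U) then box q1 q2 n else set0.
have -> : U = \bigcup_q1 \bigcup_q2 \bigcup_n F q1 q2 n.
  apply/seteqP; split; last first.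
    by move=> x [q1 _ [q2 _ [n _]]]; rewrite /F; case: pselect => // boxU; exact: boxU.
  move=> x Ux; have /nbhs_ballP[e /= e0 eU] : nbhs x U by exact: open_nbhs_nbhs.
  have [n nP] : exists n : nat, (n.+1%:R^-1 : R) < e / 2.
    have i0 : 0 <= (e / 2)^-1 by rewrite invr_ge0 ltW// divr_gt0.
    have := archi_boundP i0; set m := Num.bound _ => im; exists m.
    rewrite -[ltRHS]invrK ltf_pV2 ?posrE ?invr_gt0 ?ltr0n ?divr_gt0//.
    by apply: lt_trans im _; rewrite ltr_nat.
  set r := _^-1 in nP; have r0 : 0 < r by rewrite invr_gt0 ltr0n.
  have approx (a : R) : exists q : rat, `|a - ratr q| < r.
    have [q] := @rat_in_itvoo R (a - r) (a + r) ltac:(lra).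
    by rewrite in_itv/= => q1; exists q; rewrite distrC ltr_distl.
  have [q1 q1P] := approx x.1; have [q2 q2P] := approx x.2.
  exists q1 => //; exists q2 => //; exists n => //.
  have xbox : box q1 q2 n x by split; rewrite /ball/= distrC.
  rewrite /F; case: pselect => // -[] y [/= y1 y2].
  apply: eU; split; rewrite /ball/=.
    have -> : x.1 - y.1 = (x.1 - ratr q1) + (ratr q1 - y.1) by ring.
    by apply: le_lt_trans (ler_normD _ _) _; move: y1; rewrite /ball/= -/r; lra.
  have -> : x.2 - y.2 = (x.2 - ratr q2) + (ratr q2 - y.2) by ring.
  by apply: le_lt_trans (ler_normD _ _) _; move: y2; rewrite /ball/= -/r; lra.
apply: bigcupT_measurable_rat => q1; apply: bigcupT_measurable_rat => q2.
apply: bigcupT_measurable => n; rewrite /F; case: pselect => [boxU|outU].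
  by apply: measurableX; exact: measurable_ball.
exact: measurable0.
Qed.

Lemma closed_plane_measurable A : closed A -> measurable A.
Proof.
move=> cA; rewrite -[A]setCK; apply: measurableC; apply: open_plane_measurable.
by rewrite openC.
Qed.

Lemma measurable_fun_plane D (F : plane -> R) : closed D ->
  (forall x, D x -> forall e : R, 0 < e -> exists2 r : R, 0 < r &
    forall y, D y -> enorm (y - x) < r -> `|F y - F x| < e) ->
  measurable_fun D F.
Proof.
move=> cD cF; apply: (measurability (@RGenCInfty.G R)).
  exact: RGenCInfty.measurableE.
move=> _ [_ [c ->] <-]; apply: closed_plane_measurable.
apply/closed_enormP => x xP.
have Dx : D x.
  by apply: ((closed_enormP D).1 cD) => r /xP[y [Dy _] yr]; exists y.
split => //=; rewrite in_itv/= andbT leNgt; apply/negP => Fx.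
have [r r0 rP] := cF x Dx (c - F x) ltac:(lra).
have [y [Dy]] := xP r r0; rewrite /= in_itv/= andbT => Fy yr.
by have := rP y Dy yr; rewrite ltr_distl; lra.
Qed.

End PlaneTopology.

Section HausdorffLipschitz.
Context {R : realType}.
Local Notation plane := (R * R)%type.
Local Open Scope ereal_scope.
Implicit Types (A B : set plane).

(** Not expanding distances, [g] maps a covering of [A] to a covering of the
    interval by intervals that are not longer than the diameters. *)
Lemma hausdorff1_ge_interval A (g : plane -> R) (a b : R) : (a <= b)%R ->
  (forall x y, A x -> A y -> `|g x - g y| <= enorm (x - y))%R ->
  (forall c, (a <= c <= b)%R -> exists2 x, A x & g x = c) ->
  (b - a)%:E <= hausdorff1 A.
Proof.
move=> ab g_lip gA; apply: le_trans (hausdorff1_delta_le A ltr01).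
apply: le_ereal_inf_tmp => _ [U [AU Ud] <-].
pose G i := [set g x | x in U i `&` A].
pose I i : set R := if pselect (G i !=set0) then `[inf (G i), sup (G i)]%classic else set0.
have Gd i s t : G i s -> G i t -> (s - t <= fine (diam (U i)))%R.
  move=> [x [Ux Ax] <-] [y [Uy Ay] <-].
  apply: le_trans (ler_norm _) _; apply: le_trans (g_lip x y Ax Ay) _.
  have := enorm_le_diam Ux Uy; have := Ud i; have := diam_ge0 (U i).
  by case: (diam (U i)) => [d| |]//; rewrite lee_fin.
have Gbound i t : G i t -> has_ubound (G i) /\ has_lbound (G i).
  move=> Gt; split; first by exists (t + fine (diam (U i)))%R => s Gs; have := Gd i s t Gs Gt; lra.
  by exists (t - fine (diam (U i)))%R => s Gs; have := Gd i t s Gt Gs; lra.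
have mI i : measurable (I i) by rewrite /I; case: pselect => ?; [exact: measurable_itv|exact: measurable0].
have cover : `[a, b]%classic `<=` \bigcup_i I i.
  move=> c /=; rewrite in_itv/= => /gA[x Ax <-]; have [i _ Ui] := AU x Ax.
  exists i => //; have Gx : G i (g x) by exists x.
  rewrite /I; case: pselect => [neG|]; last by case; exists (g x).
  have [ub lb] := Gbound i _ Gx; rewrite /= in_itv/=.
  by rewrite ge_inf//= ub_le_sup.
have lenI i : lebesgue_measure (I i) <= diam (U i).
  rewrite /I; case: pselect => [[t Gt]|noG]; last by rewrite measure0 diam_ge0.
  have [ub lb] := Gbound i _ Gt; have infsup : (inf (G i) <= sup (G i))%R.
    by apply: le_trans (ge_inf lb Gt) _; exact: ub_le_sup.
  rewrite lebesgue_measure_itv/= lte_fin; case: ifP => _; last exact: diam_ge0.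
  have dfin : diam (U i) \is a fin_num.
    rewrite ge0_fin_numE ?diam_ge0//; apply: le_lt_trans (Ud i) _.
    by rewrite ltey.
  rewrite -(fineK dfin) -EFinB lee_fin lerBlDr; apply: ge_sup; first by exists t.
  move=> s Gs; rewrite -lerBlDl; apply: lb_le_inf; first by exists t.
  by move=> u Gu; have := Gd i s u Gs Gu; lra.
have -> : (b - a)%:E = lebesgue_measure (`[a, b]%classic : set R).
  rewrite lebesgue_measure_itv/= lte_fin.
  by move: ab; rewrite le_eqVlt => /predU1P[->|->]; rewrite ?subrr ?ltxx.
apply: le_trans (@measure_sigma_subadditive _ _ _ lebesgue_measure _ I mI _ cover) _.
  exact: measurable_itv.
by apply: lee_nneseries => // i _; exact: lenI.
Qed.

(** Short intervals of values of [g] pull back to sets of small diameter. *)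
Lemma hausdorff1_le_interval A (g : plane -> R) (a b L : R) :
  (a <= b)%R -> (0 <= L)%R ->
  (forall x y, A x -> A y -> enorm (x - y) <= L * `|g x - g y|)%R ->
  (forall x, A x -> a <= g x <= b)%R ->
  hausdorff1 A <= (L * (b - a))%:E.
Proof.
move=> ab L0 g_exp gA; apply: hausdorff1_leP => d d0.
have Lab : (0 <= L * (b - a))%R by rewrite mulr_ge0// subr_ge0.
have [n nP] : exists n : nat, (L * (b - a) <= d * n.+1%:R)%R.
  have i0 : (0 <= L * (b - a) / d)%R by rewrite divr_ge0// ltW.
  have := archi_boundP i0; set m := Num.bound _ => im; exists m.
  rewrite [X in (_ <= X)%R]mulrC -ler_pdivrMr//; apply: le_trans (ltW im) _.
  by rewrite ler_nat.
have n0 : (0 < n.+1%:R :> R)%R by rewrite ltr0n.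
pose l := ((b - a) / n.+1%:R)%R.
have l0 : (0 <= l)%R by rewrite divr_ge0 ?subr_ge0// ltW.
pose U i := if (i < n.+1)%N then
  [set x | A x /\ (a + l * i%:R <= g x <= a + l * i.+1%:R)%R] else set0.
have Ud i : diam (U i) <= (L * l)%:E.
  rewrite /U; case: ifP => _; last by rewrite diam0 lee_fin mulr_ge0.
  apply: diam_le => [|x y [Ax gx] [Ay gy]]; first by rewrite lee_fin mulr_ge0.
  rewrite lee_fin; apply: le_trans (g_exp x y Ax Ay) _; apply: ler_wpM2l => //.
  by move: gx gy; rewrite -natr1 ler_norml; lra.
have AU : A `<=` \bigcup_i U i.
  move=> x Ax; have /andP[ga gb] := gA x Ax.
  have ex : exists i, (g x <= a + l * i.+1%:R)%R.
    by exists n; rewrite /l divfK ?gt_eqF//; lra.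
  case/ex_minnP: ex => i gi imin; exists i => //.
  have i_n : (i < n.+1)%N by rewrite ltnS imin// /l divfK ?gt_eqF//; lra.
  rewrite /U i_n; split => //; rewrite gi andbT.
  case: i gi imin i_n => [|i] gi imin i_n; first by rewrite mulr0 addr0.
  rewrite leNgt; apply/negP => gi'; have := imin i (ltW gi').
  by rewrite ltnn.
apply: (@le_trans _ _ (\sum_(0 <= i <oo) diam (U i))).
  apply: ereal_inf_lbound; exists U => //; split => // i.
  apply: le_trans (Ud i) _; rewrite lee_fin /l mulrA ler_pdivrMr//.
rewrite (nneseries_split _ n.+1); last by move=> *; exact: diam_ge0.
rewrite add0n eseries0 ?adde0; last first.
  by move=> i ni _; rewrite /U ltnNge ni diam0.
apply: (@le_trans _ _ (\sum_(0 <= i < n.+1) (L * l)%:E)).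
  by rewrite !big_mkord; apply: lee_sum => i _; exact: Ud.
rewrite big_mkord sumEFin lee_fin sumr_const card_ord -mulr_natr.
by rewrite /l -mulrA divfK ?gt_eqF.
Qed.

(** The Lipschitz map is given by its graph [S], so that the estimate applies to
    a bijection and to its inverse. *)
Lemma hausdorff1_lipschitz A B (S : plane -> plane -> Prop) (L : R) : (0 < L)%R ->
  (forall y, B y -> exists2 x, A x & S x y) ->
  (forall x x' y y', A x -> A x' -> B y -> B y' -> S x y -> S x' y' ->
    (enorm (y - y') <= L * enorm (x - x'))%R) ->
  hausdorff1 B <= L%:E * hausdorff1 A.
Proof.
move=> L0 BA lip; apply: hausdorff1_leP => d d0.
have dL : (0 < d / L)%R by rewrite divr_gt0.
apply: (@le_trans _ _ (L%:E * hausdorff1_delta (d / L) A)); last first.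
  by rewrite lee_pmul2l// hausdorff1_delta_le.
rewrite -lee_pdivrMl//; apply: le_ereal_inf_tmp => _ [U [AU Ud] <-].
rewrite lee_pdivrMl//.
pose V i := [set y | B y /\ exists2 x, U i x /\ A x & S x y].
have Vd i : diam (V i) <= L%:E * diam (U i).
  apply: diam_le => [|y y' [By [x [Ux Ax] Sx]] [By' [x' [Ux' Ax'] Sx']]].
    by apply: mule_ge0; [rewrite lee_fin ltW|exact: diam_ge0].
  apply: (@le_trans _ _ (L * enorm (x - x'))%:E).
    by rewrite lee_fin; exact: (lip x x' y y').
  by rewrite EFinM lee_pmul2l//; exact: enorm_le_diam.
rewrite -nneseriesZl//; last by move=> *; exact: diam_ge0.
apply: (@le_trans _ _ (\sum_(0 <= i <oo) diam (V i))); last first.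
  by apply: lee_nneseries => // *; exact: diam_ge0.
apply: ereal_inf_lbound; exists V => //; split => [y By|i].
  have [x Ax Sx] := BA y By; have [i _ Ui] := AU x Ax.
  by exists i => //; split => //; exists x.
apply: le_trans (Vd i) _; rewrite -lee_pdivlMl// -EFinM mulrC.
exact: Ud.
Qed.

Lemma hausdorff1_point (x : plane) : hausdorff1 [set x] = 0.
Proof.
apply/eqP; rewrite eq_le hausdorff1_ge0 andbT.
have -> : 0 = (0 * (0 - 0))%:E :> \bar R by rewrite mul0r.
apply: (@hausdorff1_le_interval [set x] (fun=> 0%R)) => // [y z -> ->|y _].
  by rewrite subrr mul0r enorm_le// /dot /= !mulr0 addr0 expr0n.
by rewrite lexx.
Qed.

End HausdorffLipschitz.

(** * The circle by angle *)

Section Circle.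
Context {R : realType}.
Local Notation plane := (R * R)%type.
Implicit Types (s t a b : R) (x y u v : plane).

Definition cpt t : plane := (cos t, sin t).
Definition ctan t : plane := (- sin t, cos t).

Lemma cpt_S1 t : S1 (cpt t).
Proof. by rewrite /S1 /= /enorm /dot /= -!expr2 cos2Dsin2 sqrtr1. Qed.

Lemma enorm_cpt t : enorm (cpt t) = 1. Proof. exact: cpt_S1. Qed.

Lemma enorm_ctan t : enorm (ctan t) = 1.
Proof. by rewrite /enorm /dot /= mulrNN -!expr2 addrC cos2Dsin2 sqrtr1. Qed.

Lemma cpt_per t : cpt (t + 2 * pi) = cpt t.
Proof.
have e : 2 * pi = pi *+ 2 :> R by rewrite mulr2n; ring.
by rewrite /cpt e cosD2pi sinD2pi.
Qed.

Lemma ctan_per t : ctan (t + 2 * pi) = ctan t.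
Proof. by have [e1 e2] := cpt_per t; rewrite /ctan e1 e2. Qed.

Lemma dot_cpt s t : dot (cpt s) (cpt t) = cos (t - s).
Proof. by rewrite /dot /= cosB; ring. Qed.

Lemma dot_ctan_cpt s t : dot (ctan s) (cpt t) = sin (t - s).
Proof. by rewrite /dot /= sinB; ring. Qed.

Lemma frame_sqr t x : dot (cpt t) x ^+ 2 + dot (ctan t) x ^+ 2 = dot x x.
Proof.
rewrite /dot /=; transitivity ((cos t ^+ 2 + sin t ^+ 2) * (x.1 * x.1 + x.2 * x.2)).
  by ring.
by rewrite cos2Dsin2 mul1r.
Qed.

Lemma frame_eq t x y : dot (cpt t) x = dot (cpt t) y ->
  dot (ctan t) x = dot (ctan t) y -> x = y.
Proof.
move=> e1 e2; apply/eqP; rewrite -subr_eq0; apply/eqP; apply: enorm_eq0.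
apply/eqP; rewrite -sqrf_eq0 enorm_sqr -(frame_sqr t) !dotBr e1 e2 !subrr.
by rewrite expr0n addr0.
Qed.

Lemma cpt_rot s t x :
  dot (cpt t) x = cos (t - s) * dot (cpt s) x + sin (t - s) * dot (ctan s) x.
Proof.
rewrite cosB sinB /dot /=; transitivity ((cos s ^+ 2 + sin s ^+ 2) *
  (cos t * x.1 + sin t * x.2)); last by ring.
by rewrite cos2Dsin2 mul1r.
Qed.

Lemma ctan_rot s t x :
  dot (ctan t) x = cos (t - s) * dot (ctan s) x - sin (t - s) * dot (cpt s) x.
Proof.
rewrite cosB sinB /dot /=; transitivity ((cos s ^+ 2 + sin s ^+ 2) *
  (- sin t * x.1 + cos t * x.2)); last by ring.
by rewrite cos2Dsin2 mul1r.
Qed.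

Lemma chord_le s t : enorm (cpt s - cpt t) <= `|s - t|.
Proof.
rewrite enorm_le// real_normK ?num_real// dotBl !dotBr !dot_cpt !subrr cos0.
rewrite -[t - s]opprB cosN.
by have := cos_ge_quad (s - t); lra.
Qed.

Lemma S1_cpt u : S1 u -> exists2 t, 0 <= t < 2 * pi & u = cpt t.
Proof.
move=> /S1_dot; rewrite /dot -!expr2 => u1.
have pi0 := @pi_gt0 R.
have [ub1 ub2] : -1 <= u.1 /\ u.1 <= 1.
  by have := sqr_ge0 u.2; rewrite expr2 in u1 *; split; nra.
have c1 : cos (acos u.1) = u.1 by rewrite acosK// in_itv/= ub1.
have s1 : sin (acos u.1) ^+ 2 = u.2 ^+ 2 by rewrite sin2cos2 c1; lra.
have a0 : 0 <= acos u.1 by apply: acos_ge0; rewrite ub1.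
have api : acos u.1 <= pi by apply: acos_lepi; rewrite ub1.
have s0 : 0 <= sin (acos u.1) by apply: sin_ge0_pi; rewrite a0.
have [t ut] : exists t, u = cpt t.
  have [u20|u20] := leP 0 u.2.
    exists (acos u.1); rewrite /cpt c1; case: u {ub1 ub2 c1 u1 a0 api} s1 s0 u20 => u1 u2 /= s1 s0 u20.
    by congr (_, _); apply/eqP; rewrite -(@eqrXn2 _ 2) ?s1.
  exists (- acos u.1); rewrite /cpt cosN sinN c1.
  case: u {ub1 ub2 c1 u1 a0 api} s1 s0 u20 => u1 u2 /= s1 s0 u20.
  congr (_, _); apply: oppr_inj; rewrite opprK; apply/eqP.
  by rewrite -(@eqrXn2 _ 2)// ?sqrrN ?s1// oppr_ge0 ltW.
have [k kP] := reduce_angle t; exists (t + 2 * pi * k%:~R) => //.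
by rewrite (periodic_int cpt_per).
Qed.

Lemma cpt_inj s t : s < t -> t < s + 2 * pi -> cpt s <> cpt t.
Proof.
move=> st ts e; have pi0 := @pi_gt0 R.
have : dot (cpt s) (cpt t) = 1 by rewrite -e dot_cpt subrr cos0.
rewrite dot_cpt; have -> : t - s = (t - s) / 2 + (t - s) / 2 by lra.
have h0 : 0 < sin ((t - s) / 2) by apply: sin_gt0_pi; apply/andP; split; lra.
by rewrite cosD -!expr2 cos2sin2; have := exprn_gt0 2 h0; lra.
Qed.

Lemma geodesic_cpt s t : geodesic (cpt s) t = cpt (s + t).
Proof. by rewrite /geodesic /cpt /= cosD sinD; congr (_, _); ring. Qed.

Lemma cpt_continuous : continuous cpt.
Proof.
move=> t A /enorm_nbhs[r r0 rA]; apply/nbhs_ballP; exists r => // s.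
rewrite /ball/= distrC => st; apply: rA; exact: le_lt_trans (chord_le _ _) st.
Qed.

Definition carc a b : set plane := [set cpt t | t in `[a, b]].

Lemma carc_S1 a b : carc a b `<=` S1.
Proof. by move=> _ [t _ <-]; exact: cpt_S1. Qed.

Lemma carcP a b t : a <= t <= b -> carc a b (cpt t).
Proof. by move=> tab; exists t => //=; rewrite in_itv. Qed.

Lemma carc_closed a b : closed (carc a b).
Proof.
apply: compact_closed; first exact: norm_hausdorff.
apply: continuous_compact; last exact: segment_compact.
by apply: continuous_subspaceT => t; exact: cpt_continuous.
Qed.

Lemma carc_measurable a b : measurable (carc a b).
Proof. apply: closed_plane_measurable. exact: carc_closed. Qed.

Lemma S1_closed : closed (S1 : set plane).
Proof.
have -> : S1 = carc 0 (2 * pi).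
  apply/seteqP; split; last exact: carc_S1.
  by move=> u /S1_cpt[t /andP[t0 t1] ->]; apply: carcP; rewrite t0 ltW.
exact: carc_closed.
Qed.

End Circle.

Section Monotone.
Context {R : realType}.
Local Notation plane := (R * R)%type.
Implicit Types (s t a b : R) (Y : R -> plane).

(** A curve whose point at each angle maximizes the normal direction of that
    angle: over a short range of angles, its chords are almost parallel to the
    tangent direction at the start. *)
Definition normal_curve Y a b := forall s t, a <= s -> s <= t -> t <= b ->
  0 <= dot (cpt t) (Y t - Y s) /\ dot (cpt s) (Y t - Y s) <= 0.

Lemma normal_curve_chord Y a b : normal_curve Y a b -> b - a < pi / 2 ->
  forall s t, a <= s -> s <= t -> t <= b ->
  cos (b - a) * enorm (Y t - Y s) <= dot (ctan a) (Y t - Y s).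
Proof.
move=> NY ba s t as_ st tb; have pi0 := @pi_gt0 R.
have [h1 h2] := NY s t as_ st tb; set d := Y t - Y s in h1 h2 *.
have c0 : 0 < cos (t - s) by apply: cos_gt0_pihalf; lra.
have s0 : 0 <= sin (t - s) by apply: sin_ge0_pi; lra.
have sd0 : 0 <= sin (s - a) by apply: sin_ge0_pi; lra.
have cd0 : 0 < cos (s - a) by apply: cos_gt0_pihalf; lra.
have cba : 0 < cos (b - a) by apply: cos_gt0_pihalf; lra.
pose p := - dot (cpt s) d; pose q := dot (ctan s) d.
have p0 : 0 <= p by rewrite oppr_ge0.
have e1 : p * cos (t - s) <= q * sin (t - s).
  by have := cpt_rot s t d; rewrite -/q -[dot (cpt s) d]opprK -/p => e; lra.
have q0 : 0 <= q.
  have [s00|s00] := leP (sin (t - s)) 0.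
    have sz : sin (t - s) = 0 by apply/le_anti; rewrite s00.
    have tsz : t = s.
      apply/eqP; rewrite eq_le st andbT leNgt; apply/negP => ts.
      by have : 0 < sin (t - s) by [apply: sin_gt0_pi; lra]; rewrite sz ltxx.
    by rewrite /q /d tsz subrr /dot /= !mulr0 addr0.
  rewrite leNgt; apply/negP => qneg; have : q * sin (t - s) < 0 by rewrite nmulr_rlt0.
  have : 0 <= p * cos (t - s) by apply: mulr_ge0 => //; exact: ltW.
  lra.
have -> : dot (ctan a) d = cos (s - a) * q - sin (s - a) * p.
  rewrite (ctan_rot s a) -/q -[a - s]opprB cosN sinN /p; ring.
(* [|d| cos (t - s) <= q] and the right-hand side is at least
   [q cos (t - a) / cos (t - s)] *)
have nd : enorm d ^+ 2 = p ^+ 2 + q ^+ 2.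
  by rewrite enorm_sqr -(frame_sqr s) /p sqrrN.
have n1 : enorm d * cos (t - s) <= q.
  rewrite -ler_sqr ?nnegrE//; last by rewrite mulr_ge0 ?enorm_ge0// ltW.
  rewrite exprMn nd mulrDl.
  have : (p * cos (t - s)) ^+ 2 <= (q * sin (t - s)) ^+ 2.
    rewrite ler_sqr ?nnegrE//; first by rewrite mulr_ge0// ltW.
    by rewrite mulr_ge0.
  rewrite !exprMn => e2.
  rewrite -[leRHS]mulr1 -(cos2Dsin2 (t - s)) mulrDr.
  by rewrite addrC lerD2l.
have e3 : q * cos (t - a) <= (cos (s - a) * q - sin (s - a) * p) * cos (t - s).
  have -> : t - a = (t - s) + (s - a) by ring.
  rewrite cosD.
  have : sin (s - a) * (p * cos (t - s)) <= sin (s - a) * (q * sin (t - s)).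
    exact: ler_wpM2l.
  lra.
have cc : cos (b - a) <= cos (t - a).
  have [->//|tneb] := eqVneq t b; apply: ltW; rewrite ltr_cos ?in_itv/=; lra.
rewrite -(ler_pM2r c0) -mulrA; apply: le_trans e3.
apply: (@le_trans _ _ (cos (b - a) * q)); first by rewrite ler_pM2l.
by rewrite [leRHS]mulrC ler_wpM2r.
Qed.

(** The length of a normal curve over a short range of angles, up to the factor
    [cos (b - a)], is the progress in the tangent direction. *)
Lemma normal_curve_length Y a b : a <= b -> b - a < pi / 2 -> normal_curve Y a b ->
  (forall t, a <= t <= b -> {for t, continuous (fun s => dot (ctan a) (Y s))}) ->
  (((dot (ctan a) (Y b - Y a))%:E <= hausdorff1 [set Y t | t in `[a, b]])%E /\
  (hausdorff1 [set Y t | t in `[a, b]] <=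
    (dot (ctan a) (Y b - Y a) / cos (b - a))%:E)%E).
Proof.
move=> ab ba NY cY; have pi0 := @pi_gt0 R.
have cba : 0 < cos (b - a) by apply: cos_gt0_pihalf; lra.
pose g x := dot (ctan a) x.
have gmono s t : a <= s -> s <= t -> t <= b -> g (Y s) <= g (Y t).
  move=> as_ st tb; rewrite -subr_ge0 -dotBr.
  apply: le_trans (normal_curve_chord NY ba as_ st tb).
  by rewrite mulr_ge0 ?enorm_ge0// ltW.
have gab : g (Y a) <= g (Y b) by exact: gmono.
rewrite dotBr -/(g _) -/(g _); split.
  apply: (@hausdorff1_ge_interval _ _ g _ _ gab).
    move=> x y _ _; rewrite -dotBr; apply: le_trans (normr_dot_le _ _) _.
    by rewrite enorm_ctan mul1r.
  move=> c cab; have [|t tab tc] := @ivt _ (fun t => g (Y t)) a b c ab cY.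
    by left.
  by exists (Y t) => //; exists t => //=; rewrite in_itv.
rewrite mulrC; apply: (@hausdorff1_le_interval _ _ g _ _ _ gab).
- by rewrite invr_ge0 ltW.
- move=> _ _ [s /= + <-] [t /= + <-]; rewrite !in_itv/=.
  wlog st : s t / s <= t => [hw sab tab|].
    have [st|/ltW ts] := leP s t; first exact: hw.
    by rewrite enormC distrC; exact: hw.
  move=> /andP[as_ sb] /andP[at_ tb].
  rewrite -ler_pdivrMl ?invr_gt0// invrK enormC distrC -dotBr.
  apply: le_trans (normal_curve_chord NY ba as_ st tb) _.
  exact: ler_norm.
move=> _ [t /= + <-]; rewrite in_itv/= => /andP[at_ tb].
by rewrite !gmono.
Qed.

End Monotone.

(** * Convex bodies and their surface area measures *)

Section Plane.
Context {R : realType}.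
Local Notation plane := (R * R)%type.

(** Borel induction: the closed half-planes generate. *)
Lemma measurable_plane_ind (P : set (set plane)) :
  P set0 -> (forall A, P A -> P (~` A)) ->
  (forall F : (set plane)^nat, (forall n, P (F n)) -> P (\bigcup_n F n)) ->
  (forall A, closed A -> P A) ->
  forall A, measurable A -> P A.
Proof.
move=> P0 PC PU Pcl.
have coord (pr : plane -> R) : continuous pr -> forall C, measurable C -> P (pr @^-1` C).
  move=> cpr C mC; have : (@RGenCInfty.G R).-sigma.-measurable C.
    by rewrite -RGenCInfty.measurableE.
  apply: (@smallest_sub _ _ _ [set C | P (pr @^-1` C)]).
    split => [|B mB|F mF] /=.
    - by rewrite preimage_set0.
    - by rewrite setTD preimage_setC; exact: PC.
    - by rewrite preimage_bigcup; exact: PU.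
  move=> _ [x ->] /=; apply: Pcl; apply: closed_comp => [? _|]; first exact: cpr.
  by rewrite set_itvE; exact: closed_ge.
suff : measurable `<=` P by exact.
apply: smallest_sub; first by split => [|B|F] //; [rewrite setTD; exact: PC | exact: PU].
move=> B [] [C mC <-]; rewrite setTI; apply: coord => // x.
  exact: cvg_fst.
exact: cvg_snd.
Qed.

Lemma dot_continuous : continuous (fun z : plane * plane => dot z.2 z.1).
Proof.
move=> z; rewrite /dot.
have c1 : {for z, continuous (fun y : plane * plane => y.1.1)}.
  by apply: (@continuous_comp _ _ _ fst fst); exact: cvg_fst.
have c2 : {for z, continuous (fun y : plane * plane => y.1.2)}.
  by apply: (@continuous_comp _ _ _ fst snd); [exact: cvg_fst|exact: cvg_snd].
have c3 : {for z, continuous (fun y : plane * plane => y.2.1)}.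
  by apply: (@continuous_comp _ _ _ snd fst); [exact: cvg_snd|exact: cvg_fst].
have c4 : {for z, continuous (fun y : plane * plane => y.2.2)}.
  by apply: (@continuous_comp _ _ _ snd snd); exact: cvg_snd.
by apply: cvgD; apply: cvgM; [exact: c3|exact: c1|exact: c4|exact: c2].
Qed.

Lemma dotl_continuous (u : plane) : continuous (dot u).
Proof.
move=> x A /nbhs_ballP[e /= e0 eA].
have u0 : 0 < enorm u + 1 by rewrite ltr_wpDl ?enorm_ge0.
have r0 : 0 < e / (enorm u + 1) by rewrite divr_gt0.
suff : nbhs x (dot u @^-1` A) by [].
apply: filterS (nbhs_enorm x r0) => y /= yx; apply: eA; rewrite /ball/= distrC -dotBr.
apply: le_lt_trans (normr_dot_le _ _) _.
apply: (@le_lt_trans _ _ ((enorm u + 1) * enorm (y - x))).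
  by rewrite ler_wpM2r ?enorm_ge0// lerDl.
by rewrite mulrC -ltr_pdivlMr.
Qed.

Lemma carc_compact (a b : R) : compact (carc a b).
Proof.
apply: continuous_compact; last exact: segment_compact.
by apply: continuous_subspaceT => t; exact: cpt_continuous.
Qed.

Lemma S1_carc : S1 = carc 0 (2 * pi) :> set plane.
Proof.
apply/seteqP; split; last exact: carc_S1.
by move=> u /S1_cpt[t /andP[t0 t1] ->]; apply: carcP; rewrite t0 ltW.
Qed.

End Plane.

Section Body.
Context {R : realType}.
Local Notation plane := (R * R)%type.
Implicit Types (K A C : set plane) (x y u v : plane).

Lemma convex_body_neq0 K : convex_body K -> K !=set0.
Proof. by case=> _ _ [x /interior_subset Kx]; exists x. Qed.

Lemma convex_body_closed K : convex_body K -> closed K.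
Proof. by case=> cK _ _; apply: compact_closed => //; exact: norm_hausdorff. Qed.

Lemma support_attained K u : convex_body K -> exists2 x, K x &
  dot u x = support_fun K u /\ forall y, K y -> dot u y <= support_fun K u.
Proof.
move=> cb; have [||x] := @compact_EVT_max _ _ (dot u) K (convex_body_neq0 cb).
- by case: cb.
- by apply: continuous_subspaceT => ?; exact: dotl_continuous.
rewrite inE => Kx mx; exists x => //.
have hx : dot u x = support_fun K u.
  apply/le_anti/andP; split.
    apply: ub_le_sup; last by exists x.
    by exists (dot u x) => _ [y Ky <-]; apply: mx; rewrite inE.
  apply: ge_sup; first by exists (dot u x), x.
  by move=> _ [y Ky <-]; apply: mx; rewrite inE.
by split=> // y Ky; rewrite -hx; apply: mx; rewrite inE.
Qed.

Lemma dot_le_support K u x : convex_body K -> K x -> dot u x <= support_fun K u.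
Proof. by move=> /(support_attained u)[_ _ [_]]; exact. Qed.

Lemma outer_normalP K x u : convex_body K -> K x ->
  outer_normal K x u <-> S1 u /\ dot u x = support_fun K u.
Proof.
move=> cb Kx; split=> -[S1u H]; split=> //.
  apply/le_anti; rewrite dot_le_support//=.
  by have [y Ky [<- _]] := support_attained u cb; exact: H.
by move=> y Ky; rewrite H; exact: dot_le_support.
Qed.

Lemma convex_body_bounded K : convex_body K ->
  exists2 M : R, 0 <= M & forall x, K x -> enorm x <= M.
Proof.
move=> cb; have [e _ [_ he]] := support_attained (1, 0) cb.
have [_ _ [_ h1]] := support_attained (-1, 0) cb.
have [_ _ [_ h2]] := support_attained (0, 1) cb.
have [_ _ [_ h3]] := support_attained (0, -1) cb.
move: he h1 h2 h3; set a := support_fun _ _; set b := support_fun _ _.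
set c := support_fun _ _; set d := support_fun _ _ => ha hb hc hd.
have a0 := normr_ge0 a; have b0 := normr_ge0 b; have c0 := normr_ge0 c.
have d0 := normr_ge0 d.
exists (`|a| + `|b| + (`|c| + `|d|)); first by lra.
move=> x Kx; apply: le_trans (enorm_le_sum x) _.
have := ha x Kx; have := hb x Kx; have := hc x Kx; have := hd x Kx.
rewrite /dot /= !mulN1r !mul1r !mul0r !addr0 !add0r => e4 e3 e2 e1.
have := ler_norm a; have := ler_norm b; have := ler_norm c; have := ler_norm d.
move=> ? ? ? ?; apply: lerD; rewrite ler_norml; apply/andP; split; lra.
Qed.

Lemma interior_strict K x u : S1 u -> K° x -> exists2 y, K y & dot u x < dot u y.
Proof.
move=> S1u /enorm_nbhs[r r0 rK]; exists (x + (r / 2) *: u).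
  apply: rK; rewrite addrAC subrr add0r; apply: (@le_lt_trans _ _ (r / 2)); last lra.
  rewrite enorm_le; last by rewrite divr_ge0// ltW.
  have -> : dot ((r / 2) *: u) ((r / 2) *: u) = (r / 2) ^+ 2 * dot u u.
    by rewrite /dot /= /GRing.scale /=; ring.
  by rewrite (S1_dot S1u) mulr1.
have -> : dot u (x + (r / 2) *: u) = dot u x + r / 2 * dot u u.
  by rewrite /dot /= /GRing.scale /=; ring.
by rewrite (S1_dot S1u) mulr1 ltrDl divr_gt0.
Qed.

Lemma outer_normal_bd K x u : convex_body K -> K x -> outer_normal K x u -> bd K x.
Proof.
move=> cb Kx [S1u xu]; split; first exact: subset_closure.
by move=> /(interior_strict S1u)[y Ky]; rewrite ltNge xu.
Qed.

Definition smooth K := forall x u v, K x ->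
  outer_normal K x u -> outer_normal K x v -> u = v.

(** The reverse spherical image. For a smooth body it commutes with complements
    in the boundary, whence its measurability and the additivity of the surface
    area. *)
Definition normal_preimage K A :=
  [set x | K x /\ exists2 u, A u & outer_normal K x u].

Lemma surface_areaE K A : convex_body K -> smooth K ->
  surface_area K A = hausdorff1 (normal_preimage K A).
Proof.
move=> cb sK; congr hausdorff1; apply/seteqP; split => x /=.
  move=> [[cKx _] [u Au [xu _]]]; split; last by exists u.
  exact: convex_body_closed cb _ cKx.
move=> [Kx [u Au xu]]; split; first exact: outer_normal_bd xu.
by exists u => //; split=> // v xv; exact: sK xv xu.
Qed.

(** It is the projection of a compact set of pairs of a point and a normal. *)
Lemma normal_preimage_closed K C : convex_body K -> closed C ->
  closed (normal_preimage K C).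
Proof.
move=> cb cC; apply: compact_closed; first exact: norm_hausdorff.
pose E : set (plane * plane) := ((fst @^-1` K) `&` (snd @^-1` (S1 `&` C))) `&`
  \bigcap_(y in K) [set z | dot z.2 y <= dot z.2 z.1].
have -> : normal_preimage K C = fst @` E.
  apply/seteqP; split => x /=.
    move=> [Kx [u Cu [S1u xu]]]; by exists (x, u).
  by move=> [[y u] [[/= Ky [S1u Cu]] yu] <-]; split=> //; exists u.
apply: continuous_compact.
  by apply: continuous_subspaceT => z; exact: cvg_fst.
apply: (@subclosed_compact _ _ (K `*` S1)); last by move=> z [[? []]].
  apply: closedI; first apply: closedI.
  - by apply: closed_comp => [? _|]; [exact: cvg_fst|exact: convex_body_closed].
  - apply: closed_comp => [? _|]; first exact: cvg_snd.
    by apply: closedI => //; exact: S1_closed.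
  apply: closed_bigI => y Ky.
  pose g (z : plane * plane) := dot z.2 z.1 - dot y z.2.
  have -> : [set z : plane * plane | dot z.2 y <= dot z.2 z.1] = g @^-1` [set t | 0 <= t].
    by apply/seteqP; split => z /=; rewrite subr_ge0 (dotC y).
  apply: closed_comp; last exact: closed_ge.
  move=> z _; apply: (@continuousB _ _ _ (fun z : plane * plane => dot z.2 z.1)
    (fun z : plane * plane => dot y z.2)); first exact: dot_continuous.
  apply: (@continuous_comp _ _ _ snd (dot y)); first exact: cvg_snd.
  exact: dotl_continuous.
apply: compact_setX; first by case: cb.
by rewrite S1_carc; exact: carc_compact.
Qed.

Lemma normal_preimage_measurable K A : convex_body K -> smooth K ->
  measurable A -> measurable (normal_preimage K A).
Proof.
move=> cb sK mA; move: A mA.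
apply: (@measurable_plane_ind R (fun A => measurable (normal_preimage K A))).
- have -> : normal_preimage K set0 = set0; last exact: measurable0.
  by rewrite -subset0 => x [_ [u]].
- move=> A mA; have -> : normal_preimage K (~` A) =
      normal_preimage K setT `\` normal_preimage K A.
    apply/seteqP; split => x.
      move=> [Kx [u Au xu]]; split; first by split=> //; exists u.
      by move=> [_ [v Av xv]]; apply: Au; rewrite (sK x u v).
    move=> [[Kx [u _ xu]] nA]; split=> //; exists u => // Au; apply: nA.
    by split=> //; exists u.
  apply: measurableD => //; apply: closed_plane_measurable.
  by apply: normal_preimage_closed => //; exact: closedT.
- move=> F mF; have -> : normal_preimage K (\bigcup_n F n) =
      \bigcup_n normal_preimage K (F n); last exact: bigcupT_measurable.
  apply/seteqP; split => x.
    by move=> [Kx [u [n _ Fu] xu]]; exists n => //; split=> //; exists u.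
  by move=> [n _ [Kx [u Fu xu]]]; split=> //; exists u => //; exists n.
- by move=> C cC; apply: closed_plane_measurable; exact: normal_preimage_closed.
Qed.

End Body.

Section SurfaceMeasure.
Context {R : realType}.
Local Notation plane := (R * R)%type.
Local Open Scope ereal_scope.
Variable (K : set plane).
Hypothesis (cbK : convex_body K) (sK : smooth K).

(** The proofs are arguments so that the measure structure, which needs them, can
    be inferred from the term. *)
Definition surface_measure of convex_body K & smooth K := surface_area K.
Local Notation mu := (surface_measure cbK sK).

Let surface0 : mu set0 = 0.
Proof.
rewrite /surface_measure surface_areaE//.
have -> : normal_preimage K set0 = set0; last exact: hausdorff1_set0.
by rewrite -subset0 => x [_ [u]].
Qed.

Let surface_ge0 A : 0 <= mu A.
Proof. by rewrite /surface_measure surface_areaE//; exact: hausdorff1_ge0. Qed.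

Let surface_additive : semi_sigma_additive mu.
Proof.
move=> F mF tF mUF.
have -> : mu (\bigcup_n F n) = hausdorff1 (\bigcup_n normal_preimage K (F n)).
  rewrite /surface_measure surface_areaE//; congr hausdorff1.
  apply/seteqP; split => x.
    by move=> [Kx [u [n _ Fu] xu]]; exists n => //; split=> //; exists u.
  by move=> [n _ [Kx [u Fu xu]]]; split=> //; exists u => //; exists n.
have -> : (fun n => \sum_(0 <= i < n) mu (F i)) =
    (fun n => \sum_(0 <= i < n) hausdorff1 (normal_preimage K (F i))).
  apply/funext => n; apply: eq_bigr => i _.
  by rewrite /surface_measure surface_areaE.
apply: (@measure_semi_sigma_additive _ _ _ (@hausdorff1 R)).
- by move=> i; exact: normal_preimage_measurable.
- apply/trivIsetP => i j _ _ ij; rewrite -subset0 => x [[Kx [u Fu xu]] [_ [v Fv xv]]].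
  move/trivIsetP : tF => /(_ i j I I ij); rewrite -subset0 => /(_ u); apply.
  by split=> //; rewrite (sK Kx xu xv).
- by apply: bigcupT_measurable => i; exact: normal_preimage_measurable.
Qed.

HB.instance Definition _ := isMeasure.Build _ _ _ mu
  surface0 surface_ge0 surface_additive.

End SurfaceMeasure.

(** * Comparison of integrals over the circle *)

Section Integral.
Context {R : realType}.
Local Notation plane := (R * R)%type.
Local Open Scope ereal_scope.
Implicit Types (A D : set plane) (g : plane -> R).
Import HBNNSimple.

(** Nothing is assumed on the set function: before a solution is known to be
    smooth, its surface area is not known to be a measure. *)
Lemma integral_null (mu : set plane -> \bar R) D g :
  (forall A, A `<=` D -> mu A = 0) -> \int[mu]_(u in D) (g u)%:E = 0.
Proof.
move=> mu0.
have zero (G : plane -> \bar R) : (forall x, 0 <= G x) ->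
    (forall x, ~ D x -> G x = 0) ->
    ereal_sup [set sintegral mu h |
      h in [set h : {nnsfun plane >-> R} | forall x, (h x)%:E <= G x]] = 0.
  move=> G0 GD.
  have sz (h : {nnsfun plane >-> R}) : (forall x, (h x)%:E <= G x) ->
      sintegral mu h = 0.
    move=> hG; rewrite /sintegral fsbig1// => r _.
    have [->|r0] := eqVneq r 0%R; first by rewrite mul0e.
    rewrite mu0 ?mule0// => x /= hx; apply: contrapT => /GD Gx.
    have : (h x)%:E <= 0 by rewrite -Gx.
    rewrite lee_fin hx => rle; have : (0 <= h x)%R by [].
    by rewrite hx => rge; move/eqP: r0; apply; apply/le_anti; rewrite rle.
  apply/le_anti/andP; split; first by apply: ge_ereal_sup => _ [h hG <-]; rewrite sz.
  apply: ereal_sup_ubound; exists nnsfun0; first by move=> x /=.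
  by apply: sz => x /=.
have out x : ~ D x -> ((fun u => (g u)%:E) \_ D) x = 0.
  by move=> Dx; rewrite patchE; case: ifPn => //; rewrite inE.
rewrite /integral !zero ?sube0// => x Dx.
  by rewrite funenegE out// oppe0 maxxx.
by rewrite funeposE out//= maxxx.
Qed.

Lemma integral_bounds (mu : {measure set plane -> \bar R}) D g (c1 c2 : R) :
  measurable D -> measurable_fun D g -> (0 <= c1)%R ->
  (forall u, D u -> c1 <= g u <= c2)%R ->
  c1%:E * mu D <= \int[mu]_(u in D) (g u)%:E /\
  \int[mu]_(u in D) (g u)%:E <= c2%:E * mu D.
Proof.
move=> mD mg c10 gb; rewrite -!integral_cst//.
have mgE : measurable_fun D (fun u => (g u)%:E) by exact/measurable_EFinP.
split; apply: ge0_le_integral => //= u Du.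
- by have /andP[] := gb u Du.
- by have /andP[gu _] := gb u Du; rewrite lee_fin (le_trans c10).
- by have /andP[] := gb u Du.
Qed.

(** The power 6 is the loss in the comparison over a short arc. *)
Lemma lee_mul_squeeze (x y : \bar R) : 0 <= y ->
  (forall l : R, (1 < l)%R -> (l <= 2)%R -> x <= (l ^+ 6)%:E * y) -> x <= y.
Proof.
move=> y0 H; case: y y0 H => [r| |] //; first last.
  by move=> *; rewrite leey.
rewrite lee_fin => r0 H.
have xl l : (1 < l)%R -> (l <= 2)%R -> x <= (l ^+ 6 * r)%:E by exact: H.
apply/lee_addgt0Pr => e e0.
have d0 : (0 < 63 * (r + 1))%R by lra.
pose y := Num.min 1%R (e / (63 * (r + 1)))%R.
have y0 : (0 < y)%R by rewrite lt_min ltr01/= divr_gt0.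
have y1 : (y <= 1)%R by rewrite ge_min lexx.
have ye : (y * (63 * (r + 1)) <= e)%R by rewrite -ler_pdivlMr// ge_min lexx orbT.
apply: le_trans (xl (1 + y)%R _ _) _; [by rewrite ltrDl|lra|].
rewrite lee_fin.
have y6 : ((1 + y) ^+ 6 <= 1 + 63 * y)%R.
  have pw (k : nat) : (y ^+ k.+1 <= y)%R.
    by rewrite exprS ler_piMr ?exprn_ile1// ltW.
  have -> : ((1 + y) ^+ 6 = 1 + 6 * y + 15 * y ^+ 2 + 20 * y ^+ 3 + 15 * y ^+ 4
    + 6 * y ^+ 5 + y ^+ 6)%R by ring.
  have := pw 1%N; have := pw 2%N; have := pw 3%N; have := pw 4%N; have := pw 5%N.
  lra.
apply: (@le_trans _ _ ((1 + 63 * y) * r)%R); first exact: ler_wpM2r.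
have -> : ((1 + 63 * y) * r = r + y * (63 * r))%R by ring.
rewrite lerD2l; apply: le_trans ye; apply: ler_wpM2l; [exact: ltW|lra].
Qed.

(** Comparing two integrals over the subsets of short arcs is enough to compare
    them over all subsets of the circle: cut the circle into short arcs. *)
Lemma arcwise_le (mu nu : {measure set plane -> \bar R}) (g1 g2 : plane -> R) (c D : R) :
  (0 < D)%R -> (0 <= c)%R ->
  measurable_fun S1 g1 -> measurable_fun S1 g2 ->
  (forall u, S1 u -> 0 <= g1 u)%R -> (forall u, S1 u -> 0 <= g2 u)%R ->
  (forall (a : R) A, measurable A -> A `<=` carc a (a + D) ->
    \int[mu]_(u in A) (g1 u)%:E <= c%:E * \int[nu]_(u in A) (g2 u)%:E) ->
  forall A, measurable A -> A `<=` S1 ->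
    \int[mu]_(u in A) (g1 u)%:E <= c%:E * \int[nu]_(u in A) (g2 u)%:E.
Proof.
move=> D0 c0 mg1 mg2 g10 g20 H.
have ind n : forall A, measurable A -> A `<=` carc 0 (n%:R * D) ->
    \int[mu]_(u in A) (g1 u)%:E <= c%:E * \int[nu]_(u in A) (g2 u)%:E.
  elim: n => [|n IH] A mA An.
    apply: (H 0%R) => //; apply: subset_trans An _ => _ [t /= + <-].
    by rewrite mul0r !in_itv/= => /andP[t0 t1]; apply: carcP; lra.
  have mC := carc_measurable (n%:R * D) (n%:R * D + D).
  set C := carc _ _ in mC.
  have AS : A `<=` S1 by apply: subset_trans An _; exact: carc_S1.
  have split_int (m : {measure set plane -> \bar R}) (g : plane -> R) :
      measurable_fun S1 g -> (forall u, S1 u -> 0 <= g u)%R ->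
      \int[m]_(u in A) (g u)%:E =
      \int[m]_(u in A `\` C) (g u)%:E + \int[m]_(u in A `&` C) (g u)%:E.
    move=> mg g0; have AE : A = (A `\` C) `|` (A `&` C) by rewrite setUC setUIDK.
    rewrite {1}AE ge0_integral_setU//.
    - exact: measurableD.
    - exact: measurableI.
    - apply/measurable_EFinP; rewrite -AE; apply: measurable_funS mg => //.
      exact: closed_plane_measurable S1_closed.
    - by move=> u; rewrite -AE => Au; rewrite lee_fin g0//; exact: AS.
    - by rewrite disj_set2E; apply/eqP; rewrite -subset0 => u [[_ nC] [_ /nC]].
  rewrite (split_int mu g1)// (split_int nu g2)// ge0_muleDr; first last.
  - by apply: integral_ge0 => u [Au _]; rewrite lee_fin g20//; exact: AS.
  - by apply: integral_ge0 => u [Au _]; rewrite lee_fin g20//; exact: AS.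
  apply: leeD.
    apply: IH; first exact: measurableD.
    move=> u [Au nC]; have [t /=] := An u Au; rewrite in_itv/= => /andP[t0 t1] tu.
    rewrite -tu; apply: carcP; rewrite t0/= leNgt; apply/negP => nt.
    apply: nC; rewrite -tu; apply: carcP; rewrite ltW//=.
    by move: t1; rewrite -natr1 mulrDl mul1r.
  by apply: (H (n%:R * D)%R); [exact: measurableI|move=> u []].
move=> A mA AS; have [n nD] : exists n : nat, (2 * pi <= n%:R * D)%R.
  have p0 : (0 <= 2 * pi / D :> R)%R by rewrite divr_ge0 ?mulr_ge0 ?pi_ge0 ?ltW.
  exists (Num.bound (2 * pi / D : R)%R); have := archi_boundP p0.
  by rewrite ltr_pdivrMr// => /ltW.
apply: (ind n A mA); apply: subset_trans AS _; rewrite S1_carc => _ [t /= + <-].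
by rewrite in_itv/= => /andP[t0 t1]; apply: carcP; rewrite t0 (le_trans t1).
Qed.

End Integral.

(** * Solutions of the Minkowski problem solve the differential equation *)

Section Corners.
Context {R : realType}.
Local Notation plane := (R * R)%type.
Implicit Types (K : set plane) (x y u v : plane) (f : plane -> R) (a b s t : R).

Definition circle_continuous f := forall u, S1 u -> forall e : R, 0 < e ->
  exists2 r : R, 0 < r & forall v, S1 v -> enorm (v - u) < r -> `|f v - f u| < e.

Lemma circle_continuous_measurable f : circle_continuous f -> measurable_fun S1 f.
Proof. by move=> cf; apply: measurable_fun_plane => //; exact: S1_closed. Qed.

Lemma circle_continuous_cpt f : circle_continuous f -> continuous (f \o cpt).
Proof.
move=> cf t; apply/continuousP_eps => e e0.
have [r r0 rf] := cf (cpt t) (cpt_S1 t) e e0; exists r => // s st.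
by apply: rf; [exact: cpt_S1|exact: le_lt_trans (chord_le _ _) st].
Qed.

Lemma carc_length a b : a <= b -> b - a < pi / 2 ->
  ((sin (b - a))%:E <= hausdorff1 (carc a b) /\
   hausdorff1 (carc a b) <= (sin (b - a) / cos (b - a))%:E)%E.
Proof.
move=> ab ba; have [||] := @normal_curve_length R cpt a b ab ba.
- move=> s t _ st _; rewrite !dotBr !dot_cpt !subrr cos0 -(opprB t s) cosN.
  by have := cos_le1 (t - s); split; lra.
- move=> t _; apply: (@continuous_comp _ _ _ cpt (dot (ctan a))).
    exact: cpt_continuous.
  exact: dotl_continuous.
by rewrite dotBr !dot_ctan_cpt subrr sin0 subr0.
Qed.

(** The direction [cpt th] as a combination of [cpt s] and [cpt t]; the
    coefficients are positive when [th] is between [s] and [t]. *)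
Lemma sin_cpt s t th x : sin (t - s) * dot (cpt th) x =
  sin (t - th) * dot (cpt s) x + sin (th - s) * dot (cpt t) x.
Proof. by rewrite !sinB /dot /=; ring. Qed.

(** Two opposite normals would put the body on a line. *)
Lemma no_antipodal_normals K x t : convex_body K ->
  outer_normal K x (cpt t) -> outer_normal K x (cpt (t + pi)) -> False.
Proof.
move=> cb [S1t n1] [_ n2].
have opp y : dot (cpt (t + pi)) y = - dot (cpt t) y.
  by rewrite /dot /= cosDpi sinDpi; ring.
have Kd y : K y -> dot (cpt t) y = dot (cpt t) x.
  move=> Ky; apply/le_anti; rewrite n1//=.
  by have := n2 y Ky; rewrite !opp lerN2.
have [_ _ [y Ky]] := cb; have [z Kz] := interior_strict S1t Ky.
by rewrite (Kd z Kz) (Kd y (interior_subset Ky)) ltxx.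
Qed.

(** Between two normals at the same point, the body has no other boundary
    point: the surface area measure does not charge that arc. *)
Lemma normals_between K x s t th y : s < th -> th < t -> t < s + pi ->
  K x -> outer_normal K x (cpt s) -> outer_normal K x (cpt t) ->
  K y -> outer_normal K y (cpt th) -> y = x.
Proof.
move=> sth tht ts Kx [_ ns] [_ nt] Ky [_ nth].
have c1 : 0 < sin (t - th) by apply: sin_gt0_pi; lra.
have c2 : 0 < sin (th - s) by apply: sin_gt0_pi; lra.
have c3 : 0 < sin (t - s) by apply: sin_gt0_pi; lra.
have d1 : dot (cpt s) (y - x) <= 0 by rewrite dotBr subr_le0; exact: ns.
have d2 : dot (cpt t) (y - x) <= 0 by rewrite dotBr subr_le0; exact: nt.
have d3 : 0 <= dot (cpt th) (y - x) by rewrite dotBr subr_ge0; exact: nth.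
have e := sin_cpt s t th (y - x).
have e0 : 0 <= sin (t - s) * dot (cpt th) (y - x) by rewrite mulr_ge0// ltW.
have e1 : sin (t - th) * dot (cpt s) (y - x) <= 0 by rewrite pmulr_rle0.
have e2 : sin (th - s) * dot (cpt t) (y - x) <= 0 by rewrite pmulr_rle0.
have z1 : sin (t - th) * dot (cpt s) (y - x) = 0.
  by clear -e e0 e1 e2; lra.
have z2 : sin (th - s) * dot (cpt t) (y - x) = 0.
  by clear -e e0 e1 e2; lra.
have {}z1 : dot (cpt s) (y - x) = 0.
  by apply/eqP; move/eqP: z1; rewrite mulf_eq0 gt_eqF.
have {}z2 : dot (cpt t) (y - x) = 0.
  by apply/eqP; move/eqP: z2; rewrite mulf_eq0 gt_eqF.
have z3 : dot (ctan s) (y - x) = 0.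
  move: z2; rewrite (cpt_rot s t) z1 mulr0 add0r => /eqP.
  by rewrite mulf_eq0 gt_eqF//= => /eqP.
apply/eqP; rewrite -subr_eq0; apply/eqP.
have dz (w : plane) : dot w 0 = 0 by rewrite /dot /= !mulr0 addr0.
by apply: (@frame_eq _ s); rewrite dz.
Qed.

Variables (p eps : R) (f : plane -> R) (K : set plane).
Hypotheses (e1 : eps < 1) (fc : circle_continuous f).
Hypothesis (f1 : forall u, S1 u -> `|f u - 1| <= eps).
Hypothesis (solK : Lp_Minkowski_solution p f K).

Let cbK : convex_body K. Proof. by case: solK => -[]. Qed.

(** At a corner, the arc of the normals has no surface area, while the integral of
    [f] over it is positive. *)
Lemma no_corner x s t : s < t -> t < s + pi -> K x ->
  outer_normal K x (cpt s) -> outer_normal K x (cpt t) -> False.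
Proof.
move=> st ts Kx ns nt; have pi0 := @pi_gt0 R.
pose a := s + (t - s) / 3; pose b := s + 2 * (t - s) / 3.
have sa : s < a by rewrite /a; lra.
have ab : a < b by rewrite /a /b; lra.
have bt : b < t by rewrite /b; lra.
have ba : b - a < pi / 2 by rewrite /a /b; lra.
have mC := carc_measurable a b.
have [_ /(_ _ mC (@carc_S1 _ a b))] := solK.
rewrite (@integral_null R (surface_area K)); last first.
  move=> A Aab; rewrite /surface_area.
  suff -> : [set x | bd K x /\ exists2 u, A u & gauss_map_eq K x u] = set0.
    exact: hausdorff1_set0.
  rewrite -subset0 => y [[Ky _] [u /Aab[th /=]]]; rewrite in_itv/= => /andP[ath thb] <-.
  move=> [nth uni]; have {}Ky := convex_body_closed cbK Ky.
  have yx : y = x.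
    apply: (@normals_between K x s t th y) => //; [exact: lt_le_trans ath|].
    exact: le_lt_trans bt.
  rewrite yx in uni; apply: (@cpt_inj R s t st); first lra.
  by rewrite (uni _ ns) (uni _ nt).
have fb u : carc a b u -> 1 - eps <= f u <= 1 + eps.
  by move=> /carc_S1/f1; rewrite ler_distl.
have mf : measurable_fun (carc a b) f.
  apply: measurable_funS (circle_continuous_measurable fc); last exact: carc_S1.
  exact: closed_plane_measurable S1_closed.
have := e1; rewrite -subr_gt0 => e10.
have [lb _] := integral_bounds (@hausdorff1 R) mC mf (ltW e10) fb.
move=> eq0; move: lb; rewrite -eq0 leNgt; apply/negP; rewrite negbK.
have [lb _] := carc_length (ltW ab) ba.
rewrite mule_gt0// ?lte_fin//; apply: lt_le_trans lb.
by rewrite lte_fin; apply: sin_gt0_pi; lra.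
Qed.

(** Two distinct normals at one point either are opposite or bound an arc shorter
    than a half circle. *)
Lemma solution_smooth : smooth K.
Proof.
move=> x u v Kx nu nv; have pi0 := @pi_gt0 R.
have [s /andP[s0 s1] us] := S1_cpt nu.1; have [t /andP[t0 t1] vt] := S1_cpt nv.1.
rewrite us vt in nu nv *.
wlog st : s t {us vt} s0 s1 t0 t1 nu nv / s < t => [hw|].
  have [st|ts|->//] := ltgtP s t; first exact: hw.
  by apply/esym; apply: hw.
exfalso; have [ts|ts|ts] := ltgtP t (s + pi).
- exact: (@no_corner x s t).
- by apply: (@no_corner x t (s + 2 * pi)) => //; [lra|lra|rewrite cpt_per].
- by apply: (@no_antipodal_normals K x s) => //; rewrite -ts.
Qed.

End Corners.

Section Bodies.
Context {R : realType}.
Local Notation plane := (R * R)%type.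
Implicit Types (K : set plane) (x y z u v : plane) (f : plane -> R) (a b s t : R).

Lemma convex_body_segment K x y l : convex_body K -> K x -> K y ->
  0 <= l -> l <= 1 -> K (x + l *: (y - x)).
Proof.
move=> [_ cK _] Kx Ky l0 l1.
have := cK y x (Itv01 l0 l1); rewrite !inE => /(_ Ky Kx).
have -> : x + l *: (y - x) = l *: y + (1 - l) *: x; last by [].
by rewrite scalerBl scale1r scalerBr addrCA.
Qed.

Lemma enorm_le_support K C x : convex_body K -> K 0 ->
  (forall t, support_fun K (cpt t) <= C) -> K x -> enorm x <= C.
Proof.
move=> cb K0 hC Kx.
have d0 u : dot u 0 = 0 :> R by rewrite /dot /= !mulr0 addr0.
have [x0|xn0] := eqVneq (enorm x) 0.
  by rewrite x0; apply: le_trans (hC 0); have := dot_le_support (cpt 0) cb K0; rewrite d0.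
have xp : 0 < enorm x by rewrite lt_def xn0 enorm_ge0.
have du y : dot ((enorm x)^-1 *: x) y = (enorm x)^-1 * dot x y.
  by rewrite /dot /= /GRing.scale /=; ring.
have [|t _ xt] := @S1_cpt R ((enorm x)^-1 *: x).
  rewrite /S1 /= {1}/enorm du dotC du -enorm_sqr mulrA -expr2 -exprMn.
  by rewrite mulVf// expr1n sqrtr1.
apply: le_trans (hC t); rewrite -xt.
apply: le_trans (dot_le_support _ cb Kx).
by rewrite du -enorm_sqr expr2 mulrA mulVf// mul1r.
Qed.

Lemma support_lipschitz K M u v : convex_body K -> (forall x, K x -> enorm x <= M) ->
  `|support_fun K u - support_fun K v| <= M * enorm (u - v).
Proof.
move=> cb KM.
wlog vu : u v / support_fun K v <= support_fun K u => [hw|].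
  have [vu|/ltW uv] := leP (support_fun K v) (support_fun K u); first exact: hw.
  by rewrite distrC enormC; exact: hw.
rewrite ger0_norm ?subr_ge0//.
have [x Kx [<- _]] := support_attained u cb.
apply: (@le_trans _ _ (dot (u - v) x)).
  by rewrite dotBl lerD2l lerN2; exact: dot_le_support.
apply: le_trans (dot_le_enorm _ _) _; rewrite mulrC.
by rewrite ler_wpM2r ?enorm_ge0//; exact: KM.
Qed.

Lemma closed_far e x : closed [set y : plane | e <= enorm (y - x)].
Proof.
apply/closed_enormP => y yx /=; rewrite leNgt; apply/negP => ye.
have [|z /= ez zy] := yx (e - enorm (y - x)); first by rewrite subr_gt0.
have := enormD (z - y) (y - x); have -> : z - y + (y - x) = z - x.
  by rewrite addrA subrK.
by move: (enorm (z - x)) ez zy => E ez zy; lra.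
Qed.

End Bodies.

Section Contact.
Context {R : realType}.
Local Notation plane := (R * R)%type.
Variables (K : set plane) (X : R -> plane) (M : R).
Hypotheses (cbK : convex_body K) (KX : forall t, K (X t)).
Hypothesis hX : forall t, dot (cpt t) (X t) = support_fun K (cpt t).
Hypothesis KM : forall x, K x -> enorm x <= M.
Local Notation h t := (support_fun K (cpt t)).

Lemma contact_normal_curve (a b : R) : normal_curve X a b.
Proof.
move=> s t _ _ _; rewrite !dotBr subr_ge0 subr_le0 !hX.
by split; exact: dot_le_support.
Qed.

Lemma support_cpt_lipschitz s t : `|h s - h t| <= M * `|s - t|.
Proof.
apply: le_trans (support_lipschitz _ _ cbK KM) _; rewrite ler_wpM2l ?chord_le//.
exact: le_trans (enorm_ge0 _) (KM (KX 0)).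
Qed.

Variable t : R.
Hypothesis face : forall x, K x -> dot (cpt t) x = h t -> x = X t.

(** By compactness, the points of the body away from the only contact point
    with the support line stay away from that line. *)
Lemma contact_continuous e : 0 < e -> exists2 r : R, 0 < r &
  forall s, `|s - t| < r -> enorm (X s - X t) < e.
Proof.
move=> e0; pose E := K `&` [set y | e <= enorm (y - X t)].
have [[y Ey]|E0] := pselect (E !=set0); last first.
  exists 1 => // s _; rewrite ltNge; apply/negP => es; apply: E0.
  by exists (X s); split.
have cE : compact E.
  apply: (@subclosed_compact _ _ K); [|by case: cbK|by move=> ? []].
  by apply: closedI; [exact: convex_body_closed|exact: closed_far].
have [||y0] := @compact_EVT_max _ _ (dot (cpt t)) E _ cE; first by exists y.
  by apply: continuous_subspaceT => ?; exact: dotl_continuous.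
rewrite inE => -[Ky0 ey0] y0max.
have M0 : 0 <= M by exact: le_trans (enorm_ge0 _) (KM (KX 0)).
pose d := h t - dot (cpt t) y0.
have d0 : 0 < d.
  rewrite subr_gt0 lt_neqAle dot_le_support// andbT; apply/eqP => yt.
  by move: ey0 => /=; rewrite (face Ky0 yt) subrr leNgt /enorm /dot /= !mulr0 addr0 sqrtr0 e0.
have M1 : 0 < 2 * M + 1 by lra.
exists (d / (2 * M + 1)); first by rewrite divr_gt0.
move=> s; rewrite ltr_pdivlMr// => st; rewrite ltNge; apply/negP => es.
have : X s \in E by rewrite inE; split.
move/y0max => le1.
have le2 : h s - dot (cpt t) (X s) <= M * `|s - t|.
  rewrite -hX -dotBl; apply: le_trans (dot_le_enorm _ _) _; rewrite mulrC.
  apply: ler_pM; rewrite ?enorm_ge0//; first exact: KM.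
  exact: chord_le.
have := support_cpt_lipschitz s t; rewrite ler_norml => /andP[le3 _].
have n0 := normr_ge0 (s - t).
move: d0 st le1 le2 le3 n0; rewrite /d.
move: (h t) (h s) (dot _ y0) (dot _ (X s)) `|s - t| => H H' A B N.
move=> d0 st le1 le2 le3 n0; lra.
Qed.

(** The support function lies above the support functions of its contact points,
    and the contact point moves continuously. *)
Lemma support_derive : is_derive t 1 (fun s => h s) (dot (ctan t) (X t)).
Proof.
have dc : is_derive t 1 (fun s => dot (cpt s) (X t)) (dot (ctan t) (X t)).
  by rewrite /dot /=; derive; ring.
apply/deriveP => e e0; have e2 : 0 < e / 2 by rewrite divr_gt0.
have [r1 r10 c1] := (deriveP _ _ _).1 dc _ e2.
have [r2 r20 c2] := contact_continuous e2.
exists (Num.min r1 r2); first by rewrite lt_min r10.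
move=> s; rewrite lt_min => /andP[/c1 d1 /c2 d2].
have l1 : dot (cpt s) (X t) <= h s by exact: dot_le_support.
have l2 : h s - dot (cpt s) (X t) <= e / 2 * `|s - t|.
  have : dot (cpt t) (X s) <= h t by exact: dot_le_support.
  rewrite -!hX => l3.
  apply: (@le_trans _ _ (dot (cpt s - cpt t) (X s - X t))).
    rewrite dotBl !dotBr; move: l3.
    move: (dot (cpt s) (X s)) (dot (cpt s) (X t)) (dot (cpt t) (X s)) => A B C.
    by move: (dot (cpt t) (X t)) => D; lra.
  apply: le_trans (dot_le_enorm _ _) _; rewrite mulrC.
  by apply: ler_pM; rewrite ?enorm_ge0 ?chord_le// ltW.
move: d1; rewrite hX; move: l1 l2.
move: (h s) (h t) (dot (cpt s) (X t)) => A B C l1 l2.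
move: (dot _ (X t) * _) `|s - t| l2 => D N l2.
rewrite !ler_norml => /andP[d1 d1']; apply/andP; split; lra.
Qed.

End Contact.

Section SolutionODE.
Context {R : realType}.
Local Notation plane := (R * R)%type.
Implicit Types (x y z u v : plane) (a b s t : R).

Lemma support_measurable (K : set plane) (q : R) : convex_body K ->
  measurable_fun S1 (fun u => support_fun K u `^ q).
Proof.
move=> cb; have [M M0 KM] := convex_body_bounded cb.
have M1 : 0 < M + 1 by rewrite ltr_wpDl.
apply: (@measurableT_comp _ _ _ _ _ _ (fun y : R => y `^ q)).
  exact: measurable_powR.
apply: circle_continuous_measurable => u _ e e0.
exists (e / (M + 1)); first by rewrite divr_gt0.
move=> v _; rewrite ltr_pdivlMr// => uv.
apply: le_lt_trans (support_lipschitz _ _ cb KM) _; apply: le_lt_trans uv.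
by rewrite mulrC ler_wpM2l ?enorm_ge0// lerDl.
Qed.

Variables (p eps : R) (f : plane -> R) (K : set plane).
Hypotheses (e1 : eps < 1) (fc : circle_continuous f).
Hypothesis (f1 : forall u, S1 u -> `|f u - 1| <= eps).
Hypothesis (solK : Lp_Minkowski_solution p f K).

Local Notation h t := (support_fun K (cpt t)).

Let cbK : convex_body K. Proof. by case: solK => -[]. Qed.
Let sK : smooth K. Proof. exact: (solution_smooth e1 fc f1 solK). Qed.
Local Notation mu := (surface_measure cbK sK).

Let mf C : measurable C -> C `<=` S1 -> measurable_fun C f.
Proof.
move=> _ CS; apply: measurable_funS (circle_continuous_measurable fc) => //.
exact: closed_plane_measurable S1_closed.
Qed.

Let mh C : C `<=` S1 -> measurable_fun C (fun u => support_fun K u `^ (1 - p)).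
Proof.
move=> CS; apply: measurable_funS (support_measurable _ cbK) => //.
exact: closed_plane_measurable S1_closed.
Qed.

(** An edge of the body would be an atom of the surface area measure. *)
Lemma solution_face t x y : 0 < h t -> K x -> K y ->
  dot (cpt t) x = h t -> dot (cpt t) y = h t -> x = y.
Proof.
move=> ht; pose g := dot (ctan t).
have E z : K z -> dot (cpt t) z = h t -> forall z', K z' -> dot (cpt t) z' = h t ->
    ~ g z < g z'.
  move=> Kz hz z' Kz' hz' gg.
  have mC : measurable [set cpt t].
    have -> : [set cpt t] = carc t t; last exact: carc_measurable.
    apply/seteqP; split => [_ ->|_ [a /= + <-]]; first by apply: carcP; rewrite lexx.
    by rewrite in_itv/= -eq_le => /eqP <-.
  have CS : [set cpt t] `<=` S1 by move=> _ ->; exact: cpt_S1.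
  have [_ /(_ _ mC CS) eq] := solK.
  have hp : 0 < h t `^ (1 - p) by exact: powR_gt0.
  have [|lb _] := @integral_bounds R mu [set cpt t] _ _ (h t `^ (1 - p)) mC (mh CS) (ltW hp).
    by move=> _ ->; rewrite lexx.
  have e10 : 0 <= 1 - eps by rewrite subr_ge0 ltW.
  have [|_ ub] := @integral_bounds R (@hausdorff1 R) [set cpt t] _ _ (1 + eps) mC (mf mC CS) e10.
    by move=> u /CS/f1; rewrite ler_distl.
  have : (0 < (h t `^ (1 - p))%:E * mu [set cpt t])%E.
    rewrite mule_gt0 ?lte_fin// /surface_measure surface_areaE//.
    apply: (@lt_le_trans _ _ (g z' - g z)%:E); first by rewrite lte_fin subr_gt0.
    apply: (@hausdorff1_ge_interval _ _ g _ _ (ltW gg)).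
      move=> u v _ _; rewrite -dotBr; apply: le_trans (normr_dot_le _ _) _.
      by rewrite enorm_ctan mul1r.
    move=> c /andP[c1 c2]; pose l := (c - g z) / (g z' - g z).
    have gz0 : 0 < g z' - g z by rewrite subr_gt0.
    have dl (w : plane) : dot w (z + l *: (z' - z)) = dot w z + l * (dot w z' - dot w z).
      by rewrite /dot /= /GRing.scale /=; ring.
    exists (z + l *: (z' - z)); last first.
      rewrite {1}/g dl -/(g z) -/(g z') /l divfK ?gt_eqF//.
      by rewrite addrC subrK.
    have Kl : K (z + l *: (z' - z)).
      apply: convex_body_segment => //; first by rewrite divr_ge0 ?subr_ge0// ltW.
      by rewrite ler_pdivrMr// mul1r lerD2r.
    split=> //; exists (cpt t) => //; apply/outer_normalP => //.
    by split; [exact: cpt_S1|rewrite dl hz hz' subrr mulr0 addr0].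
  rewrite ltNge => /negP; apply; apply: le_trans lb _.
  rewrite [leLHS](_ : _ = (\int[surface_area K]_(u in [set cpt t])
    (support_fun K u `^ (1 - p))%:E)%E)//.
  rewrite eq; apply: le_trans ub _.
  by rewrite [X in (_ * X)%E](hausdorff1_point (cpt t)) mule0.
move=> Kx Ky hx hy; apply: (@frame_eq _ t); first by rewrite hx hy.
by apply/le_anti; rewrite !leNgt; apply/andP; split; apply/negP; exact: E.
Qed.

Variables (X : R -> plane).
Hypotheses (KX : forall t, K (X t)) (hX : forall t, dot (cpt t) (X t) = h t).

Lemma arc_preimage s t : (forall a, s <= a <= t -> 0 < h a) ->
  normal_preimage K (carc s t) = [set X a | a in `[s, t]].
Proof.
move=> ha; apply/seteqP; split => x.
  move=> [Kx [_ [a /= ast <-] /(outer_normalP _ cbK Kx)[_ xa]]].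
  exists a => //; apply: (@solution_face a) => //.
  by apply: ha; move: ast; rewrite in_itv.
move=> [a /= ast <-]; split=> //; exists (cpt a).
  by apply: carcP; move: ast; rewrite in_itv.
by apply/outer_normalP => //; split; [exact: cpt_S1|exact: hX].
Qed.

(** The equation over the arc from [s] to [t], with the length of the boundary
    curve and of the arc replaced by the advance in the direction tangent at
    [s]. This determines the increment of the derivative of the support function
    up to second order terms. *)
Lemma arc_comparison s t c1 c2 m1 m2 : s <= t -> t - s < pi / 2 ->
  (forall a, s <= a <= t -> 0 < h a) ->
  (forall a, s <= a <= t -> c1 <= f (cpt a) <= c2) ->
  (forall a, s <= a <= t -> m1 <= h a `^ (1 - p) <= m2) ->
  0 <= c1 -> 0 <= m1 ->
  m1 * dot (ctan s) (X t - X s) <= c2 * (sin (t - s) / cos (t - s)) /\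
  c1 * sin (t - s) <= m2 * (dot (ctan s) (X t - X s) / cos (t - s)).
Proof.
move=> st ts ha fb hb c10 m10.
have mC := carc_measurable s t; have CS := @carc_S1 R s t.
have [M M0 KM] := convex_body_bounded cbK.
have [||X1 X2] := @normal_curve_length R X s t st ts.
- by apply: contact_normal_curve cbK KX hX _ _.
- move=> a ast; apply: (@continuous_comp _ _ _ X (dot (ctan s))); last first.
    exact: dotl_continuous.
  have Fa x : K x -> dot (cpt a) x = h a -> x = X a.
    by move=> Kx xa; exact: (@solution_face a) (ha a ast) Kx (KX a) xa (hX a).
  move=> A /enorm_nbhs[e e0 eA].
  have [r r0 rX] := contact_continuous cbK KX hX KM Fa e0.
  apply/nbhs_ballP; exists r => // b; rewrite /ball/= distrC => ba.
  by apply: eA; exact: rX.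
have [C1 C2] := carc_length st ts.
have fbC u : carc s t u -> c1 <= f u <= c2.
  by move=> [a /= ast <-]; apply: fb; move: ast; rewrite in_itv.
have hbC u : carc s t u -> m1 <= support_fun K u `^ (1 - p) <= m2.
  by move=> [a /= ast <-]; apply: hb; move: ast; rewrite in_itv.
have [F1 F2] := integral_bounds (@hausdorff1 R) mC (mf mC CS) c10 fbC.
have [S1 S2] := integral_bounds mu mC (mh CS) m10 hbC.
have SE : mu (carc s t) = hausdorff1 [set X a | a in `[s, t]].
  by rewrite /surface_measure surface_areaE// arc_preimage.
have [_ /(_ _ mC CS) eq] := solK.
have {}eq : (\int[mu]_(u in carc s t) (support_fun K u `^ (1 - p))%:E =
  \int[@hausdorff1 R]_(u in carc s t) (f u)%:E)%E := eq.
have ss : s <= s <= t by rewrite lexx.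
have c20 : 0 <= c2.
  by have /andP[fs1 fs2] := fb s ss; apply: le_trans c10 (le_trans fs1 fs2).
have m20 : 0 <= m2.
  by have /andP[hs1 hs2] := hb s ss; apply: le_trans m10 (le_trans hs1 hs2).
split; rewrite -lee_fin EFinM [leRHS]EFinM.
  apply: le_trans (lee_wpmul2l _ X1) _; first by rewrite lee_fin.
  rewrite -SE; apply: le_trans S1 _; rewrite eq; apply: le_trans F2 _.
  by apply: lee_wpmul2l => //; rewrite lee_fin.
apply: le_trans (lee_wpmul2l _ C1) _; first by rewrite lee_fin.
apply: le_trans F1 _; rewrite -eq; apply: le_trans S2 _; rewrite [X in (_ * X <= _)%E]SE.
by apply: lee_wpmul2l => //; rewrite lee_fin.
Qed.

End SolutionODE.

Section Curvature.
Context {R : realType}.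
Local Notation plane := (R * R)%type.
Implicit Types (x y z u v : plane) (a b s t : R).

Lemma trig_small (e : R) : 0 < e -> e <= 1 -> exists2 r : R, 0 < r &
  forall D, 0 <= D -> D < r -> [/\ D < pi / 2, (1 - e) * D <= sin D * cos D,
    sin D / cos D <= (1 + e) * D, 1 - cos D <= e * D & (1 - e) * D <= sin D <= D].
Proof.
move=> e0 e1; have pi2 := @pi_ge2 R.
exists (Num.min 1 (e / 2)); first by rewrite lt_min ltr01 divr_gt0.
move=> D D0; rewrite lt_min => /andP[D1 De].
have Dpi : D < pi / 2 by lra.
have k0 : 0 < cos D by apply: cos_gt0_pihalf; lra.
have kq := cos_ge_quad D; have k1 := cos_le1 D.
have sD : sin D <= D by exact: sin_le_id.
have Dk : D * cos D <= sin D.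
  have [->|Dn0] := eqVneq D 0; first by rewrite mul0r sin0.
  have Dp : 0 < D by rewrite lt_def Dn0.
  have [c /andP[c0 cD]] := mvt Dp (fun w _ => is_derive_sin w).
  rewrite sin0 !subr0 => ->; rewrite mulrC ler_wpM2r//.
  by apply: ltW; rewrite ltr_cos ?in_itv/=; lra.
have q : D * D <= e / 2 by apply: le_trans (ltW De); rewrite ler_piMr// ltW.
have q2 : D * D <= D by rewrite ler_piMr// ltW.
have q3 : D * D <= e * (2^-1 * D).
  by rewrite mulrA ler_wpM2r// ltW.
rewrite expr2 in kq; clear De pi2.
have sc : (1 - e) * D <= D * cos D * cos D.
  have -> : D * cos D * cos D = cos D * cos D * D by ring.
  rewrite ler_wpM2r//.
  have -> : cos D * cos D = 1 - 2 * (1 - cos D) + (1 - cos D) * (1 - cos D) by ring.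
  have : 0 <= (1 - cos D) * (1 - cos D) by rewrite -expr2 sqr_ge0.
  by move: (_ * _) => w w0; lra.
have sc2 : D * cos D * cos D <= sin D * cos D by rewrite ler_wpM2r// ltW.
have s0 : 0 <= sin D by apply: le_trans Dk; rewrite mulr_ge0// ltW.
split=> //.
- exact: le_trans sc sc2.
- rewrite ler_pdivrMr//; apply: le_trans sD _; rewrite mulrAC ler_peMl//.
  apply: (@le_trans _ _ ((1 + e) * (1 - e / 4))); last first.
    apply: ler_wpM2l; first by lra.
    by move: kq q; move: (D * D) (cos D) => w k; lra.
  have : e * e <= e by rewrite ler_piMr// ltW.
  by clear -e0; lra.
- have : 0 <= e * D by rewrite mulr_ge0// ltW.
  by move=> eD; clear -kq q3 eD; lra.
- rewrite sD andbT; apply: le_trans sc (le_trans sc2 _); rewrite ler_piMr//.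
Qed.

(** The second order inequalities behind the equation, with all error terms
    controlled by one constant. *)
Lemma curvature_step (e B H0 H M dt ds D k sn tn sc : R) : 0 <= e -> e <= 1 ->
  0 <= D -> e <= B -> 0 <= H -> H <= M -> `|H - H0| <= e -> `|dt| <= M ->
  (1 - e) * D <= sc -> tn <= (1 + e) * D -> 0 <= 1 - k -> 1 - k <= e * D ->
  (1 - e) * D <= sn -> sn <= D ->
  H * sn + dt * k - ds <= (B + e) * tn -> (B - e) * sc <= H * sn + dt * k - ds ->
  `|dt - ds - (B - H0) * D| <= (3 + B + 2 * M) * e * D.
Proof.
move=> e0 e1 D0 eB HP HM HH dM h1 h2 k0 h3 h4 h5 up lo.
have M0 : 0 <= M by exact: le_trans HM.
have u1 : (B + e) * tn <= (B + e) * ((1 + e) * D) by rewrite ler_wpM2l//; lra.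
have l1 : (B - e) * ((1 - e) * D) <= (B - e) * sc by rewrite ler_wpM2l//; lra.
have u2 : H * ((1 - e) * D) <= H * sn by rewrite ler_wpM2l.
have l2 : H * sn <= H * D by rewrite ler_wpM2l.
have d1 : `|dt * (1 - k)| <= M * (e * D).
  by rewrite normrM ler_pM// ger0_norm.
have hd : `|(H - H0) * D| <= e * D by rewrite normrM ler_pM// ger0_norm.
have he : H * (e * D) <= M * (e * D) by rewrite ler_wpM2r ?mulr_ge0.
have ee : e * e * D <= e * D by rewrite ler_wpM2r// ler_piMr.
move: d1 hd; rewrite !ler_norml => /andP[d1 d2] /andP[hd1 hd2].
have eD0 : 0 <= e * e * D by rewrite !mulr_ge0.
clear h1 h2 k0 h3 h4 h5 HH dM HM HP eB e0 e1 D0 M0.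
apply/andP; split; lra.
Qed.

End Curvature.

Section CircleSolution.
Context {R : realType}.
Local Notation plane := (R * R)%type.
Implicit Types (x y z u v : plane) (a b s t : R).

Variables (p eps : R) (f : plane -> R) (K : set plane).
Hypotheses (e1 : eps < 1) (fc : circle_continuous f).
Hypothesis (f1 : forall u, S1 u -> `|f u - 1| <= eps).
Hypothesis (solK : Lp_Minkowski_solution p f K).

Local Notation h t := (support_fun K (cpt t)).

Let cbK : convex_body K. Proof. by case: solK => -[]. Qed.

Variables (X : R -> plane).
Hypotheses (KX : forall t, K (X t)) (hX : forall t, dot (cpt t) (X t) = h t).

Lemma solution_derive t : 0 < h t ->
  is_derive t 1 (fun s => h s) (dot (ctan t) (X t)).
Proof.
move=> ht; have [M _ KM] := convex_body_bounded cbK.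
apply: (support_derive cbK KX hX KM) => x Kx xt.
exact: (solution_face e1 fc f1 solK ht Kx (KX t) xt (hX t)).
Qed.

Lemma support_continuous t : {for t, continuous (fun s => h s)}.
Proof.
have [M M0 KM] := convex_body_bounded cbK; apply/continuousP_eps => e e0.
have M1 : 0 < M + 1 by rewrite ltr_wpDl.
exists (e / (M + 1)); first by rewrite divr_gt0.
move=> s; rewrite ltr_pdivlMr// => st; apply: le_lt_trans st.
apply: le_trans (support_cpt_lipschitz cbK KX KM s t) _.
by rewrite mulrC ler_wpM2l// lerDl.
Qed.

(** Near [t] the functions [f] and [h^(1-p)] are almost constant, so that the
    advance of the contact point per angle is almost [f h^(p-1)]. *)
Lemma solution_derive2 t : 0 < h t -> is_derive t 1 (fun s => dot (ctan s) (X s))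
  (f (cpt t) * h t `^ (p - 1) - h t).
Proof.
move=> ht; have [M M0 KM] := convex_body_bounded cbK.
pose F0 := f (cpt t); pose g0 := h t `^ (1 - p).
have F0p : 0 < F0.
  have := f1 (cpt_S1 t); rewrite ler_distl => /andP[F1 _].
  by apply: lt_le_trans F1; rewrite subr_gt0.
have g0p : 0 < g0 by exact: powR_gt0.
pose B := F0 / g0; have B0 : 0 < B by rewrite divr_gt0.
have -> : f (cpt t) * h t `^ (p - 1) = B.
  by rewrite -(opprB 1 p) powRN.
have Bg : B * g0 = F0 by rewrite divfK// gt_eqF.
apply/deriveP => e e0; pose C := 3 + B + 2 * M.
have C0 : 0 < C by rewrite /C; lra.
pose d := Num.min (Num.min 1 B) (e / C).
have d0 : 0 < d by rewrite !lt_min ltr01 B0 divr_gt0.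
have d1 : d <= 1 by rewrite !ge_min lexx.
have dB : d <= B by rewrite !ge_min lexx orbT.
have dC : C * d <= e by rewrite mulrC -ler_pdivlMr// !ge_min lexx !orbT.
have D0 : 0 < 1 + B + d by lra.
pose q := d * g0 / (1 + B + d).
have q0 : 0 < q by rewrite divr_gt0// mulr_gt0.
have qE : q + q * B + q * d = d * g0.
  have : q * (1 + B + d) = d * g0 by rewrite divfK// gt_eqF.
  by rewrite !mulrDr mulr1.
have qd0 : 0 <= q * d by rewrite mulr_ge0// ltW.
have qB0 : 0 <= q * B by rewrite mulr_ge0// ltW.
have qg : q < g0.
  by rewrite ltr_pdivrMr// mulrC ltr_pM2l//; lra.
have [r1 r10 trig] := trig_small d0 d1.
have [r2 r20 fr] := (continuousP_eps _ _).1 (@circle_continuous_cpt _ _ fc t) q q0.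
have [r3 r30 gr] := (continuousP_eps _ _).1
  (@continuous_powR R (fun s => h s) (1 - p) t (@support_continuous t) ht) q q0.
have dh0 : 0 < Num.min d (h t) by rewrite lt_min d0.
have [r4 r40 hr] := (continuousP_eps _ _).1 (@support_continuous t) _ dh0.
pose r := Num.min (Num.min r1 r2) (Num.min r3 r4).
have rp : 0 < r by rewrite !lt_min r10 r20 r30.
exists r => //.
have dM a : `|dot (ctan a) (X a)| <= M.
  apply: le_trans (normr_dot_le _ _) _; rewrite enorm_ctan mul1r; exact: KM.
have key a b : a <= b -> `|a - t| < r -> `|b - t| < r -> b - a < r ->
    `|dot (ctan b) (X b) - dot (ctan a) (X a) - (B - h t) * (b - a)| <= C * d * (b - a).
  move=> ab ar br bar.
  have wr w : a <= w <= b -> `|w - t| < r.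
    move=> /andP[aw wb]; move: ar br; rewrite !ltr_norml => /andP[a1 _] /andP[_ b2].
    by clear -aw wb a1 b2; apply/andP; split; lra.
  have r1b : b - a < r1 by apply: lt_le_trans bar _; rewrite !ge_min lexx.
  have ba0 : 0 <= b - a by rewrite subr_ge0.
  have [bpi t1 t2 t3 /andP[t4 t5]] := trig (b - a) ba0 r1b.
  have fw w : a <= w <= b -> F0 - q <= f (cpt w) <= F0 + q.
    move=> /wr wt; rewrite -ler_distl; apply/ltW/fr.
    by apply: lt_le_trans wt _; rewrite !ge_min lexx orbT.
  have gw w : a <= w <= b -> g0 - q <= h w `^ (1 - p) <= g0 + q.
    move=> /wr wt; rewrite -ler_distl; apply/ltW/gr.
    by apply: lt_le_trans wt _; rewrite !ge_min lexx !orbT.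
  have hw w : a <= w <= b -> `|h w - h t| < Num.min d (h t).
    by move=> /wr wt; apply: hr; apply: lt_le_trans wt _; rewrite !ge_min lexx !orbT.
  have hp w : a <= w <= b -> 0 < h w.
    move=> /hw; rewrite lt_min => /andP[_]; rewrite ltr_distl subrr.
    by case/andP.
  have abb : a <= b <= b by rewrite ab lexx.
  have m10 : 0 < g0 - q by rewrite subr_gt0.
  have m20 : 0 < g0 + q by rewrite addr_gt0.
  have c1B : (B - d) * (g0 + q) <= F0 - q.
    have -> : (B - d) * (g0 + q) = B * g0 - d * g0 + q * B - q * d by ring.
    by rewrite Bg -qE; lra.
  have c2B : F0 + q <= (B + d) * (g0 - q).
    have -> : (B + d) * (g0 - q) = B * g0 + d * g0 - q * B - q * d by ring.
    by rewrite Bg -qE; lra.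
  have c10 : 0 <= F0 - q.
    by apply: le_trans c1B; rewrite mulr_ge0 ?subr_ge0// ltW.
  have k0 : 0 < cos (b - a).
    by apply: cos_gt0_pihalf; have := @pi_gt0 R; move=> ?; lra.
  have [up lo] := arc_comparison e1 fc f1 solK KX hX ab bpi hp fw gw c10 (ltW m10).
  have s0 : 0 <= sin (b - a).
    by apply: le_trans t4; rewrite mulr_ge0// subr_ge0.
  have eE : dot (ctan a) (X b - X a) =
      h b * sin (b - a) + dot (ctan b) (X b) * cos (b - a) - dot (ctan a) (X a).
    by rewrite dotBr (ctan_rot b a) hX -(opprB b a) cosN sinN; ring.
  have hb : `|h b - h t| <= d.
    by have := hw b abb; rewrite lt_min => /andP[/ltW].
  have hM : h b <= M.
    by rewrite -hX; apply: le_trans (dot_le_enorm _ _) _; rewrite enorm_cpt mul1r; exact: KM.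
  apply: (@curvature_step _ d B (h t) (h b) M _ _ (b - a) (cos (b - a))
    (sin (b - a)) (sin (b - a) / cos (b - a)) (sin (b - a) * cos (b - a))) => //.
  - exact: ltW.
  - exact/ltW/hp.
  - rewrite -eE -(ler_pM2l m10); apply: le_trans up _.
    by rewrite [leRHS]mulrA (mulrC (g0 - q)) ler_wpM2r// divr_ge0// ltW.
  - rewrite -eE mulrA -ler_pdivlMr// -(ler_pM2l m20); apply: le_trans lo.
    by rewrite [leLHS]mulrA (mulrC (g0 + q)) ler_wpM2r.
have tt : `|t - t| < r by rewrite subrr normr0.
move=> s st; have [ts|/ltW ts] := leP t s.
  have n0 : 0 <= s - t by rewrite subr_ge0.
  have H := key t s ts tt st; rewrite (ger0_norm n0) in st *.
  by apply: le_trans (H st) _; rewrite ler_wpM2r.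
have n0 : s - t <= 0 by rewrite subr_le0.
have H := key s t ts st tt; rewrite (ler0_norm n0) opprB in st *.
have -> : dot (ctan s) (X s) - dot (ctan t) (X t) - (B - h t) * (s - t) =
  - (dot (ctan t) (X t) - dot (ctan s) (X s) - (B - h t) * (t - s)) by ring.
by rewrite normrN; apply: le_trans (H st) _; rewrite ler_wpM2r// subr_ge0.
Qed.

(** Zeros of the support function are normals at the origin, and there is only
    one of them. *)
Lemma solution_circle_solution : circle_solution p eps (f \o cpt) (fun t => h t)
  (fun t => dot (ctan t) (X t)).
Proof.
have K0 : K 0 by case: solK => -[].
have d0 u : dot u 0 = 0 :> R by rewrite /dot /= !mulr0 addr0.
split.
- by move=> t; have := dot_le_support (cpt t) cbK K0; rewrite d0.
- by move=> t; rewrite cpt_per.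
- exact: support_continuous.
- move=> C hC s t; apply: (support_cpt_lipschitz cbK KX) => x Kx.
  exact: enorm_le_support hC Kx.
- move=> a b ha hb ab; rewrite leNgt; apply/negP => ba.
  apply: (cpt_inj ab ba); apply: (solution_smooth e1 fc f1 solK K0).
    by apply/outer_normalP => //; split; [exact: cpt_S1|rewrite ha d0].
  by apply/outer_normalP => //; split; [exact: cpt_S1|rewrite hb d0].
- exact: solution_derive.
- exact: solution_derive2.
- by move=> t; apply: f1; exact: cpt_S1.
Qed.

End CircleSolution.

(** * Solutions of the differential equation solve the Minkowski problem *)

Section WulffShape.
Context {R : realType}.
Local Notation plane := (R * R)%type.
Implicit Types (x y z u v : plane) (a b s t : R).

Variables (h dh r : R -> R) (m M : R).
Hypotheses (hd : forall t, is_derive t 1 h (dh t))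
  (hdd : forall t, is_derive t 1 dh (r t - h t))
  (r_gt0 : forall t, 0 < r t) (h_per : forall t, h (t + 2 * pi) = h t)
  (m_gt0 : 0 < m) (h_bnd : forall t, m <= h t <= M).

(** The boundary point with normal [cpt t] of the body with support function
    [h]. *)
Definition contact t : plane := h t *: cpt t + dh t *: ctan t.

Lemma contact_cpt s t : dot (cpt s) (contact t) = h t * cos (t - s) - dh t * sin (t - s).
Proof. by rewrite /contact /dot /= /GRing.scale /= cosB sinB; ring. Qed.

Lemma contact_ctan s t : dot (ctan s) (contact t) = h t * sin (t - s) + dh t * cos (t - s).
Proof. by rewrite /contact /dot /= /GRing.scale /= cosB sinB; ring. Qed.

Lemma contact_cpt_id t : dot (cpt t) (contact t) = h t.
Proof. by rewrite contact_cpt subrr cos0 sin0 mulr1 mulr0 subr0. Qed.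

Lemma contact_per t : contact (t + 2 * pi) = contact t.
Proof. by rewrite /contact h_per (derive_periodic hd h_per) cpt_per ctan_per. Qed.

Lemma contact_derive s t :
  is_derive t 1 (fun w => dot (ctan s) (contact w)) (r t * cos (t - s)).
Proof.
have -> : (fun w => dot (ctan s) (contact w)) =
    (fun w => h w * sin (w - s) + dh w * cos (w - s)).
  by apply/funext => w; exact: contact_ctan.
have := hd t; have := hdd t => *; derive; ring.
Qed.

(** The positivity of the radius of curvature gives the convexity. *)
Lemma contact_lt s t : s < t -> t < s + 2 * pi -> dot (cpt s) (contact t) < h s.
Proof.
move=> st ts; have pi0 := @pi_gt0 R.
pose F w := h w * cos (w - s) - dh w * sin (w - s).
have dF (w : R) : is_derive w 1 F (- (r w * sin (w - s))).
  by have := hd w; have := hdd w => *; rewrite /F; derive; ring.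
rewrite contact_cpt -/(F t).
have [tpi|/ltW tpi] := leP t (s + pi).
  have [c /andP[sc ct] e] := mvt st (fun w _ => dF w).
  have -> : h s = F s by rewrite /F subrr cos0 sin0 mulr1 mulr0 subr0.
  rewrite -subr_lt0 e mulNr oppr_lt0 mulr_gt0 ?subr_gt0// mulr_gt0//.
  by apply: sin_gt0_pi; lra.
have [c /andP[tc cs] e] := mvt ts (fun w _ => dF w).
have -> : h s = F (s + 2 * pi).
  have e2 : 2 * pi = pi *+ 2 :> R by rewrite mulr2n; ring.
  by rewrite /F addrAC subrr add0r e2 cos2pi sin2pi mulr1 mulr0 subr0 -e2 h_per.
rewrite -subr_gt0 e mulr_gt0 ?subr_gt0// -mulrN mulr_gt0//.
have -> : c - s = c - s - pi + pi by rewrite subrK.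
by rewrite sinDpi opprK; apply: sin_gt0_pi; lra.
Qed.

Lemma shift_angle s t : exists2 t', s <= t' < s + 2 * pi &
  contact t' = contact t /\ cpt t' = cpt t.
Proof.
have [k /andP[k1 k2]] := reduce_angle (t - s).
exists (t + 2 * pi * k%:~R); first by apply/andP; split; lra.
by rewrite (periodic_int contact_per) (periodic_int (@cpt_per R)).
Qed.

Lemma contact_le s t : dot (cpt s) (contact t) <= h s.
Proof.
have [t' /andP[st' t's] [<- _]] := shift_angle s t.
move: st'; rewrite le_eqVlt => /predU1P[<-|st']; first by rewrite contact_cpt_id.
by apply: ltW; exact: contact_lt.
Qed.

Definition wulff : set plane := [set x | forall t, dot (cpt t) x <= h t].

Lemma wulff_contact t : wulff (contact t).
Proof. by move=> s; exact: contact_le. Qed.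

Lemma wulff_convex_body : convex_body wulff.
Proof.
split.
- apply: (@subclosed_compact _ _ (`[- M, M]%classic `*` `[- M, M]%classic)).
  + have -> : wulff = \bigcap_(t in setT) (dot (cpt t) @^-1` [set w | w <= h t]).
      by apply/seteqP; split => [x H t _|x H t]; [exact: H|exact: (H t I)].
    apply: closed_bigI => t _; apply: closed_comp; last exact: closed_le.
    by move=> x _; exact: dotl_continuous.
  + by apply: compact_setX; exact: segment_compact.
  move=> x wx; have hM t : dot (cpt t) x <= M.
    by apply: le_trans (wx t) _; have /andP[] := h_bnd t.
  have := hM 0; have := hM pi; have := hM (pi / 2); have := hM (- (pi / 2)).
  rewrite /dot /= cosN sinN cos_pihalf sin_pihalf cospi sinpi cos0 sin0.
  rewrite !mul0r !mulN1r !mul1r !addr0 !add0r => x1 x2 x3 x4.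
  by split; rewrite /= in_itv/=; apply/andP; split; lra.
- move=> x y l; rewrite !inE => wx wy t.
  rewrite [leLHS](_ : _ = l%:num * dot (cpt t) x + (1 - l%:num) * dot (cpt t) y).
    have l0 : 0 <= l%:num by []. have l1 : 0 <= 1 - l%:num by rewrite subr_ge0.
    have -> : h t = l%:num * h t + (1 - l%:num) * h t by ring.
    by apply: lerD; apply: ler_wpM2l => //.
  by rewrite /dot /conv /= /GRing.scale /= /unstable.onem; ring.
- exists 0; apply: filterS (nbhs_enorm 0 m_gt0) => x /=; rewrite subr0 => xm t.
  apply: le_trans (dot_le_enorm _ _) _; rewrite enorm_cpt mul1r.
  by apply: le_trans (ltW xm) _; have /andP[] := h_bnd t.
Qed.

Lemma wulff0 : wulff 0.
Proof.
move=> t; rewrite /dot /= !mulr0 addr0; have /andP[+ _] := h_bnd t.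
by apply: le_trans; exact: ltW.
Qed.

Lemma support_wulff t : support_fun wulff (cpt t) = h t.
Proof.
have cb := wulff_convex_body; apply/le_anti/andP; split.
  by have [x Kx [<- _]] := support_attained (cpt t) cb; exact: Kx.
by rewrite -contact_cpt_id; apply: dot_le_support => //; exact: wulff_contact.
Qed.

(** The difference between the support value and [dot (cpt s) x] has a minimum at
    [t], so its derivative vanishes, which gives the tangential coordinate. *)
Lemma wulff_face x t : wulff x -> dot (cpt t) x = h t -> x = contact t.
Proof.
move=> wx xt; apply: (@frame_eq _ t); first by rewrite contact_cpt_id.
rewrite contact_ctan subrr sin0 cos0 mulr0 mulr1 add0r.
pose D s := h s - dot (cpt s) x.
have hx (w : R) : is_derive w 1 D (dh w - dot (ctan w) x).
  by rewrite /D /dot /=; have := hd w => *; derive; ring.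
apply/esym/eqP; rewrite -subr_eq0; apply/eqP; apply: (derive_uniq (hx t)).
apply: (@derive1_at_min _ D (t - 1) (t + 1)) => //.
- lra.
- by rewrite in_itv/=; lra.
- by move=> w _; rewrite /D xt subrr subr_ge0; exact: wx.
Qed.

Lemma wulff_smooth : smooth wulff.
Proof.
have cb := wulff_convex_body.
move=> x u v Kx nu nv.
have [s /andP[s0 s1] us] := S1_cpt nu.1; have [t /andP[t0 t1] vt] := S1_cpt nv.1.
rewrite us vt in nu nv *.
wlog st : s t {us vt} s0 s1 t0 t1 nu nv / s < t => [hw|].
  have [st|ts|->//] := ltgtP s t; first exact: hw.
  by apply/esym; apply: hw.
have [_] := (outer_normalP _ cb Kx).1 nu; have [_] := (outer_normalP _ cb Kx).1 nv.
rewrite !support_wulff => /(wulff_face Kx) -> e.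
by have := @contact_lt s t st; rewrite e ltxx => H; exfalso; have : false by apply: H; lra.
Qed.

Lemma wulff_preimage (A : set plane) x : A `<=` S1 ->
  normal_preimage wulff A x <-> exists2 t, A (cpt t) & x = contact t.
Proof.
have cb := wulff_convex_body; move=> AS; split.
  move=> [Kx [u Au /(outer_normalP _ cb Kx)[/S1_cpt[t _ ut] xu]]]; exists t; rewrite -?ut//.
  by apply: wulff_face => //; rewrite -support_wulff -ut.
move=> [t At ->]; split; first exact: wulff_contact.
exists (cpt t) => //; apply/(outer_normalP _ cb (@wulff_contact t)).
by split; [exact: AS|rewrite support_wulff contact_cpt_id].
Qed.

End WulffShape.

Section WulffSolution.
Context {R : realType}.
Local Notation plane := (R * R)%type.
Implicit Types (x y z u v : plane) (a b s t l D : R).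

Lemma sin_chord a s t D : D < pi / 2 -> a <= s -> s <= t -> t <= a + D ->
  cos D * (t - s) <= enorm (cpt t - cpt s).
Proof.
move=> Dpi as_ st ta; have pi0 := @pi_gt0 R.
apply: le_trans (_ : dot (ctan a) (cpt t - cpt s) <= _); last first.
  by apply: le_trans (dot_le_enorm _ _) _; rewrite enorm_ctan mul1r.
rewrite dotBr !dot_ctan_cpt.
move: st; rewrite le_eqVlt => /predU1P[->|st]; first by rewrite !subrr mulr0.
have [|c /andP[sc ct] ->] := @mvt R (fun w => sin (w - a)) (fun w => cos (w - a)) s t st.
  by move=> w _; derive; ring.
rewrite ler_wpM2r ?subr_ge0 ?(ltW st)//.
have [->|n] := eqVneq (c - a) D; first exact: lexx.
by apply: ltW; rewrite ltr_cos ?in_itv/=; lra.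
Qed.

Lemma powR_ratio (q l x y : R) : 0 <= q -> q <= 1 -> 1 <= l -> 0 < x -> 0 < y ->
  x <= l * y -> x `^ q <= l * y `^ q.
Proof.
move=> q0 q1 l1 x0 y0 xy; have l0 : 0 <= l by apply: le_trans l1.
apply: le_trans (ler_powR_pos q0 (ltW x0) xy) _.
rewrite powRM//; last exact: ltW.
rewrite ler_wpM2r ?powR_ge0// -[leRHS]powRr1//.
exact: ler_powR.
Qed.

Variables (p : R) (f : plane -> R) (h dh : R -> R) (m M : R).
Hypotheses (p0 : 0 < p) (p1 : p < 1).
Hypotheses (hd : forall t, is_derive t 1 h (dh t))
  (hdd : forall t, is_derive t 1 dh (f (cpt t) * h t `^ (p - 1) - h t))
  (h_per : forall t, h (t + 2 * pi) = h t)
  (m_gt0 : 0 < m) (h_bnd : forall t, m <= h t <= M).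
Hypotheses (fc : circle_continuous f) (f_lo : forall u, S1 u -> m <= f u).
Hypothesis (f_unif : forall e, 0 < e -> exists2 r, 0 < r &
  forall s t, `|s - t| <= r -> `|f (cpt s) - f (cpt t)| <= e).

Let g t := h t `^ (1 - p).
Let r t := f (cpt t) * h t `^ (p - 1).
Local Notation K := (wulff h).
Local Notation X := (contact h dh).

Let h0 t : 0 < h t.
Proof. by have /andP[+ _] := h_bnd t; exact: lt_le_trans. Qed.

Let f0 t : 0 < f (cpt t).
Proof. by apply: lt_le_trans (f_lo (cpt_S1 t)). Qed.

Let g0 t : 0 < g t. Proof. exact: powR_gt0. Qed.

Let rE t : r t = f (cpt t) / g t.
Proof. by rewrite /r /g -powRN opprB. Qed.

Let r0 t : 0 < r t. Proof. by rewrite rE divr_gt0. Qed.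

Let cbK : convex_body K. Proof. exact: (wulff_convex_body m_gt0 h_bnd). Qed.
Let sK : smooth K.
Proof. exact: (wulff_smooth hd hdd r0 h_per m_gt0 h_bnd). Qed.
Let hK t : support_fun K (cpt t) = h t.
Proof. exact: (support_wulff hd hdd r0 h_per m_gt0 h_bnd). Qed.
Let mu := surface_measure cbK sK.

Lemma short_arc l : 1 < l -> l <= 2 -> exists D, [/\ 0 < D, D < pi / 2, 1 <= l * cos D &
  forall s t, `|s - t| <= D -> [/\ f (cpt s) <= l * f (cpt t), g s <= l * g t &
    r s <= l ^+ 2 * r t]].
Proof.
move=> l1 l2; have pi2 := @pi_ge2 R.
have l10 : 0 < l - 1 by rewrite subr_gt0.
have e0 : 0 < (l - 1) * m by rewrite mulr_gt0.
have [r1 r10 fr] := f_unif e0.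
have [C C0 KC] := convex_body_bounded cbK.
have C1 : 0 < C + 1 by rewrite ltr_wpDl.
pose D := Num.min (Num.min r1 (l - 1)) (Num.min (1/2) ((l - 1) * m / (C + 1))).
have D0 : 0 < D by rewrite !lt_min r10 l10 !divr_gt0.
have D1 : D <= 1 / 2 by rewrite !ge_min lexx !orbT.
have Dl : D <= l - 1 by rewrite !ge_min lexx !orbT.
have Dr : D <= r1 by rewrite !ge_min lexx.
have DC : D * (C + 1) <= (l - 1) * m by rewrite -ler_pdivlMr// !ge_min lexx !orbT.
have l0 : 0 <= l by apply: ltW; apply: lt_trans l1.
have near_ratio s t : `|s - t| <= D -> f (cpt s) <= l * f (cpt t) /\ g s <= l * g t.
  move=> st; split.
    have := fr s t (le_trans st Dr); rewrite ler_norml => /andP[_].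
    have : (l - 1) * m <= (l - 1) * f (cpt t).
      by rewrite ler_wpM2l ?f_lo ?ltW//; exact: cpt_S1.
    by rewrite [(l - 1) * f _]mulrBl mul1r; move: (l * f _) ((l - 1) * m) => *; lra.
  apply: powR_ratio => //; [by rewrite subr_ge0 ltW|by rewrite gerBl ltW|exact: ltW|].
  have hl : `|h s - h t| <= C * `|s - t|.
    have := support_cpt_lipschitz cbK (wulff_contact hd hdd r0 h_per) KC s t.
    by rewrite !hK.
  have hl2 : C * `|s - t| <= (l - 1) * m.
    by apply: le_trans DC; rewrite mulrC; apply: ler_pM => //; rewrite ?lerDl.
  have : (l - 1) * m <= (l - 1) * h t.
    by apply: ler_wpM2l; [exact: ltW|have /andP[] := h_bnd t].
  move: hl; rewrite ler_norml => /andP[_].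
  by rewrite [(l - 1) * h t]mulrBl mul1r; move: hl2; move: (l * h t) ((l - 1) * m) (C * _) => *; lra.
exists D; split=> //; first lra.
  have cD := cos_ge_quad D.
  have D2 : D ^+ 2 <= (l - 1) / 2 by rewrite expr2; have := ler_pM (ltW D0) (ltW D0) Dl D1; lra.
  apply: (@le_trans _ _ (l * (1 - D ^+ 2 / 2))); last by rewrite ler_wpM2l.
  apply: (@le_trans _ _ (l * (1 - (l - 1) / 2 / 2))); last by rewrite ler_wpM2l//; lra.
  by nra.
move=> s t st; have [fst gst] := near_ratio s t st.
have ts : `|t - s| <= D by rewrite distrC.
have [_ gts] := near_ratio t s ts.
split=> //; rewrite !rE.
have gi : (g s)^-1 <= l / g t.
  by rewrite ler_pdivlMr// mulrC ler_pdivrMr.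
have -> : l ^+ 2 * (f (cpt t) / g t) = l * f (cpt t) * (l / g t) by ring.
by apply: ler_pM => //; rewrite ?invr_ge0 ltW.
Qed.

Section ShortArc.
Variables (l D a : R) (A : set plane).
Hypotheses (l1 : 1 < l) (D0 : 0 < D) (Dpi : D < pi / 2) (lD : 1 <= l * cos D).
Hypothesis ratio : forall s t, `|s - t| <= D -> [/\ f (cpt s) <= l * f (cpt t),
  g s <= l * g t & r s <= l ^+ 2 * r t].
Hypotheses (mA : measurable A) (AD : A `<=` carc a (a + D)).

Let l0 : 0 < l. Proof. exact: lt_trans l1. Qed.
Let cD : 0 < cos D. Proof. by have := lt_le_trans ltr01 lD; rewrite pmulr_rgt0. Qed.
Let AS : A `<=` S1. Proof. by apply: subset_trans AD _; exact: carc_S1. Qed.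

Let preimage_arc x : normal_preimage K A x -> exists2 t, a <= t <= a + D &
  x = X t /\ A (cpt t).
Proof.
move=> [Kx [u Au /(outer_normalP _ cbK Kx)[_ xu]]].
have [t /=] := AD Au; rewrite in_itv/= => tD tu; exists t => //; split; last by rewrite tu.
by apply: (wulff_face hd) => //; rewrite tu xu -tu hK.
Qed.

Let in_preimage t : A (cpt t) -> normal_preimage K A (X t).
Proof. by move=> At; apply/(wulff_preimage hd hdd r0 h_per m_gt0 h_bnd _ AS); exists t. Qed.

Let progress s t : a <= s -> s < t -> t <= a + D -> exists2 c, a <= c <= a + D &
  dot (ctan a) (X t - X s) = r c * cos (c - a) * (t - s).
Proof.
move=> as_ st ta; rewrite dotBr.
have [c /andP[sc ct] ->] := mvt st (fun w _ => contact_derive hd hdd a w).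
by exists c => //; apply/andP; split; lra.
Qed.

Let cosb c : a <= c <= a + D -> cos D <= cos (c - a) <= 1.
Proof.
move=> /andP[ac ca]; rewrite cos_le1 andbT; have pi0 := @pi_gt0 R.
have DD := Dpi.
have [->|n] := eqVneq (c - a) D; first exact: lexx.
by apply: ltW; rewrite ltr_cos ?in_itv/=; lra.
Qed.

Let chord_upper s t : a <= s -> s <= t -> t <= a + D ->
  enorm (X t - X s) <= l ^+ 4 * r a * enorm (cpt t - cpt s).
Proof.
move=> as_ st ta.
have N : normal_curve X a (a + D).
  apply: (contact_normal_curve cbK) => w; first exact: (wulff_contact hd hdd r0 h_per).
  by rewrite hK contact_cpt_id.
have c1 : cos D * enorm (X t - X s) <= dot (ctan a) (X t - X s).
  by have := normal_curve_chord N _ as_ st ta; rewrite addrAC subrr add0r; exact.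
move: st; rewrite le_eqVlt => /predU1P[->|st].
  by rewrite !subrr /enorm /dot /= !mulr0 addr0 sqrtr0 mulr0.
have c2 := sin_chord Dpi as_ (ltW st) ta.
have [c cD' e] := progress as_ st ta; rewrite e in c1.
have /andP[k1 k2] := cosb cD'.
have [_ _ rc] : [/\ f (cpt c) <= l * f (cpt a), g c <= l * g a & r c <= l ^+ 2 * r a].
  by apply: ratio; have /andP[ac ca] := cD'; rewrite ger0_norm; lra.
have ts : 0 <= t - s by rewrite subr_ge0 ltW.
have one (w z : R) : cos D * w <= z -> 0 <= z -> w <= l * z.
  move=> wz z0; have [w0|w0] := leP w 0.
    by apply: le_trans w0 _; rewrite mulr_ge0// ltW.
  apply: (@le_trans _ _ (l * cos D * w)); first by rewrite ler_peMl// ltW.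
  by rewrite -mulrA ler_wpM2l// ltW.
have rk : r c * cos (c - a) * (t - s) <= l ^+ 2 * r a * (t - s).
  rewrite ler_wpM2r//; apply: le_trans rc; rewrite ler_piMr// ltW//; exact: r0.
have ra : 0 <= l ^+ 2 * r a by rewrite mulr_ge0 ?exprn_ge0// ltW.
apply: le_trans (one _ _ (le_trans c1 rk) _) _; first exact: mulr_ge0.
have -> : l ^+ 4 * r a * enorm (cpt t - cpt s) =
  l * (l ^+ 2 * r a) * (l * enorm (cpt t - cpt s)) by ring.
rewrite mulrA ler_wpM2l//; first by rewrite mulr_ge0// ltW.
by apply: one => //; exact: enorm_ge0.
Qed.

Let chord_lower s t : a <= s -> s <= t -> t <= a + D ->
  enorm (cpt t - cpt s) <= l ^+ 3 / r a * enorm (X t - X s).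
Proof.
move=> as_ st ta.
move: st; rewrite le_eqVlt => /predU1P[->|st].
  by rewrite !subrr /enorm /dot /= !mulr0 addr0 sqrtr0 mulr0.
have ts : 0 <= t - s by rewrite subr_ge0 ltW.
have c0 : enorm (cpt t - cpt s) <= t - s.
  by apply: le_trans (chord_le _ _) _; rewrite ger0_norm.
apply: le_trans c0 _.
have c1 : dot (ctan a) (X t - X s) <= enorm (X t - X s).
  by apply: le_trans (dot_le_enorm _ _) _; rewrite enorm_ctan mul1r.
have [c cD' e] := progress as_ st ta; rewrite e in c1.
have /andP[k1 k2] := cosb cD'.
have [_ _ rc] : [/\ f (cpt a) <= l * f (cpt c), g a <= l * g c & r a <= l ^+ 2 * r c].
  by apply: ratio; have /andP[ac ca] := cD'; rewrite distrC ger0_norm; lra.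
have l3 : 0 <= l ^+ 3 / r a by rewrite divr_ge0 ?exprn_ge0// ltW// r0.
apply: le_trans (_ : l ^+ 3 / r a * (r c * cos (c - a) * (t - s)) <= _); last exact: ler_wpM2l.
rewrite mulrA ler_peMl//.
have -> : l ^+ 3 / r a * (r c * cos (c - a)) = (l ^+ 2 * r c) / r a * (l * cos (c - a)) by ring.
rewrite -[leLHS]mulr1; apply: ler_pM => //.
  by rewrite ler_pdivlMr ?mul1r// r0.
by apply: le_trans lD _; rewrite ler_wpM2l// ltW.
Qed.

Let rel x y := exists2 t, a <= t <= a + D & x = cpt t /\ y = X t.

(** From angles to contact points, the map expands distances by at most the
    radius of curvature, up to the variation over the arc. *)
Lemma short_arc_area : (mu A <= (l ^+ 4 * r a)%:E * hausdorff1 A)%E.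
Proof.
rewrite /mu /surface_measure surface_areaE//.
apply: (@hausdorff1_lipschitz _ A _ rel).
- by rewrite mulr_gt0 ?exprn_gt0 ?r0.
- by move=> x /preimage_arc[t tD [-> At]]; exists (cpt t) => //; exists t.
move=> _ _ _ _ _ _ _ _ [s /andP[s1 s2] [-> ->]] [t /andP[t1 t2] [-> ->]].
have [st|/ltW ts] := leP s t; last exact: chord_upper.
by rewrite enormC [enorm (cpt s - _)]enormC; exact: chord_upper.
Qed.

(** The inverse map expands by at most the inverse of the radius of curvature. *)
Lemma short_arc_length : (hausdorff1 A <= (l ^+ 3 / r a)%:E * mu A)%E.
Proof.
rewrite /mu /surface_measure surface_areaE//.
apply: (@hausdorff1_lipschitz _ _ A (fun y x => rel x y)).
- by rewrite divr_gt0 ?exprn_gt0 ?r0.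
- move=> x Ax; have [t /=] := AD Ax; rewrite in_itv/= => tD tx.
  by exists (X t); [apply: in_preimage; rewrite tx|exists t].
move=> _ _ _ _ _ _ _ _ [s /andP[s1 s2] [-> ->]] [t /andP[t1 t2] [-> ->]].
have [st|/ltW ts] := leP s t; last exact: chord_lower.
by rewrite enormC [enorm (X s - _)]enormC; exact: chord_lower.
Qed.

Let bnd u : A u -> (f (cpt a) / l <= f u <= l * f (cpt a)) /\
  (g a / l <= support_fun K u `^ (1 - p) <= l * g a).
Proof.
move=> /AD[t /=]; rewrite in_itv/= => /andP[at_ ta] <-; rewrite hK -/(g t).
have d1 : `|t - a| <= D by rewrite ger0_norm; lra.
have d2 : `|a - t| <= D by rewrite distrC.
have [F1 G1 _] := ratio d1; have [F2 G2 _] := ratio d2.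
by rewrite !ler_pdivrMr// ![_ * l]mulrC F1 G1 F2 G2.
Qed.

Let mf : measurable_fun A f.
Proof.
apply: measurable_funS (circle_continuous_measurable fc) => //.
exact: closed_plane_measurable S1_closed.
Qed.

Let mh : measurable_fun A (fun u => support_fun K u `^ (1 - p)).
Proof.
apply: measurable_funS (support_measurable _ cbK) => //.
exact: closed_plane_measurable S1_closed.
Qed.

Let fl0 : 0 <= f (cpt a) / l. Proof. by rewrite divr_ge0// ltW. Qed.
Let gl0 : 0 <= g a / l. Proof. by rewrite divr_ge0// ltW. Qed.
Let ln0 : l != 0. Proof. by rewrite gt_eqF. Qed.
Let gn0 : g a != 0. Proof. by rewrite gt_eqF. Qed.
Let fn0 : f (cpt a) != 0. Proof. by rewrite gt_eqF. Qed.

Lemma short_arc_le :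
  (\int[mu]_(u in A) (support_fun K u `^ (1 - p))%:E <=
   (l ^+ 6)%:E * \int[@hausdorff1 R]_(u in A) (f u)%:E)%E.
Proof.
have [F1 _] := integral_bounds (@hausdorff1 R) mA mf fl0 (fun u Au => (bnd Au).1).
have [_ G2] := integral_bounds mu mA mh gl0 (fun u Au => (bnd Au).2).
apply: le_trans G2 _.
apply: le_trans (lee_wpmul2l _ short_arc_area) _; first by rewrite lee_fin mulr_ge0// ltW.
apply: le_trans (lee_wpmul2l _ F1); last by rewrite lee_fin exprn_ge0// ltW.
rewrite !muleA -!EFinM rE.
have -> // : l * g a * (l ^+ 4 * (f (cpt a) / g a)) = l ^+ 6 * (f (cpt a) / l).
by field; rewrite ln0 gn0.
Qed.

Lemma short_arc_ge :
  (\int[@hausdorff1 R]_(u in A) (f u)%:E <=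
   (l ^+ 6)%:E * \int[mu]_(u in A) (support_fun K u `^ (1 - p))%:E)%E.
Proof.
have [_ F2] := integral_bounds (@hausdorff1 R) mA mf fl0 (fun u Au => (bnd Au).1).
have [G1 _] := integral_bounds mu mA mh gl0 (fun u Au => (bnd Au).2).
apply: le_trans F2 _.
apply: le_trans (lee_wpmul2l _ short_arc_length) _; first by rewrite lee_fin mulr_ge0// ltW.
apply: le_trans (lee_wpmul2l _ G1); last by rewrite lee_fin exprn_ge0// ltW.
rewrite !muleA -!EFinM rE; apply: lee_wpmul2r; first exact: measure_ge0.
rewrite lee_fin.
have -> : l * f (cpt a) * (l ^+ 3 / (f (cpt a) / g a)) = l ^+ 4 * g a.
  by field; rewrite fn0 gn0.
have -> : l ^+ 6 * (g a / l) = l * (l ^+ 4 * g a) by field; rewrite ln0.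
by rewrite ler_peMl ?(ltW l1)// mulr_ge0 ?exprn_ge0// ltW.
Qed.

End ShortArc.

(** Both measures have comparable values on the subsets of short arcs, with a
    factor that tends to 1 with the length of the arcs. *)
Lemma wulff_solution : Lp_Minkowski_solution p f K.
Proof.
split; first by split; [exact: cbK|exact: (wulff0 m_gt0 h_bnd)].
move=> A mA AS.
have mS : measurable (S1 : set plane) by exact: closed_plane_measurable S1_closed.
have mf : measurable_fun S1 f by exact: circle_continuous_measurable.
have mh : measurable_fun S1 (fun u => support_fun K u `^ (1 - p)).
  exact: support_measurable.
have fp u : S1 u -> 0 <= f u by move=> /f_lo; apply: le_trans; exact: ltW.
have hp u : S1 u -> 0 <= support_fun K u `^ (1 - p) by move=> _; exact: powR_ge0.
rewrite -[X in integral X]/(mu : set plane -> \bar R).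
apply/le_anti/andP; split; apply: lee_mul_squeeze => [|l l1 l2].
- by apply: integral_ge0 => u Au; rewrite lee_fin; apply: fp; exact: AS.
- have [D [D0 Dpi lD ratio]] := short_arc l1 l2.
  apply: (arcwise_le D0 _ mh mf hp fp) => //.
    by apply: exprn_ge0; apply: ltW; apply: lt_trans l1.
  by move=> a B mB BD; exact: (short_arc_le l1 Dpi lD ratio mB BD).
- by apply: integral_ge0 => u Au; rewrite lee_fin; apply: hp; exact: AS.
- have [D [D0 Dpi lD ratio]] := short_arc l1 l2.
  apply: (arcwise_le D0 _ mf mh fp hp) => //.
    by apply: exprn_ge0; apply: ltW; apply: lt_trans l1.
  by move=> a B mB BD; exact: (short_arc_ge l1 Dpi lD ratio mB BD).
Qed.

End WulffSolution.

(** * Determination by the support function, and regularity *)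

Section Determination.
Context {R : realType}.
Local Notation plane := (R * R)%type.
Implicit Types (K : set plane) (x y z u v : plane) (s t : R).

Lemma polar x : 0 < enorm x -> exists t, x = enorm x *: cpt t.
Proof.
move=> xp; have du y : dot ((enorm x)^-1 *: x) y = (enorm x)^-1 * dot x y.
  by rewrite /dot /= /GRing.scale /=; ring.
have [|t _ xt] := @S1_cpt R ((enorm x)^-1 *: x).
  rewrite /S1 /= {1}/enorm du dotC du -enorm_sqr mulrA -expr2 -exprMn.
  by rewrite mulVf ?gt_eqF// expr1n sqrtr1.
by exists t; rewrite -xt scalerA divff ?gt_eqF// scale1r.
Qed.

Lemma enorm_distance_continuous x : continuous (fun z => - enorm (z - x)).
Proof.
move=> z A /nbhs_ballP[e /= e0 eA].
suff : nbhs z ((fun z => - enorm (z - x)) @^-1` A) by [].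
apply: filterS (nbhs_enorm z e0) => y /= yz; apply: eA; rewrite /ball/=.
apply: le_lt_trans yz; rewrite opprK addrC ler_norml.
have h1 := enormD (y - z) (z - x); have h2 := enormD (z - y) (y - x).
rewrite (enormC z y) in h2; rewrite !addrA !subrK in h1 h2.
by apply/andP; split; lra.
Qed.

(** A point outside a body is separated from it by the line through the nearest
    point of the body. *)
Lemma support_le_subset K1 K2 : convex_body K1 -> convex_body K2 ->
  (forall t, support_fun K1 (cpt t) <= support_fun K2 (cpt t)) -> K1 `<=` K2.
Proof.
move=> cb1 cb2 h12 x Kx; apply: contrapT => nKx.
have [||y] := @compact_EVT_max _ _ (fun z => - enorm (z - x)) K2 (convex_body_neq0 cb2).
- by case: cb2.
- by apply: continuous_subspaceT => z; exact: enorm_distance_continuous.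
rewrite inE => Ky ymin; pose w := x - y.
have w0 : 0 < enorm w.
  rewrite lt_def enorm_ge0 andbT; apply/eqP => /enorm_eq0/eqP.
  by rewrite subr_eq0 => /eqP xy; apply: nKx; rewrite xy.
have sep z : K2 z -> dot w (z - y) <= 0.
  move=> Kz; rewrite leNgt; apply/negP => wz.
  have q0 : 0 <= dot (z - y) (z - y) by exact: dot_ge0.
  have quad l : 0 <= l -> l <= 1 ->
      2 * l * dot w (z - y) <= l * l * dot (z - y) (z - y).
    move=> l0 l1; have Kl : K2 (y + l *: (z - y)) by exact: convex_body_segment.
    have : y + l *: (z - y) \in K2 by rewrite inE.
    move/ymin; rewrite lerN2 enormC [leRHS]enormC -/w => wl.
    have {wl} : enorm w ^+ 2 <= enorm (x - (y + l *: (z - y))) ^+ 2.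
      by rewrite ler_sqr ?nnegrE ?enorm_ge0.
    rewrite !enorm_sqr opprD addrA -/w.
    have -> : dot (w - l *: (z - y)) (w - l *: (z - y)) =
        dot w w - 2 * l * dot w (z - y) + l * l * dot (z - y) (z - y).
      by rewrite /dot /= /GRing.scale /=; ring.
    by move: (dot w w) (2 * l * _) (l * l * _) => a b c H; lra.
  have l0 : 0 < dot w (z - y) / (dot w (z - y) + dot (z - y) (z - y)).
    by rewrite divr_gt0// ltr_pwDl.
  have l1 : dot w (z - y) / (dot w (z - y) + dot (z - y) (z - y)) <= 1.
    by rewrite ler_pdivrMr ?mul1r ?lerDl// ltr_pwDl.
  have := quad _ (ltW l0) l1; set l := _ / _ in l0 l1 *.
  have lE : l * (dot w (z - y) + dot (z - y) (z - y)) = dot w (z - y).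
    by rewrite divfK// gt_eqF// ltr_pwDl.
  rewrite -mulrA mulrCA -[leRHS]mulrA ler_pM2l//.
  have lw : 0 < l * dot w (z - y) by rewrite mulr_gt0.
  by rewrite mulrDr in lE; move: (l * dot w (z - y)) (l * dot (z - y) (z - y)) (dot w (z - y)) lE lw wz => a b c *; lra.
have [t wt] := polar w0.
have dt z : dot w z = enorm w * dot (cpt t) z.
  by rewrite {1}wt /dot /= /GRing.scale /=; ring.
have s1 : support_fun K2 (cpt t) <= dot (cpt t) y.
  have [z Kz [<- _]] := support_attained (cpt t) cb2.
  by have := sep z Kz; rewrite dt pmulr_rle0// dotBr subr_le0.
have s2 : dot (cpt t) y < dot (cpt t) x.
  by rewrite -subr_gt0 -dotBr -(pmulr_rgt0 _ w0) -dt -enorm_sqr exprn_gt0.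
have := dot_le_support (cpt t) cb1 Kx.
by rewrite leNgt (le_lt_trans (h12 t))// (le_lt_trans s1).
Qed.

Lemma support_inj K1 K2 : convex_body K1 -> convex_body K2 ->
  (forall t, support_fun K1 (cpt t) = support_fun K2 (cpt t)) -> K1 = K2.
Proof.
by move=> cb1 cb2 h12; apply/seteqP; split; apply: support_le_subset => // t; rewrite h12.
Qed.

End Determination.

Section HolderFunctions.
Context {R : realType}.
Local Notation plane := (R * R)%type.
Implicit Types (f w : plane -> R) (al : R) (u v : plane).

Lemma sup_norm_ge f u : S1 u -> (`|f u|%:E <= sup_norm f)%E.
Proof. by move=> Su; apply: ereal_sup_ubound; exists u. Qed.

Lemma sup_norm_ge0 f : (0 <= sup_norm f)%E.
Proof.
by apply: le_trans (sup_norm_ge f (@cpt_S1 R 0)); rewrite lee_fin.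
Qed.

Lemma holder_seminorm_ge al f u v : S1 u -> S1 v -> u <> v ->
  ((`|f u - f v| / enorm (u - v) `^ al)%:E <= holder_seminorm al f)%E.
Proof. by move=> Su Sv uv; apply: ereal_sup_ubound; exists (u, v). Qed.

Lemma holder_seminorm_ge0 al f : (0 <= holder_seminorm al f)%E.
Proof.
have pi0 := @pi_gt0 R.
have : cpt 0 <> cpt pi :> plane by apply: cpt_inj; lra.
move=> /(holder_seminorm_ge al f (@cpt_S1 R 0) (@cpt_S1 R pi)); apply: le_trans.
by rewrite lee_fin divr_ge0// powR_ge0.
Qed.

Lemma enorm_sub_gt0 u v : u <> v -> 0 < enorm (u - v).
Proof.
move=> uv; rewrite lt_def enorm_ge0 andbT; apply/eqP => /enorm_eq0/eqP.
by rewrite subr_eq0 => /eqP.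
Qed.

Lemma holder_constant al f : holder al f -> exists2 C, 0 <= C &
  forall u v, S1 u -> S1 v -> `|f u - f v| <= C * enorm (u - v) `^ al.
Proof.
rewrite /holder /holder_norm => fin.
have sfin : (holder_seminorm al f < +oo)%E.
  by apply: le_lt_trans fin; rewrite leeDr// sup_norm_ge0.
have s0 := holder_seminorm_ge0 al f.
have sE : holder_seminorm al f = (fine (holder_seminorm al f))%:E.
  by rewrite fineK// ge0_fin_numE.
exists (fine (holder_seminorm al f)); first exact: fine_ge0.
move=> u v Su Sv; have [->|uv] := pselect (u = v).
  by rewrite !subrr normr0 mulr_ge0 ?powR_ge0 ?fine_ge0.
rewrite -ler_pdivrMr ?powR_gt0 ?enorm_sub_gt0// -lee_fin -sE.
exact: holder_seminorm_ge.
Qed.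

Lemma holder_near al f (e : R) : (holder_norm al (fun u => f u - 1)%R <= e%:E)%E ->
  forall u, S1 u -> `|f u - 1| <= e.
Proof.
move=> fe u Su; rewrite -lee_fin; apply: le_trans fe.
apply: le_trans (sup_norm_ge (fun u => f u - 1) Su) _.
by rewrite /holder_norm leeDl// holder_seminorm_ge0.
Qed.

Lemma holder_of_bounds al w C1 C2 : (forall u, S1 u -> `|w u| <= C1) ->
  (forall u v, S1 u -> S1 v -> `|w u - w v| <= C2 * enorm (u - v) `^ al) ->
  holder al w.
Proof.
move=> w1 w2; rewrite /holder /holder_norm.
apply: (@le_lt_trans _ _ (C1%:E + C2%:E)%E); last by rewrite -EFinD ltry.
apply: leeD; apply: ge_ereal_sup => _ [x Sx <-]; first by rewrite lee_fin; exact: w1.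
case: Sx => S1x S2x x12; rewrite lee_fin ler_pdivrMr ?powR_gt0 ?enorm_sub_gt0//.
exact: w2.
Qed.

Lemma holder_uniform al f (C : R) : 0 < al -> 0 <= C ->
  (forall u v, S1 u -> S1 v -> `|f u - f v| <= C * enorm (u - v) `^ al) ->
  forall e, 0 < e -> exists2 r : R, 0 < r & forall u v, S1 u -> S1 v ->
    enorm (u - v) <= r -> `|f u - f v| <= e.
Proof.
move=> al0 C0 fC e e0; have C1 : 0 < C + 1 by rewrite ltr_wpDl.
have q0 : 0 < e / (C + 1) by rewrite divr_gt0.
exists ((e / (C + 1)) `^ al^-1); first exact: powR_gt0.
move=> u v Su Sv uv; apply: le_trans (fC u v Su Sv) _.
have : enorm (u - v) `^ al <= e / (C + 1).
  apply: le_trans (ler_powR_pos (ltW al0) (enorm_ge0 _) uv) _.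
  by rewrite -powRrM mulVf ?gt_eqF// powRr1// ltW.
rewrite ler_pdivlMr//; apply: le_trans; rewrite mulrC ler_wpM2l ?powR_ge0//.
by rewrite lerDl.
Qed.

End HolderFunctions.

Section Regularity.
Context {R : realType}.
Local Notation plane := (R * R)%type.
Implicit Types (u v : plane) (s t x y : R).

Lemma powR_sub_le (q c x y : R) : 0 < q -> q < 1 -> 0 < c -> c <= x -> c <= y ->
  `|x `^ (q - 1) - y `^ (q - 1)| <= c `^ (q - 2) * `|x - y|.
Proof.
move=> q0 q1 c0; wlog xy : x y / x <= y => [hw cx cy|].
  have [xy|/ltW yx] := leP x y; first exact: hw.
  by rewrite distrC [`|x - y|]distrC; exact: hw.
move=> cx cy; move: xy; rewrite le_eqVlt => /predU1P[->|xy].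
  by rewrite !subrr normr0 mulr0.
have [z /andP[xz zy]|z /andP[xz zy] e] := @mvt R (fun w => w `^ (q - 1))
  (fun w => (q - 1) * w `^ (q - 1 - 1)) x y xy.
  by apply: is_derive1_powR; apply: lt_le_trans c0 (le_trans cx xz).
rewrite distrC [`|x - y|]distrC e normrM ler_wpM2r// normrM.
rewrite (ger0_norm (powR_ge0 _ _)) ltr0_norm ?subr_lt0// opprB.
have -> : q - 1 - 1 = q - 2 by ring.
rewrite -[leRHS]mul1r; apply: ler_pM; rewrite ?powR_ge0// ?subr_ge0 ?(ltW q1)//.
  by rewrite gerBl ltW.
by apply: ler_powR_neg => //; [lra|apply: le_trans cx (ltW xz)].
Qed.

(** The covariant derivative is the derivative in the angle. *)
Lemma cpt_derive (h : plane -> R) (dh : R -> R) s :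
  is_derive s 1 (h \o cpt) (dh s) ->
  is_derive (0 : R) 1 (fun t => h (geodesic (cpt s) t)) (dh s).
Proof.
move=> hd; have -> : (fun t => h (geodesic (cpt s) t)) = (fun t => (h \o cpt) (t + s)).
  by apply/funext => t; rewrite geodesic_cpt addrC.
by apply: derive_shift_arg; rewrite add0r.
Qed.

Variables (p al C M : R) (f : plane -> R) (K : set plane) (h dh : R -> R) (d : R).
Hypotheses (p0 : 0 < p) (p1 : p < 1) (al0 : 0 < al) (al1 : al < 1) (d1 : d < 1).
Hypotheses (cbK : convex_body K) (C0 : 0 <= C).
Hypothesis (f_le : forall u, S1 u -> `|f u| <= M).
Hypothesis (fC : forall u v, S1 u -> S1 v -> `|f u - f v| <= C * enorm (u - v) `^ al).
Hypothesis nos : near_one_solution p d (f \o cpt) (fun t => support_fun K (cpt t)) dh.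

(** The equation gives the second derivative as a combination of [f] and of powers
    of the support function, which is Lipschitz and away from zero. *)
Lemma near_one_C2holder : C2holder al (support_fun K).
Proof.
have hd1 s := cpt_derive (nos_derive nos s).
have cd s : circle_derive (support_fun K) (cpt s) = dh s by exact: derive_deriv1.
have dd s : is_derive s 1 (circle_derive (support_fun K) \o cpt)
    (f (cpt s) * support_fun K (cpt s) `^ (p - 1) - support_fun K (cpt s)).
  have -> : circle_derive (support_fun K) \o cpt = dh by apply/funext => t; exact: cd.
  exact: (nos_derive2 nos).
have hd2 s := cpt_derive (dh := fun s => f (cpt s) * support_fun K (cpt s) `^ (p - 1)
  - support_fun K (cpt s)) (dd s).
have cdd u : S1 u -> circle_derive (circle_derive (support_fun K)) u =
    f u * support_fun K u `^ (p - 1) - support_fun K u.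
  by move=> /S1_cpt[s _ ->]; apply: derive_deriv1 (hd2 s).
pose c := 1 - d; have c0 : 0 < c by rewrite subr_gt0.
have hb u : S1 u -> c <= support_fun K u <= 1 + d.
  move=> /S1_cpt[s _ ->]; have := nos_near nos s; rewrite ler_distl => /andP[a b].
  by rewrite a b.
have pb u : S1 u -> 0 <= support_fun K u `^ (p - 1) <= c `^ (p - 1).
  move=> Su; rewrite powR_ge0/=; apply: ler_powR_neg => //; first by rewrite subr_le0 ltW.
  by have /andP[] := hb u Su.
have [B B0 KB] := convex_body_bounded cbK.
have M0 : 0 <= M by apply: le_trans (f_le (@cpt_S1 R 0)).
have eal u v : S1 u -> S1 v -> enorm (u - v) <= 2 * enorm (u - v) `^ al.
  move=> Su Sv; have [->|n0] := eqVneq (enorm (u - v)) 0.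
    by rewrite mulr_ge0 ?powR_ge0.
  have n1 : 0 < enorm (u - v) by rewrite lt_def n0 enorm_ge0.
  have e2 : enorm (u - v) <= 2.
    by have := enormD u (- v); rewrite enormN Su Sv.
  rewrite -[leLHS](powRr1 (ltW n1)) -{1}(subrK al 1) powRD_gt0//.
  rewrite ler_wpM2r ?powR_ge0//.
  apply: le_trans (ler_powR_pos _ (ltW n1) e2) _; first by rewrite subr_ge0 ltW.
  rewrite -[leRHS]powRr1//; apply: ler_powR; first by rewrite ler1n.
  by rewrite gerBl ltW.
have hl u v : S1 u -> S1 v ->
    `|support_fun K u - support_fun K v| <= B * 2 * enorm (u - v) `^ al.
  move=> Su Sv; apply: le_trans (support_lipschitz _ _ cbK KB) _.
  by rewrite -mulrA ler_wpM2l// eal.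
split.
- by move=> u /S1_cpt[s _ ->]; exact: (@ex_derive _ _ _ _ _ _ _ (hd1 s)).
- by move=> u /S1_cpt[s _ ->]; exact: (@ex_derive _ _ _ _ _ _ _ (hd2 s)).
apply: (@holder_of_bounds _ _ _ (M * c `^ (p - 1) + (1 + d))
  (C * c `^ (p - 1) + M * (c `^ (p - 2) * (B * 2)) + B * 2)).
  move=> u Su; rewrite cdd//; apply: le_trans (ler_normB _ _) _. apply: lerD.
    have /andP[q1 q2] := pb u Su.
    by rewrite normrM ler_pM// ?f_le// ger0_norm.
  have /andP[q1 q2] := hb u Su; rewrite ger0_norm//.
  exact: le_trans (ltW c0) q1.
move=> u v Su Sv; rewrite !cdd//.
set a := support_fun K u; set b := support_fun K v; set E := enorm (u - v) `^ al.
have -> : f u * a `^ (p - 1) - a - (f v * b `^ (p - 1) - b) =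
  (f u - f v) * a `^ (p - 1) + f v * (a `^ (p - 1) - b `^ (p - 1)) - (a - b) by ring.
apply: le_trans (ler_normB _ _) _; rewrite [leRHS]mulrDl; apply: lerD; last exact: hl.
apply: le_trans (ler_normD _ _) _; rewrite [leRHS]mulrDl; apply: lerD; rewrite normrM.
  have /andP[q1 q2] := pb u Su.
  by rewrite mulrAC; apply: ler_pM => //; [exact: fC|rewrite ger0_norm].
rewrite -mulrA; apply: ler_pM => //; first exact: f_le.
have /andP[ca _] := hb u Su; have /andP[cb _] := hb v Sv.
apply: le_trans (powR_sub_le p0 p1 c0 ca cb) _.
by rewrite -mulrA ler_wpM2l ?powR_ge0//; exact: hl.
Qed.

End Regularity.

Theorem theorem1p2 (R : realType) (p : R) (hp0 : 0 < p) (hp1 : p < 1) :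
  exists eps0 : R, [/\ 0 < eps0, eps0 < 1 &
    forall (alpha : R) (f : R * R -> R),
      0 < alpha -> alpha < 1 ->
      holder alpha f ->
      (holder_norm alpha (fun u => f u - 1)%R <= eps0%:E)%E ->
      (exists! K : set (R * R), Lp_Minkowski_solution p f K) /\
      (forall K : set (R * R), Lp_Minkowski_solution p f K ->
         (forall u, S1 u -> 0 < support_fun K u) /\
         C2holder alpha (support_fun K))].
Proof.
have [d [d0 d1 [e1 e10 ode]]] := near_one_existence_uniqueness hp0 hp1.
have [e2 e20 apriori] := a_priori_near_one hp0 hp1 d0.
pose eps := Num.min (1 / 2) (Num.min e1 e2).
have eps_gt0 : 0 < eps by rewrite !lt_min e10 e20 divr_gt0.
have eps_half : eps <= 1 / 2 by rewrite !ge_min lexx.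
have eps_lt1 : eps < 1 by lra.
have eps1 : eps <= e1 by rewrite !ge_min lexx orbT.
have eps2 : eps <= e2 by rewrite !ge_min lexx !orbT.
exists eps; split => // al f al0 al1 fh fnorm.
have f1 := holder_near fnorm.
have [C C0 fC] := holder_constant fh.
have funi := holder_uniform al0 C0 fC.
have fc : circle_continuous f.
  move=> u Su e epos; have [|r r0 rf] := funi (e / 2); first by rewrite divr_gt0.
  exists r => // v Sv vu; apply: le_lt_trans (rf v u Sv Su (ltW vu)) _; lra.
have cf t : {for t, continuous (f \o cpt)} by exact: circle_continuous_cpt.
have fper t : (f \o cpt) (t + 2 * pi) = (f \o cpt) t by rewrite /= cpt_per.
have f1' t : `|(f \o cpt) t - 1| <= e1 by apply: le_trans (f1 _ (cpt_S1 t)) eps1.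
have [exn unin] := ode _ cf fper f1'.
have near K : Lp_Minkowski_solution p f K -> exists dh,
    near_one_solution p d (f \o cpt) (fun t => support_fun K (cpt t)) dh.
  move=> sK; have cb : convex_body K by case: sK => -[].
  have HX t : exists x, K x /\ dot (cpt t) x = support_fun K (cpt t).
    by have [x Kx [xt _]] := support_attained (cpt t) cb; exists x.
  have [X XK] := choice HX.
  have S := solution_circle_solution eps_lt1 fc f1 sK
    (fun t => (XK t).1) (fun t => (XK t).2).
  have hn := apriori _ _ _ _ S (ltW eps_gt0) eps2.
  have hp t : 0 < support_fun K (cpt t).
    by have := hn t; rewrite ltr_distl => /andP[+ _]; apply: le_lt_trans; rewrite subr_ge0 ltW.
  exists (fun t => dot (ctan t) (X t)); split => t.
  - exact/ltW/hn.
  - by rewrite cpt_per.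
  - exact: (sol_derive S (hp t)).
  - exact: (sol_derive2 S (hp t)).
split; last first.
  move=> K sK; have cb : convex_body K by case: sK => -[].
  have [dh nos] := near K sK; split.
    move=> u /S1_cpt[t _ ->]; have := nos_near nos t; rewrite ler_distl => /andP[+ _].
    by apply: lt_le_trans; rewrite subr_gt0.
  apply: (@near_one_C2holder R p al C (1 + eps) f K dh d) => //.
  move=> u Su; have := f1 u Su; rewrite ler_distl => /andP[fl fu].
  rewrite ger0_norm//; apply: le_trans fl; lra.
have [h [dh nos]] := exn.
pose m := Num.min (1 - d) (1 / 2).
have m0 : 0 < m by rewrite lt_min subr_gt0 d1 divr_gt0.
have hb t : m <= h t <= 1 + d.
  have := nos_near nos t; rewrite ler_distl => /andP[a ->]; rewrite andbT.
  by apply: le_trans a; rewrite ge_min lexx.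
have flo u : S1 u -> m <= f u.
  move=> Su; have := f1 u Su; rewrite ler_distl => /andP[a _]; apply: le_trans a.
  by apply: (@le_trans _ _ (1 / 2)); [rewrite ge_min lexx orbT|lra].
have funi' e : 0 < e -> exists2 r, 0 < r &
    forall s t, `|s - t| <= r -> `|f (cpt s) - f (cpt t)| <= e.
  move=> epos; have [r r0 rf] := funi e epos; exists r => // s t st.
  by apply: rf; [exact: cpt_S1|exact: cpt_S1|exact: le_trans (chord_le _ _) st].
have solK := wulff_solution hp0 hp1 (nos_derive nos) (nos_derive2 nos)
  (nos_periodic nos) m0 hb fc flo funi'.
exists (wulff h); split=> // K' solK'.
apply: support_inj; [by case: solK => -[]|by case: solK' => -[]|].
have [dh1 nos1] := near _ solK; have [dh2 nos2] := near _ solK'.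
exact: unin nos1 nos2.
Qed.
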